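(* Let $(u,\rho)$ be a global solution of the prescribed curvature flow concentrating along $t_l\to\infty$ at $z_0\in\partial B$ (as described in the context), let $R=R(z_0)$, and let $\Phi=\Phi(t)\in M$ be the conformal maps of the normalized companion flow for this $R$. For each $l$ put $t_0=t_l$ and rotate coordinates so that $\Phi(t_0)=\Phi_{a_0}$ with $0<a_0<1$; for $t$ near $t_0$ write $\Phi(t)=\Phi_{e^{\mathrm i\phi(t)}a(t)}$ with $0<a(t)<1$, $\phi(t)\in\mathbb R$, $a(t_0)=a_0$, $\phi(t_0)=0$, and let $\varepsilon_0=\frac{1-a_0}{1+a_0}$. Write $\Xi=\Xi_1+\mathrm i\,\Xi_2$ for the vector $\Xi=(\Xi_1,\Xi_2)$ evaluated at $t_0$. Then, with real coefficients $A_i=A_i(z_0)>0$, $i=1,2$, and complex errors $o(1)\to0$ in $\mathbb C$ as $l\to\infty$, there holds $$\Big((A_1+o(1))\frac{da}{dt}+\mathrm i\,(A_2+o(1))\frac{d\phi}{dt}\Big)\Big|_{t=t_0}=-\varepsilon_0\,\Xi .$$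
   Context: $B\subset\mathbb R^2\cong\mathbb C$ is the open unit disc, $\nu_0$ the outward unit normal, $ds_0$ arc length on $\partial B$. $f\in C^\infty(\bar B)$, $j\in C^\infty(\partial B)$ are strictly positive and $j$ is extended harmonically to $B$. It is assumed that the problem $-\Delta u=fe^{2u}$ in $B$, $\partial u/\partial\nu_0+1=je^u$ on $\partial B$ has no solution. Flow. For a function $u$ set $g=e^{2u}g_{\mathbb R^2}$, $K=K_g=-e^{-2u}\Delta u$ in $B$, $k=k_g=e^{-u}(\partial u/\partial\nu_0+1)$ on $\partial B$. The prescribed curvature flow with smooth initial data $(u_0,\rho_0)$, $0<\rho_0<\pi$, is the system $u_t=\alpha f-K$ in $B$, $u_t=\beta j-k$ on $\partial B$, $\rho_t=\log(\beta^2/\alpha)$, with $0<\rho(t)<\pi$ and $\alpha(t)=\frac{2\rho}{\int_Bfe^{2u}dz}$, $\beta(t)=\frac{2(\pi-\rho)}{\int_{\partial B}je^uds_0}$; $u$ is continuous on $\bar B\times[0,\infty)$ and smooth for $t>0$. Note that $K-\alpha f=k-\beta j$ on $\partial B$ for $t>0$. Normalization. $M=\{e^{\mathrm i\theta}\Phi_a:\ |a|<1,\theta\in\mathbb R\}$ with $\Phi_a(z)=\frac{z+a}{1+\bar az}$. For $z\in\bar B$ let $R(z)=\sqrt{1+j(z)^2/f(z)}-j(z)/\sqrt{f(z)}\in(0,1)$. Let $\Psi(z)=\big(\frac{2z}{1+|z|^2},\frac{1-|z|^2}{1+|z|^2}\big)\in S^2$ (inverse stereographic projection), $\Psi_R(z)=\Psi(Rz)$,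 $\psi_R(z)=\frac{2Rz}{1+R^2|z|^2}$. For each $t$, $\Phi=\Phi(t)\in M$ (normalized with respect to rotations so that it is of the form $\Phi_p$, $p=p(t)\in B$) is such that $v=v(t)=u(t)\circ\Phi+\frac12\log\det d\Phi$ satisfies $\frac12\int_B\psi_Re^{2v}dz+\int_{\partial B}\psi_Re^vds_0=0$; $h=\Phi^*g=e^{2v}g_{\mathbb R^2}$. Concentration at $z_0$ along $t_l\to\infty$ means: $\Phi(t_l)\to z_0$ weakly in $H^1(B)$, $\alpha(t_l)\to\alpha>0$, $\beta(t_l)\to\beta>0$ with $\alpha=\beta^2$, and for $R=R(z_0)$, $v(t_l)\to v_\infty(z)=\log\frac{2R/\sqrt{\alpha f(z_0)}}{1+R^2|z|^2}$ in $H^{3/2}(B)\cap H^1(\partial B)\cap L^\infty(B)$. Definition of $\Xi$. Let $S^2_R=\Psi_R(B)\subset S^2$, $\pi_R=\Psi_R^{-1}$, $\bar h=\pi_R^*h$ (a metric on $S^2_R$, with area element $d\mu_{\bar h}$ and boundary line element $ds_{\bar h}$), $X_1,X_2,X_3$ the restrictions to $S^2$ of the coordinate functions of $\mathbb R^3$. Let $w=K\circ\Phi-\alpha f\circ\Phi$ and $w_R=w\circ\pi_R$. Then $$\Xi_i=\int_{S^2_R}X_iw_R\,d\mu_{\bar h}+\int_{\partial S^2_R}X_iw_R\,ds_{\bar h},\qquad i=1,2.$$ *)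

(* Defs.v *)
From HB Require Import structures.
From mathcomp Require Import all_boot all_order all_algebra.
From mathcomp Require Import all_classical all_reals all_analysis.
From mathcomp Require Import complex ring.

Set Implicit Arguments.
Unset Strict Implicit.
Unset Printing Implicit Defensive.

Import Order.TTheory GRing.Theory Num.Theory.
Import numFieldNormedType.Exports.

Local Open Scope classical_set_scope.
Local Open Scope ring_scope.

(** Points of R^2 are pairs, so that the product topology and the product
    Lebesgue measure are available; they are converted to [R[i]] only where
    complex arithmetic is needed. A function on the closed disc is represented
    by a function on the whole plane, and a function in C^oo of the closed disc
    whose derivatives up to the boundary are used by a C^oo representative on
    the plane. Only the values on the closed disc ever matter; in particular
    the (continuous) derivatives of the representative on the boundary circle
    are determined by these values. *)

Notation plane R := (R * R)%type.

Section Plane.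
Context {R : realType}.
Implicit Types (z p : plane R) (g w : plane R -> R).

Definition toC z : R[i] := Complex z.1 z.2.
Definition ofC (c : R[i]) : plane R := (complex.Re c, complex.Im c).

Definition nrm2 z : R := z.1 ^+ 2 + z.2 ^+ 2.
Definition euclid z : R := Num.sqrt (nrm2 z).

Definition disc : set (plane R) := [set z | nrm2 z < 1].
Definition cdisc : set (plane R) := [set z | nrm2 z <= 1].
Definition circle : set (plane R) := [set z | nrm2 z = 1].

Definition cis (th : R) : plane R := (cos th, sin th).

Definition rotp (th : R) z : plane R := ofC (toC (cis th) * toC z).

Definition mu2 := (@lebesgue_measure R \x @lebesgue_measure R)%E.

Definition intB g : R := \int[mu2]_(z in disc) g z.

Definition turn : set R := `[0, 2 * pi]%classic.

Definition intS g : R := \int[@lebesgue_measure R]_(th in turn) g (cis th).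

Definition Dx g : plane R -> R := 'D_((1, 0) : plane R) g.
Definition Dy g : plane R -> R := 'D_((0, 1) : plane R) g.
Definition lap g z : R := Dx (Dx g) z + Dy (Dy g) z.

(** On the unit circle the outward unit normal at [z] is [z] itself. *)
Definition Dnu g z : R := 'D_z g z.

(** [F] is of class C^k on the open set [D]. *)
Fixpoint Ck_on (V : normedModType R) (D : set V) (k : nat) (F : V -> R) : Prop :=
  (forall x, D x -> {for x, continuous F}) /\
  (if k is k'.+1 then
     forall v : V, (forall x, D x -> derivable F x v) /\ Ck_on D k' ('D_v F)
   else True).

Definition smooth_on (V : normedModType R) (D : set V) (F : V -> R) : Prop :=
  forall k, Ck_on D k F.

Definition smooth_cdisc g : Prop :=
  exists G, smooth_on (setT : set (plane R)) G /\ forall z, cdisc z -> g z = G z.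

(** [j] is smooth on the boundary circle and harmonically extended to the disc *)
Definition smooth_bdry_harmonic (j : plane R -> R) : Prop :=
  [/\ smooth_on (setT : set R) (fun th : R => j (cis th)),
      {within cdisc, continuous j},
      smooth_on disc j &
      forall z, disc z -> lap j z = 0].

(** * The prescribed curvature problem and the flow *)

Definition solves_curvature (f j u : plane R -> R) : Prop :=
  [/\ smooth_on (setT : set (plane R)) u,
      forall z, disc z -> - lap u z = f z * expR (2 * u z) &
      forall z, circle z -> Dnu u z + 1 = j z * expR (u z)].

Definition Kg (u : plane R -> R) z : R := - expR (- (2 * u z)) * lap u z.
Definition kg (u : plane R -> R) z : R := expR (- u z) * (Dnu u z + 1).

Definition alpha_ (f u : plane R -> R) (rho : R) : R :=
  2 * rho / intB (fun z => f z * expR (2 * u z)).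
Definition beta_ (j u : plane R -> R) (rho : R) : R :=
  2 * (pi - rho) / intS (fun z => j z * expR (u z)).

Record curvature_flow (f j : plane R -> R) (u : R -> plane R -> R)
    (rho : R -> R) : Prop := CurvatureFlow {
  flow_init : smooth_on (setT : set (plane R)) (u 0);
  flow_cont : {within [set q : R * plane R | 0 <= q.1 /\ cdisc q.2],
                continuous (fun q : R * plane R => u q.1 q.2)};
  flow_smooth : smooth_on [set q : R * plane R | 0 < q.1]
                  (fun q : R * plane R => u q.1 q.2);
  flow_rho_cont : {within [set t : R | 0 <= t], continuous rho};
  flow_rho_range : forall t, 0 <= t -> 0 < rho t < pi;
  flow_inside : forall t z, 0 < t -> disc z ->
    derive1 (fun s : R => u s z) t = alpha_ f (u t) (rho t) * f z - Kg (u t) z;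
  flow_bdry : forall t z, 0 < t -> circle z ->
    derive1 (fun s : R => u s z) t = beta_ j (u t) (rho t) * j z - kg (u t) z;
  flow_rho : forall t : R, 0 < t -> is_derive t (1 : R) rho
    (ln (beta_ j (u t) (rho t) ^+ 2 / alpha_ f (u t) (rho t)))
}.

(** * The normalized normalized_companion flow *)

Definition Phi p z : plane R :=
  ofC ((toC z + toC p) / (1 + conjc (toC p) * toC z)).

Definition jacdet (F : plane R -> plane R) z : R :=
  let F1 := fun y => (F y).1 in let F2 := fun y => (F y).2 in
  Dx F1 z * Dy F2 z - Dy F1 z * Dx F2 z.

Definition pullback (u : plane R -> R) (F : plane R -> plane R) z : R :=
  u (F z) + 2^-1 * ln (jacdet F z).

Definition R_of (f j : plane R -> R) z : R :=
  Num.sqrt (1 + j z ^+ 2 / f z) - j z / Num.sqrt (f z).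

Definition psi (r : R) z : plane R :=
  (2 * r * z.1 / (1 + r ^+ 2 * nrm2 z), 2 * r * z.2 / (1 + r ^+ 2 * nrm2 z)).

Definition psi_balanced (r : R) (v : plane R -> R) : Prop :=
  2^-1 * intB (fun z => (psi r z).1 * expR (2 * v z))
    + intS (fun z => (psi r z).1 * expR (v z)) = 0 /\
  2^-1 * intB (fun z => (psi r z).2 * expR (2 * v z))
    + intS (fun z => (psi r z).2 * expR (v z)) = 0.

(** [Phi (p t)] is the normalizing element of the Moebius group of the disc
    with trivial rotation part. *)
Definition normalized_companion (r : R) (u : R -> plane R -> R) (p : R -> plane R) : Prop :=
  forall t, 0 <= t -> disc (p t) /\ psi_balanced r (pullback (u t) (Phi (p t))).

(** * Concentration *)

Definition test_fun (eta : plane R -> R) : Prop :=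
  smooth_on (setT : set (plane R)) eta /\
  exists K : set (plane R),
    [/\ compact K, K `<=` disc & forall z, ~ K z -> eta z = 0].

(** [g] is in H^1 of the disc with weak gradient [(gx, gy)] *)
Definition H1_disc (g gx gy : plane R -> R) : Prop :=
  [/\ forall h, [\/ h = g, h = gx | h = gy] ->
        measurable_fun disc h /\
        mu2.-integrable disc (EFin \o (fun z => h z ^+ 2)),
      forall eta, test_fun eta ->
        intB (fun z => g z * Dx eta z) = - intB (fun z => gx z * eta z) &
      forall eta, test_fun eta ->
        intB (fun z => g z * Dy eta z) = - intB (fun z => gy z * eta z)].

(** weak convergence in H^1 of the disc of smooth functions to a constant *)
Definition weakH1_to_cst (F : nat -> plane R -> R) (c : R) : Prop :=
  forall g gx gy, H1_disc g gx gy ->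
    (fun l => intB (fun z => (F l z - c) * g z)
            + intB (fun z => Dx (F l) z * gx z)
            + intB (fun z => Dy (F l) z * gy z)) @ \oo --> (0 : R).

(** Squared norms, for functions smooth up to the boundary. The seminorm in
    H^{3/2} is the Slobodeckij seminorm of order 1/2 of the gradient, with
    kernel |x - y|^{-(2 + 2 * 1/2)}. *)
Definition H32_sq w : \bar R :=
  (\int[mu2]_(x in disc) (w x ^+ 2 + Dx w x ^+ 2 + Dy w x ^+ 2)%:E
   + \int[mu2]_(x in disc) \int[mu2]_(y in disc)
       (((Dx w x - Dx w y) ^+ 2 + (Dy w x - Dy w y) ^+ 2)
          / euclid (x - y) ^+ 3)%:E)%E.

Definition H1S_sq w : \bar R :=
  let wS := fun th : R => w (cis th) in
  (\int[@lebesgue_measure R]_(th in turn)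
     (wS th ^+ 2 + derive1 wS th ^+ 2)%:E)%E.

Definition Linf w : \bar R :=
  ('N[mu2]_+oo[(fun z => ((\1_disc z : R) * w z)%R%:E)])%E.

Definition v_infty (f : plane R -> R) (z0 : plane R) (r a : R) z : R :=
  ln ((2 * r / Num.sqrt (a * f z0)) / (1 + r ^+ 2 * nrm2 z)).

Definition concentrates (f j : plane R -> R) (u : R -> plane R -> R)
    (rho : R -> R) (p : R -> plane R) (t : nat -> R) (z0 : plane R) : Prop :=
  let w := fun (a : R) (l : nat) (z : plane R) =>
    pullback (u (t l)) (Phi (p (t l))) z
      - v_infty f z0 (R_of f j z0) a z in
  [/\ t @ \oo --> +oo,
      weakH1_to_cst (fun l z => (Phi (p (t l)) z).1) z0.1,
      weakH1_to_cst (fun l z => (Phi (p (t l)) z).2) z0.2 &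
      exists a b : R,
        [/\ 0 < a, 0 < b, a = b ^+ 2,
            (fun l => alpha_ f (u (t l)) (rho (t l))) @ \oo --> a &
            (fun l => beta_ j (u (t l)) (rho (t l))) @ \oo --> b] /\
        [/\ (fun l => H32_sq (w a l)) @ \oo --> 0%E,
            (fun l => H1S_sq (w a l)) @ \oo --> 0%E &
            (fun l => Linf (w a l)) @ \oo --> 0%E]].

(** * The vector Xi *)

Definition Psi (r : R) z : plane R * R :=
  let y := (r * z.1, r * z.2) in
  (2 * y.1 / (1 + nrm2 y), 2 * y.2 / (1 + nrm2 y),
   (1 - nrm2 y) / (1 + nrm2 y)).

Definition piR (r : R) (x : plane R * R) : plane R :=
  (x.1.1 / (1 + x.2) / r, x.1.2 / (1 + x.2) / r).

Lemma PsiK (r : R) : 0 < r -> cancel (Psi r) (piR r).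
Proof.
move=> r0 [x y]; rewrite /piR /Psi /nrm2 /=.
have d0 : 1 + ((r * x) ^+ 2 + (r * y) ^+ 2) != 0.
  by rewrite lt0r_neq0// ltr_wpDr// addr_ge0// sqr_ge0.
have d2 : 1 + ((r * x) ^+ 2 + (r * y) ^+ 2) + (1 - ((r * x) ^+ 2 + (r * y) ^+ 2)) != 0.
  by rewrite addrACA subrr addr0 -mulr2n pnatr_eq0.
by congr pair; field; rewrite lt0r_neq0 ?d0 ?d2.
Qed.

(** The metric on the cap [Psi r (disc)] obtained from [e^{2v} |dz|^2] by
    transport along [Psi r] reads [e^{2v} |dz|^2] in the global chart
    [piR r]; its area and line elements are [e^{2v} dz] and [e^v ds_0] there. *)
Definition int_cap (r : R) (v : plane R -> R) (F : plane R * R -> R) : R :=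
  intB (fun z => F (Psi r z) * expR (2 * v z)).
Definition int_cap_bdry (r : R) (v : plane R -> R) (F : plane R * R -> R) : R :=
  intS (fun z => F (Psi r z) * expR (v z)).

Definition Xi_coord (X : plane R * R -> R) (f u : plane R -> R) (rho r : R) p : R :=
  let w := fun z => Kg u (Phi p z) - alpha_ f u rho * f (Phi p z) in
  let wR := fun x => w (piR r x) in
  let v := pullback u (Phi p) in
  int_cap r v (fun x => X x * wR x) + int_cap_bdry r v (fun x => X x * wR x).

Definition Xi (f u : plane R -> R) (rho r : R) p : R[i] :=
  Complex (Xi_coord (fun x => x.1.1) f u rho r p)
          (Xi_coord (fun x => x.1.2) f u rho r p).

(** In the coordinates rotated by [th] the flow [(u, rho)] for [(f, j)] becomes
    the flow [(fun t => rotf th (u t), rho)] for [(rotf th f, rotf th j)], and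
    [Phi p] becomes [rotp (- th) \o Phi p \o rotp th = Phi (rotp (- th) p)]. *)
Definition rotf (th : R) g : plane R -> R := fun z => g (rotp th z).

Definition little_o1 (e : nat -> R[i]) : Prop :=
  (fun l => complex.Re (e l)) @ \oo --> (0 : R) /\
  (fun l => complex.Im (e l)) @ \oo --> (0 : R).

End Plane.

(* Main.v *)
(** Both integrals of the balance condition are invariant under the Moebius
    group, so this condition reads [F (p t, u t) = 0] with [F (p, u)] the
    integral of [psi_r o Phi_p^-1] against half the area plus the boundary
    length of [e^{2u} |dz|^2], and [p] can be differentiated by the implicit
    function theorem. In the normalized picture the [p]-derivative of [F] is
    [- M / (1 - |p|^2)] for an explicit positive definite matrix [M] of integrals
    of [v], and the [t]-derivative is [- Xi], because [u_t = alpha f - K] holds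
    up to the boundary. Hence [M p' = - (1 - |p|^2) Xi], and in polar
    coordinates [p' = (a', a phi')] and [(1 - a^2) / (1 + a)^2 = eps0].
    Since [v] converges uniformly to a radial profile, [M] tends to a scalar
    matrix. The scale of this profile depends on [z0] only, as
    [1/2 int e^{2u} + int e^u] is conserved by the flow; testing the weak
    convergence with a constant gives [a -> 1]. *)

Require Import Defs.
From mathcomp Require Import all_boot all_order all_algebra.
From mathcomp Require Import all_classical all_reals all_analysis.
From mathcomp Require Import measurable_realfun ess_sup_inf complex ring lra.

Set Implicit Arguments.
Unset Strict Implicit.
Unset Printing Implicit Defensive.

Import Order.TTheory GRing.Theory Num.Theory.
Import numFieldNormedType.Exports.

Local Open Scope classical_set_scope.
Local Open Scope ring_scope.

(* ssrint has a lemma named [intS]. *)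
Local Notation intS := Defs.intS.
Local Notation mplane R := (measurableTypeR R * measurableTypeR R)%type.

(** Two devices carry the proof. Invariance of the integrals under rotations and Moebius maps is
    obtained by deforming the identity through a path of maps, [Phi (s p)] with s from 0 to 1: the
    pulled back density solves a continuity equation whose flux is tangent to the circle, so its
    total stays constant by the divergence theorem, which is in turn reduced to Fubini and
    one-variable antiderivatives. Secondly, the polar coordinates of p are merely continuous at t_0.
    As psi_r o Phi_p^-1 is a quotient of real polynomials of degree 2 in p, its increments factor
    exactly through divided differences; the balance condition thus becomes a linear system for p(s)
    - p(t_0) with coefficients continuous at t_0, solved by Cramer's rule. The rotation angle at t_l
    need not converge, and the errors are chosen before it is given; they vanish because M tends to
    a scalar matrix. They are complex since the off-diagonal entry of the rotated M couples a' to
    the imaginary part and a phi' to the real part. Dividing by (1 + a)^2 to produce eps0 makes both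
    A_i a quarter of the limit of the diagonal of M. *)

Definition cont_at (R : realType) (T : topologicalType) (g : T -> R) (z : T) : Prop :=
  g @ z --> g z.

(** Continuity in the plane at the points of the closed disc, not continuity of the restriction. It
    holds for the flow at positive times and for explicit formulas, while [f], prescribed only on
    the closed disc, is first exchanged for a smooth representative. *)
Definition cont_cdisc (R : realType) (g : plane R -> R) : Prop :=
  forall z, cdisc z -> cont_at g z.

(** Continuity in the angle, the form in which the regularity of [j] along the circle is given. *)
Definition cont_circle (R : realType) (g : plane R -> R) : Prop :=
  forall th : R, cont_at (fun t : R => g (cis t)) th.

(** * Rules for continuity at a point *)

Section ContinuityRules.
Context {R : realType} {T : topologicalType}.
Implicit Types (f g : T -> R) (z : T).

Lemma cont_at_cst (c : R) z : cont_at (fun=> c) z.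
Proof. exact: cvg_cst. Qed.

Lemma cont_atD f g z :
  cont_at f z -> cont_at g z -> cont_at (fun x => f x + g x) z.
Proof. exact: cvgD. Qed.

Lemma cont_atN f z : cont_at f z -> cont_at (fun x => - f x) z.
Proof. exact: cvgN. Qed.

Lemma cont_atM f g z :
  cont_at f z -> cont_at g z -> cont_at (fun x => f x * g x) z.
Proof. exact: cvgM. Qed.

Lemma cont_atX f n z : cont_at f z -> cont_at (fun x => f x ^+ n) z.
Proof.
move=> cf; elim: n => [|n IH]; first exact: cont_at_cst.
rewrite /cont_at exprS; under eq_fun do rewrite exprS.
exact: cvgM.
Qed.

Lemma cont_atV f z : f z != 0 -> cont_at f z -> cont_at (fun x => (f x)^-1) z.
Proof. by move=> fz; apply: cvgV. Qed.

Lemma cont_at_comp (S : topologicalType) (h : S -> R) (f : T -> S) z :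
  cont_at h (f z) -> f @ z --> f z -> cont_at (fun x => h (f x)) z.
Proof. by move=> ch cf; apply: cvg_comp cf ch. Qed.

Lemma cont_at_comp1 (h : R -> R) f z :
  cont_at h (f z) -> cont_at f z -> cont_at (fun x => h (f x)) z.
Proof. exact: cont_at_comp. Qed.

Lemma cont_at_expR f z : cont_at f z -> cont_at (fun x => expR (f x)) z.
Proof. by move=> cf; apply: cont_at_comp1 => //; apply: continuous_expR. Qed.

Lemma cont_at_cos f z : cont_at f z -> cont_at (fun x => cos (f x)) z.
Proof. by move=> cf; apply: cont_at_comp1 => //; apply: continuous_cos. Qed.

Lemma cont_at_sin f z : cont_at f z -> cont_at (fun x => sin (f x)) z.
Proof. by move=> cf; apply: cont_at_comp1 => //; apply: continuous_sin. Qed.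

Lemma cont_at_ln f z : 0 < f z -> cont_at f z -> cont_at (fun x => ln (f x)) z.
Proof. by move=> f0 cf; apply: cont_at_comp1 => //; apply: continuous_ln. Qed.

Lemma cont_at_comp2 (k : plane R -> R) f g z :
  cont_at k (f z, g z) -> cont_at f z -> cont_at g z ->
  cont_at (fun x => k (f x, g x)) z.
Proof.
move=> ck cf cg; apply: (@cont_at_comp _ k (fun x => (f x, g x))) => //.
exact: (cvg_pair cf cg).
Qed.

Lemma cont_at_pair (S : topologicalType) (U : R -> S -> R) f (g : T -> S) z :
  cont_at (fun q : R * S => U q.1 q.2) (f z, g z) -> cont_at f z ->
  g @ z --> g z -> cont_at (fun x => U (f x) (g x)) z.
Proof.
move=> ck cf cg.
apply: (@cont_at_comp _ (fun q : R * S => U q.1 q.2) (fun x => (f x, g x))) => //.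
exact: (cvg_pair cf cg).
Qed.

Lemma cont_at_near f g z :
  (\forall x \near z, f x = g x) -> cont_at f z -> cont_at g z.
Proof.
move=> fg cf; rewrite /cont_at -(nbhs_singleton fg).
by apply: cvg_trans cf; apply: near_eq_cvg; near=> x; rewrite (near fg x).
Unshelve. all: by end_near. Qed.

End ContinuityRules.

Section ContinuityCoordinates.
Context {R : realType}.

Lemma cont_at_id (z : R) : cont_at (fun x => x) z.
Proof. exact: cvg_id. Qed.

Lemma cont_at_fst (T : topologicalType) (q : R * T) :
  cont_at (fun q : R * T => q.1) q.
Proof. exact: cvg_fst. Qed.

Lemma cont_at_snd (T : topologicalType) (q : T * R) :
  cont_at (fun q : T * R => q.2) q.
Proof. exact: cvg_snd. Qed.

Lemma cont_at_snd1 (T : topologicalType) (q : T * plane R) :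
  cont_at (fun q : T * plane R => q.2.1) q.
Proof. by apply: (@cont_at_comp _ _ _ fst) => //; [exact: cvg_fst|exact: cvg_snd]. Qed.

Lemma cont_at_snd2 (T : topologicalType) (q : T * plane R) :
  cont_at (fun q : T * plane R => q.2.2) q.
Proof. by apply: (@cont_at_comp _ _ _ snd) => //; [exact: cvg_snd|exact: cvg_snd]. Qed.

Lemma cont_at_fst1 (T : topologicalType) (q : plane R * T) :
  cont_at (fun q : plane R * T => q.1.1) q.
Proof. by apply: (@cont_at_comp _ _ _ fst) => //; [exact: cvg_fst|exact: cvg_fst]. Qed.

Lemma cont_at_fst2 (T : topologicalType) (q : plane R * T) :
  cont_at (fun q : plane R * T => q.1.2) q.
Proof. by apply: (@cont_at_comp _ _ _ snd) => //; [exact: cvg_snd|exact: cvg_fst]. Qed.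

End ContinuityCoordinates.

(** Dispatch is on the written shape of the function. Goals about unknown functions and nonzero
    denominators are closed by [assumption] in [cont] or left to the caller. *)
Ltac cont1 := lazymatch goal with
  | |- cont_at (fun _ => ?c) _ => exact: cont_at_cst
  | |- cont_at (fun x => x) _ => exact: cont_at_id
  | |- cont_at (fun x => @?f x + @?g x) _ => apply: (@cont_atD _ _ f g)
  | |- cont_at (fun x => - @?f x) _ => apply: (@cont_atN _ _ f)
  | |- cont_at (fun x => @?f x * @?g x) _ => apply: (@cont_atM _ _ f g)
  | |- cont_at (fun x => (@?f x)^-1) _ => apply: (@cont_atV _ _ f)
  | |- cont_at (fun x => (@?f x) ^+ ?n) _ => apply: (@cont_atX _ _ f n)
  | |- cont_at (fun x => expR (@?f x)) _ => apply: (@cont_at_expR _ _ f)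
  | |- cont_at (fun x => cos (@?f x)) _ => apply: (@cont_at_cos _ _ f)
  | |- cont_at (fun x => sin (@?f x)) _ => apply: (@cont_at_sin _ _ f)
  | |- cont_at (fun x => fst x) _ => exact: cont_at_fst
  | |- cont_at (fun x => snd x) _ => exact: cont_at_snd
  | |- cont_at (fun x => fst (snd x)) _ => exact: cont_at_snd1
  | |- cont_at (fun x => snd (snd x)) _ => exact: cont_at_snd2
  | |- cont_at (fun x => fst (fst x)) _ => exact: cont_at_fst1
  | |- cont_at (fun x => snd (fst x)) _ => exact: cont_at_fst2
  | |- cont_at (fun x => ?k (@?f x, @?g x)) _ => apply: (@cont_at_comp2 _ _ k f g)
  end.
Ltac cont := repeat (first [cont1 | assumption]).

(** * Integration over the disc *)

Section DiscIntegral.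
Context {R : realType}.
Implicit Types (z p : plane R) (f g : plane R -> R).
Local Notation mu := (@lebesgue_measure R).
Local Notation mu2 := (@mu2 R).

Lemma nrm2_ge0 z : 0 <= nrm2 z.
Proof. by rewrite addr_ge0// sqr_ge0. Qed.

Lemma cont_at_nrm2 z : cont_at (@nrm2 R) z.
Proof. by rewrite /nrm2; cont. Qed.

Lemma disc_cdisc : disc `<=` @cdisc R.
Proof. by move=> z /ltW. Qed.

Lemma circle_cdisc : circle `<=` @cdisc R.
Proof. by rewrite /circle /cdisc => z /= ->. Qed.

Lemma nrm2_cis (th : R) : nrm2 (cis th) = 1.
Proof. exact: cos2Dsin2. Qed.

Lemma circle_cis (th : R) : circle (cis th).
Proof. exact: nrm2_cis. Qed.

Lemma cdisc_cis (th : R) : cdisc (cis th).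
Proof. exact/circle_cdisc/circle_cis. Qed.

Lemma cdisc_itv z : cdisc z -> -1 <= z.1 <= 1 /\ -1 <= z.2 <= 1.
Proof.
rewrite /cdisc /nrm2 /= => h.
by split; rewrite -ler_norml -(@ler_pXn2r _ 2)// ?nnegrE// real_normK ?num_real// expr1n;
  nra.
Qed.

Lemma disc_open : open (@disc R).
Proof.
rewrite (_ : disc = @nrm2 R @^-1` [set x | x < 1]); last by [].
by apply: open_comp => [z _|]; [exact: cont_at_nrm2|exact: open_lt].
Qed.

Lemma cdisc_closed : closed (@cdisc R).
Proof.
rewrite (_ : cdisc = @nrm2 R @^-1` [set x | x <= 1]); last by [].
by apply: preimage_closed => [z _|]; [exact: cont_at_nrm2|exact: closed_le].
Qed.

Lemma cdisc_compact : compact (@cdisc R).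
Proof.
apply: (@subclosed_compact _ _ (`[-1, 1]%classic `*` `[-1, 1]%classic : set (plane R))).
- exact: cdisc_closed.
- by apply: compact_setX; exact: segment_compact.
- by move=> z /cdisc_itv[h1 h2]; split; rewrite /= in_itv.
Qed.

(** The product sigma-algebra is generated by rectangles, and an open set is the union of the
    countably many rectangles with rational corners that it contains. *)
Lemma open_plane_measurable (A : set (plane R)) : open A -> measurable (A : set (mplane R)).
Proof.
move=> oA.
pose B (q : rat * rat * (rat * rat)) : set (plane R) :=
  `]ratr q.1.1, ratr q.1.2[%classic `*` `]ratr q.2.1, ratr q.2.2[%classic.
(* Replacing the rectangles not contained in [A] by the empty set lets the union run over the whole
   countable type of corners. *)
pose C q := if `[< B q `<=` A >] then B q else set0.
have -> : A = \bigcup_q C q.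
  apply/seteqP; split=> [[x y] Axy|z [q _]]; last first.
    by rewrite /C; case: ifPn => // /asboolP BA /BA.
  have [/= [U V] [/= nU nV] UV] : nbhs (x, y) A by exact: open_nbhs_nbhs.
  have aux (c : R) (W : set R) : nbhs c W ->
      exists a b : rat, `](ratr a : R), ratr b[%classic c /\ `](ratr a : R), ratr b[%classic `<=` W.
    move=> /nbhs_ballP[e /= e0 eW].
    have [a] := @rat_in_itvoo R (c - e) c ltac:(by rewrite ltrBlDr ltrDl).
    have [b] := @rat_in_itvoo R c (c + e) ltac:(by rewrite ltrDl).
    rewrite !in_itv/= => /andP[b1 b2] /andP[a1 a2].
    exists a, b; split; first by rewrite /= in_itv/= a2 b1.
    move=> w /=; rewrite in_itv/= => /andP[w1 w2]; apply: eW.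
    by rewrite /ball /= ltr_distlC; apply/andP; split; lra.
  have [a1 [b1 [h1 s1]]] := aux _ _ nU.
  have [a2 [b2 [h2 s2]]] := aux _ _ nV.
  exists (a1, b1, (a2, b2)) => //; rewrite /C ifT; first by split.
  by apply/asboolP => -[v w] [/= hv hw]; apply: UV; split; [exact: s1|exact: s2].
apply: countable_bigcupT_measurable => [|q]; first exact: countableP.
rewrite /C; case: ifP => // _; apply: measurableX; exact: measurable_itv.
Qed.

Lemma measurable_disc : measurable (@disc R : set (mplane R)).
Proof. apply: open_plane_measurable; exact: disc_open. Qed.

Lemma mu2_disc_fin : (mu2 disc < +oo)%E.
Proof.
apply: (@le_lt_trans _ _ (mu2 (`[-1, 1]%classic `*` `[-1, 1]%classic))).
  apply: le_measure; rewrite ?inE; first exact: measurable_disc.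
    by apply: measurableX; exact: measurable_itv.
  by move=> z /disc_cdisc/cdisc_itv[h1 h2]; split; rewrite /= in_itv.
rewrite /Defs.mu2 product_measure1E; [|exact: measurable_itv|exact: measurable_itv].
rewrite /= !lebesgue_measure_itv /= lte_fin; case: ifP => _; last by rewrite mule0 ltry.
by rewrite -EFinD -EFinM ltry.
Qed.

Lemma mu2_disc_gt0 : (0 < mu2 disc)%E.
Proof.
apply: (@lt_le_trans _ _ (mu2 (`[0, 2^-1]%classic `*` `[0, 2^-1]%classic))).
  rewrite /Defs.mu2 product_measure1E; [|exact: measurable_itv|exact: measurable_itv].
  rewrite /= !lebesgue_measure_itv /= lte_fin invr_gt0 ltr0n -EFinD -EFinM lte_fin.
  by rewrite subr0 mulr_gt0.
apply: le_measure; rewrite ?inE; last first.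
- move=> z [/=]; rewrite !in_itv /= /disc /nrm2 /=; nra.
- exact: measurable_disc.
- by apply: measurableX; exact: measurable_itv.
Qed.

Lemma cont_cdisc_bounded g : cont_cdisc g ->
  exists2 M, 0 < M & forall z, cdisc z -> `|g z| <= M.
Proof.
move=> cg.
have [||c _ h] := @compact_EVT_max _ R (fun z => `|g z|) cdisc _ cdisc_compact.
- by exists (0, 0); rewrite /cdisc /nrm2 /= expr0n addr0.
- apply: continuous_in_subspaceT => z /set_mem zc; apply: cvg_norm; exact: cg.
exists (`|g c| + 1) => [|z zc]; first by rewrite ltr_wpDl.
by rewrite (le_trans (h _ (mem_set zc)))// lerDl.
Qed.

(** Nothing is known of [g] off the closed disc, but the part in the disc of the preimage of an open
    interval is open. *)
Lemma cont_cdisc_measurable g : cont_cdisc g -> measurable_fun (disc : set (mplane R)) (g : mplane R -> measurableTypeR R).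
Proof.
move=> cg; apply: (measurability _ (RGenOpens.measurableE R)).
move=> _ [_ [a [b ->] <-]]; apply: open_plane_measurable.
rewrite openE => z [zd gz]; rewrite /interior; apply: filterI.
  by apply: open_nbhs_nbhs; split => //; exact: disc_open.
by apply: (cg z (disc_cdisc zd)); apply: open_nbhs_nbhs; split => //; exact: interval_open.
Qed.

Lemma cont_cdisc_integrable g : cont_cdisc g -> mu2.-integrable disc (EFin \o g).
Proof.
move=> cg; apply: measurable_bounded_integrable.
- exact: measurable_disc.
- exact: mu2_disc_fin.
- exact: cont_cdisc_measurable.
- have [M M0 h] := cont_cdisc_bounded cg.
  exists M; split; first exact: num_real.
  by move=> x Mx z zd; rewrite /= (le_trans (h _ (disc_cdisc zd)))// ltW.
Qed.

Lemma eq_intB f g : (forall z, disc z -> f z = g z) -> intB f = intB g.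
Proof. by move=> fg; apply: eq_Rintegral => z /set_mem; exact: fg. Qed.

Lemma intBD f g : cont_cdisc f -> cont_cdisc g ->
  intB (fun z => f z + g z) = intB f + intB g.
Proof.
move=> cf cg; apply: RintegralD; [exact: measurable_disc|exact: cont_cdisc_integrable..].
Qed.

Lemma intBB f g : cont_cdisc f -> cont_cdisc g ->
  intB (fun z => f z - g z) = intB f - intB g.
Proof.
move=> cf cg; apply: RintegralB; [exact: measurable_disc|exact: cont_cdisc_integrable..].
Qed.

Lemma intBZ (c : R) f : cont_cdisc f -> intB (fun z => c * f z) = c * intB f.
Proof.
move=> cf; apply: RintegralZl; [exact: measurable_disc|exact: cont_cdisc_integrable].
Qed.

Lemma intB0 : intB (fun=> 0 : R) = 0.
Proof. by rewrite /intB Rintegral_cst ?mul0r//; exact: measurable_disc. Qed.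

Lemma le_intB f g : cont_cdisc f -> cont_cdisc g ->
  (forall z, disc z -> f z <= g z) -> intB f <= intB g.
Proof.
move=> cf cg.
exact: (le_Rintegral measurable_disc (cont_cdisc_integrable cf) (cont_cdisc_integrable cg)).
Qed.

Lemma intB_close f g (e : R) : cont_cdisc f -> cont_cdisc g ->
  (forall z, disc z -> `|f z - g z| <= e) ->
  `|intB f - intB g| <= e * fine (mu2 disc).
Proof.
move=> cf cg h; rewrite -intBB//.
have cfg : cont_cdisc (fun z => f z - g z).
  by move=> z zd; apply: cont_atD; [exact: cf|apply: cont_atN; exact: cg].
rewrite /intB; apply: (le_trans (le_normr_Rintegral measurable_disc (cont_cdisc_integrable cfg))).
rewrite -(Rintegral_cst mu2 measurable_disc).
apply: le_Rintegral => //; first exact: measurable_disc.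
  apply: cont_cdisc_integrable => z zd; apply: cvg_norm; exact: cfg.
by apply: cont_cdisc_integrable => z zd; apply: cont_at_cst.
Qed.

(** If the integral vanished, [g] would vanish almost everywhere on the disc, so the disc would be a
    null set. *)
Lemma intB_gt0 g : cont_cdisc g -> (forall z, disc z -> 0 < g z) -> 0 < intB g.
Proof.
move=> cg g0; rewrite lt_neqAle; apply/andP; split; last first.
  by apply: Rintegral_ge0 => z /g0 /ltW.
apply/eqP => ig.
have mg := cont_cdisc_measurable cg.
have : (\int[mu2]_(z in disc) `|(g z)%:E| = 0)%E.
  rewrite (_ : (fun z => `|(g z)%:E|)%E = EFin \o (fun z => `|g z|)); last by [].
  rewrite -[LHS]fineK; last first.
    apply: integrable_fin_num; first exact: measurable_disc.
    by apply: cont_cdisc_integrable => z zd; apply: cvg_norm; exact: cg.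
  congr EFin; rewrite [RHS]ig; apply: eq_Rintegral => z /set_mem/g0 h.
  by rewrite gtr0_norm.
have mg' := measurable_int _ (cont_cdisc_integrable cg).
move/(ae_eq_integral_abs mu2 measurable_disc mg').
case=> N [mN N0 sN].
have := mu2_disc_gt0; rewrite ltNge => /negP; apply; rewrite -N0.
apply: le_measure; rewrite ?inE //; first exact: measurable_disc.
move=> z zd; apply: sN => /= /(_ zd) [] /eqP; apply/negP.
by rewrite gt_eqF// g0.
Qed.

End DiscIntegral.

(** * Integration over the circle *)

Section CircleIntegral.
Context {R : realType}.
Implicit Types (f g : plane R -> R).
Local Notation mu := (@lebesgue_measure R).

Lemma turn_compact : compact (@turn R).
Proof. exact: segment_compact. Qed.

Lemma measurable_turn : measurable (@turn R : set (measurableTypeR R)).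
Proof. exact: measurable_itv. Qed.

Lemma cont_circle_integrable g : cont_circle g ->
  mu.-integrable turn (EFin \o (fun th => g (cis th))).
Proof.
move=> cg; apply: continuous_compact_integrable; first exact: turn_compact.
by apply: continuous_subspaceT => th; exact: cg.
Qed.

Lemma cont_cdisc_circle g : cont_cdisc g -> cont_circle g.
Proof.
move=> cg th; apply: (@cont_at_comp2 _ _ g cos sin).
- exact/cg/cdisc_cis.
- exact: continuous_cos.
- exact: continuous_sin.
Qed.

Lemma eq_intS f g : (forall z, circle z -> f z = g z) -> intS f = intS g.
Proof. by move=> fg; apply: eq_Rintegral => z _; exact/fg/circle_cis. Qed.

Lemma intSD f g : cont_circle f -> cont_circle g ->
  intS (fun z => f z + g z) = intS f + intS g.
Proof.
move=> cf cg; apply: RintegralD; [exact: measurable_turn|exact: cont_circle_integrable..].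
Qed.

Lemma intSB f g : cont_circle f -> cont_circle g ->
  intS (fun z => f z - g z) = intS f - intS g.
Proof.
move=> cf cg; apply: RintegralB; [exact: measurable_turn|exact: cont_circle_integrable..].
Qed.

Lemma intSZ (c : R) f : cont_circle f -> intS (fun z => c * f z) = c * intS f.
Proof.
move=> cf; exact: (RintegralZl c measurable_turn (cont_circle_integrable cf)).
Qed.

Lemma turn_measure : fine (mu turn) = 2 * pi.
Proof.
rewrite /turn lebesgue_measure_itv /= lte_fin mulr_gt0 ?pi_gt0//.
by rewrite oppr0 addr0.
Qed.

Lemma intS_cst (c : R) : intS (fun=> c) = c * (2 * pi).
Proof. by rewrite /intS Rintegral_cst ?turn_measure//; exact: measurable_turn. Qed.

Lemma intS_ge0 f : (forall z, circle z -> 0 <= f z) -> 0 <= intS f.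
Proof. by move=> h; apply: Rintegral_ge0 => th _; exact/h/circle_cis. Qed.

Lemma le_intS f g : cont_circle f -> cont_circle g ->
  (forall z, circle z -> f z <= g z) -> intS f <= intS g.
Proof.
move=> cf cg h; rewrite /intS; apply: le_Rintegral; [exact: measurable_turn|exact: cont_circle_integrable..|].
by move=> th _; exact/h/circle_cis.
Qed.

Lemma intS_close f g (e : R) : cont_circle f -> cont_circle g ->
  (forall z, circle z -> `|f z - g z| <= e) ->
  `|intS f - intS g| <= e * (2 * pi).
Proof.
move=> cf cg h; rewrite -intSB// -intS_cst.
have cfg : cont_circle (fun z => f z - g z).
  by move=> z; apply: cont_atD; [exact: cf|apply: cont_atN; exact: cg].
rewrite /intS; apply: (le_trans (le_normr_Rintegral measurable_turn (cont_circle_integrable cfg))).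
apply: (@le_intS (fun z => `|f z - g z|)) => //.
  by move=> th; apply: cvg_norm; exact: cfg.
by move=> th; apply: cont_at_cst.
Qed.

Lemma intS_gt0 g : cont_circle g -> (forall z, circle z -> 0 < g z) -> 0 < intS g.
Proof.
move=> cg g0.
have pi0 : (0 : R) <= 2 * pi by rewrite mulr_ge0// ltW// pi_gt0.
have [||c _ h] := @EVT_min R (fun t => g (cis t)) 0 (2 * pi).
- exact: pi0.
- by apply: continuous_subspaceT => th; exact: cg.
apply: (@lt_le_trans _ _ (intS (fun=> g (cis c)))).
  by rewrite intS_cst mulr_gt0 ?g0 ?mulr_gt0 ?pi_gt0//; exact: circle_cis.
apply: le_Rintegral; first exact: measurable_turn.
- by apply: (@cont_circle_integrable (fun=> g (cis c))) => th; apply: cont_at_cst.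
- exact: cont_circle_integrable.
- by move=> th; rewrite /turn /= => hth; apply: h.
Qed.

End CircleIntegral.

(** Tube lemma: near each y of [K] both values are compared with [G x0 y], which costs e / 2 twice,
    and compactness makes the neighbourhood of [x0] uniform. *)
Lemma compact_unif_near (R : realType) (X Y : topologicalType) (G : X -> Y -> R)
    (K : set Y) (x0 : X) : compact K ->
  (forall y, K y -> cont_at (fun q : X * Y => G q.1 q.2) (x0, y)) ->
  forall e, 0 < e -> \forall x \near x0, forall y, K y -> `|G x y - G x0 y| < e.
Proof.
move=> /compact_near_coveringP cK cG e e0.
apply: (cK X (nbhs x0) (fun x y => `|G x y - G x0 y| < e)) => y Ky.
have e2 : 0 < e / 2 by rewrite divr_gt0.
have := cG y Ky; move/cvgrPdist_lt => /(_ _ e2) /= [[U V] /= [nU nV] UV].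
have UV1 x' y' : U x' -> V y' -> `|G x0 y - G x' y'| < e / 2.
  by move=> Ux Vy; apply: (UV (x', y')).
exists (V, U) => //= -[y' x'] [/= Vy' Ux'].
have h1 := UV1 _ _ Ux' Vy'; have h2 := UV1 _ _ (nbhs_singleton nU) Vy'.
rewrite (_ : _ - _ = (G x0 y - G x0 y') - (G x0 y - G x' y')); last by ring.
by rewrite (le_lt_trans (ler_normB _ _))// [ltRHS]splitr ltrD.
Qed.

Definition has_deriv (R : realType) (g : R -> R) (x d : R) : Prop := is_derive x 1 g d.

(** * Derivatives in one variable *)

Section DerivativeRules.
Context {R : realType}.
Implicit Types (f g : R -> R) (x : R).

Lemma has_deriv_eq f x d d' : has_deriv f x d -> d = d' -> has_deriv f x d'.
Proof. by move=> h <-. Qed.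

Lemma has_deriv_near f g x d :
  (\forall y \near x, f y = g y) -> has_deriv f x d -> has_deriv g x d.
Proof. exact: near_eq_is_derive. Qed.

Lemma has_deriv_cont f x d : has_deriv f x d -> cont_at f x.
Proof. by case=> df _; apply: differentiable_continuous; apply: (iffLR (derivable1_diffP f x)). Qed.

Lemma has_deriv_cst (c : R) x : has_deriv (fun=> c) x 0.
Proof. exact: is_derive_cst. Qed.

Lemma has_deriv_id x : has_deriv (fun y => y) x 1.
Proof. exact: is_derive_id. Qed.

Lemma has_derivD f g x d e : has_deriv f x d -> has_deriv g x e ->
  has_deriv (fun y => f y + g y) x (d + e).
Proof. exact: is_deriveD. Qed.

Lemma has_derivN f x d : has_deriv f x d -> has_deriv (fun y => - f y) x (- d).
Proof. exact: is_deriveN. Qed.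

Lemma has_derivM f g x d e : has_deriv f x d -> has_deriv g x e ->
  has_deriv (fun y => f y * g y) x (d * g x + f x * e).
Proof.
move=> hf hg; apply: has_deriv_eq (is_deriveM hf hg) _.
by rewrite /GRing.scale /=; ring.
Qed.

Lemma has_derivX f n x d : has_deriv f x d ->
  has_deriv (fun y => f y ^+ n) x (n%:R * f x ^+ n.-1 * d).
Proof.
move=> hf; elim: n => [|n IH].
  by apply: (has_deriv_eq (has_deriv_cst 1 x)); rewrite !mul0r.
apply: has_deriv_near (has_deriv_eq (has_derivM hf IH) _).
  by near=> y; rewrite exprS.
by case: n {IH} => [|n] /=; rewrite ?expr0 -?natr1 ?exprS; ring.
Unshelve. all: by end_near.
Qed.

Lemma has_derivV f x d : f x != 0 -> has_deriv f x d ->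
  has_deriv (fun y => (f y)^-1) x (- d / f x ^+ 2).
Proof.
move=> f0 hf; apply: has_deriv_eq (is_deriveV f0 hf) _.
by rewrite /GRing.scale /= mulNr mulrC mulNr.
Qed.

Lemma has_deriv_comp f g x d e : has_deriv f (g x) d -> has_deriv g x e ->
  has_deriv (fun y => f (g y)) x (d * e).
Proof. exact: is_derive1_comp. Qed.

Lemma has_deriv_expR f x d : has_deriv f x d ->
  has_deriv (fun y => expR (f y)) x (expR (f x) * d).
Proof. by move=> hf; apply: has_deriv_comp => //; exact: is_derive_expR. Qed.

Lemma has_deriv_cos f x d : has_deriv f x d ->
  has_deriv (fun y => cos (f y)) x (- sin (f x) * d).
Proof. by move=> hf; apply: has_deriv_comp => //; exact: is_derive_cos. Qed.

Lemma has_deriv_sin f x d : has_deriv f x d ->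
  has_deriv (fun y => sin (f y)) x (cos (f x) * d).
Proof. by move=> hf; apply: has_deriv_comp => //; exact: is_derive_sin. Qed.

End DerivativeRules.

(** [eapply] leaves the value of the derivative to unification. Goals are therefore first passed
    through [has_deriv_eq], which postpones the comparison with the expected value to a [ring] or
    [field] computation. *)
Ltac deriv1 := lazymatch goal with
  | |- has_deriv (fun _ => ?c) _ _ => exact: has_deriv_cst
  | |- has_deriv (fun x => x) _ _ => exact: has_deriv_id
  | |- has_deriv (fun x => @?f x + @?g x) _ _ => eapply (@has_derivD _ f g)
  | |- has_deriv (fun x => - @?f x) _ _ => eapply (@has_derivN _ f)
  | |- has_deriv (fun x => @?f x * @?g x) _ _ => eapply (@has_derivM _ f g)
  | |- has_deriv (fun x => (@?f x)^-1) _ _ => eapply (@has_derivV _ f)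
  | |- has_deriv (fun x => (@?f x) ^+ ?n) _ _ => eapply (@has_derivX _ f n)
  | |- has_deriv (fun x => expR (@?f x)) _ _ => eapply (@has_deriv_expR _ f)
  | |- has_deriv (fun x => cos (@?f x)) _ _ => eapply (@has_deriv_cos _ f)
  | |- has_deriv (fun x => sin (@?f x)) _ _ => eapply (@has_deriv_sin _ f)
  end.
Ltac deriv := repeat (first [eassumption | deriv1]).

(** * Fundamental theorem of calculus *)

Section FundamentalTheorem.
Context {R : realType}.
Local Notation mu := (@lebesgue_measure R).

Lemma cont_seg_integrable (g : R -> R) (a b : R) :
  (forall x, a <= x <= b -> cont_at g x) -> mu.-integrable `[a, b] (EFin \o g).
Proof.
move=> cg; apply: continuous_compact_integrable; first exact: segment_compact.
apply: continuous_in_subspaceT => x /set_mem /=; rewrite in_itv /=; exact: cg.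
Qed.

Lemma FTC_seg (G g : R -> R) (a b : R) : a <= b ->
  (forall x, a <= x <= b -> cont_at g x) ->
  (forall x, a <= x <= b -> has_deriv G x (g x)) ->
  \int[mu]_(x in `[a, b]) g x = G b - G a.
Proof.
rewrite le_eqVlt => /predU1P[<- _ _|ab cg hG].
  by rewrite set_itv1 Rintegral_set1 subrr.
rewrite /Rintegral (@continuous_FTC2 R g G a b ab)//.
- apply: continuous_in_subspaceT => x /set_mem /=; rewrite in_itv /=; exact: cg.
- split.
  + move=> x; rewrite in_itv /= => /andP[x1 x2].
    by have [] := hG x _; rewrite ?ltW.
  + apply: cvg_at_right_filter; apply: (has_deriv_cont (d := g a)).
    by apply: hG; rewrite lexx ltW.
  + apply: cvg_at_left_filter; apply: (has_deriv_cont (d := g b)).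
    by apply: hG; rewrite lexx ltW.
- move=> x; rewrite in_itv /= => /andP[x1 x2].
  have /= h := hG x _; rewrite derive1E; apply: derive_val.
  by apply: h; rewrite !ltW.
Qed.

(** The slices of the open disc are open intervals, and Fubini presents their integrals as extended
    reals; hence this form. *)
Lemma FTC_oo (G g : R -> R) (a b : R) : a < b ->
  (forall x, a <= x <= b -> cont_at g x) ->
  (forall x, a <= x <= b -> has_deriv G x (g x)) ->
  (\int[mu]_(x in `]a, b[) (g x)%:E = (G b - G a)%:E)%E.
Proof.
move=> ab cg hG; rewrite -(FTC_seg (ltW ab) cg hG).
have ig := cont_seg_integrable cg.
have mo (i : interval R) : [set` i] `<=` `[a, b]%classic ->
    measurable_fun ([set` i] : set (measurableTypeR R)) (EFin \o g).
  move=> si; apply: measurable_int; apply: integrableS ig => //; exact: measurable_itv.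
rewrite integral_itv_obnd_cbnd; last first.
  by apply: mo; apply: subset_itvScc; rewrite ?bnd_simp.
rewrite integral_itv_bndo_bndc; last first.
  by apply: mo; apply: subset_itvScc; rewrite ?bnd_simp.
rewrite /Rintegral fineK//; apply: integrable_fin_num => //; exact: measurable_itv.
Qed.

Lemma antiderivative (g : R -> R) (a b : R) : (forall x, cont_at g x) ->
  exists A : R -> R, forall x, a < x < b -> has_deriv A x (g x).
Proof.
move=> cg; exists (fun x => \int[mu]_(t in `[a, x]) g t) => x /andP[ax xb].
have ig := @cont_seg_integrable g a b (fun x _ => cg x).
have [d e] := @continuous_FTC1_closed R g a x b xb ig ax (cg x).
by apply: DeriveDef; [exact: d|rewrite -derive1E; exact: e].
Qed.

Lemma has_deriv0_cst (f : R -> R) (a b : R) : a <= b ->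
  (forall x, a <= x <= b -> has_deriv f x 0) -> f a = f b.
Proof.
move=> ab hf; apply/eqP; rewrite eq_sym -subr_eq0; apply/eqP.
have [x xab||c _ h] := @MVT_segment R f (fun=> 0) a b ab.
- by move: xab; rewrite in_itv /= => /andP[x1 x2]; apply: hf; rewrite !ltW.
- apply: continuous_in_subspaceT => x /set_mem /=; rewrite in_itv /= => h.
  exact: has_deriv_cont (hf _ h).
- by rewrite h mul0r.
Qed.

End FundamentalTheorem.

(** * The divergence theorem on the disc *)

Section Divergence.
Context {R : realType}.
Implicit Types (g P Q : plane R -> R).
Local Notation mu := (@lebesgue_measure R).
Local Notation mu2 := (@mu2 R).

Local Notation chord y := (Num.sqrt (1 - y ^+ 2))%R.

Lemma chord_cdisc (x y : R) : -1 <= y <= 1 -> cdisc (x, y) = (- chord y <= x <= chord y) :> Prop.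
Proof.
move=> y1; have s0 := sqrtr_ge0 (1 - y ^+ 2).
have s2 : chord y ^+ 2 = 1 - y ^+ 2 by rewrite sqr_sqrtr; nra.
rewrite /cdisc /nrm2 /=; apply/propext; split=> [h|/andP[h1 h2]]; last by nra.
by apply/andP; split; nra.
Qed.

Lemma chord_disc (x y : R) : -1 <= y <= 1 -> (nrm2 (x, y) < 1) = (- chord y < x < chord y).
Proof.
move=> y1; have s0 := sqrtr_ge0 (1 - y ^+ 2).
have s2 : chord y ^+ 2 = 1 - y ^+ 2 by rewrite sqr_sqrtr; nra.
rewrite /nrm2 /=; apply/idP/idP => [h|/andP[h1 h2]]; last by nra.
by apply/andP; split; nra.
Qed.

Lemma chord_cdisc2 (y : R) : -1 <= y <= 1 -> cdisc (chord y, y) /\ cdisc (- chord y, y).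
Proof.
move=> y1; rewrite !chord_cdisc// lexx.
by have := sqrtr_ge0 (1 - y ^+ 2); split; rewrite ?lexx ?andbT//=; lra.
Qed.

Lemma cdisc_swap (x y : R) : cdisc (x, y) -> cdisc (y, x).
Proof. by rewrite /cdisc /nrm2 /= addrC. Qed.

Lemma chord_gt0 (y : R) : -1 < y < 1 -> - chord y < chord y.
Proof.
move=> y1; suff : 0 < chord y by lra.
by rewrite sqrtr_gt0 subr_gt0; nra.
Qed.

Lemma ext_integrable g : cont_cdisc g ->
  mu2.-integrable setT ((EFin \o g) \_ disc).
Proof.
by move=> cg; apply/(integrable_mkcond _ measurable_disc)/cont_cdisc_integrable.
Qed.

(** Fubini for the extension of [g] by zero. The slices at heights outside []-1, 1[] are empty, and
    the inner integral enters already evaluated as [I]. *)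
Lemma intB_slices1 g (I : R -> R) : cont_cdisc g ->
  (forall y : R, -1 < y < 1 ->
     (\int[mu]_(x in `](- chord y)%R, (chord y)%R[) (g (x, y))%:E = (I y)%:E)%E) ->
  intB g = \int[mu]_(y in `]-1, 1[) I y.
Proof.
move=> cg hI; rewrite /intB /Rintegral; congr fine.
rewrite [LHS]integral_mkcond [RHS]integral_mkcond.
rewrite -(integral21_prod_meas1 (ext_integrable cg)).
apply: eq_integral => y _; rewrite /fubini_G [RHS]patchE.
case: ifPn => [/set_mem /=|]; rewrite ?notin_setE /= in_itv /= => y1.
  rewrite -hI// [RHS]integral_mkcond; apply: eq_integral => x _.
  rewrite !patchE; congr (if _ then _ else _).
  have y1' : -1 <= y <= 1 by case/andP: y1 => ? ?; rewrite !ltW.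
  by apply/idP/idP => /set_mem h; apply/mem_set; move: h; rewrite /disc /= in_itv /= chord_disc.
rewrite (eq_integral (cst 0%E)) ?integral0// => x _; rewrite patchE.
case: ifPn => // /set_mem; rewrite /disc /nrm2 /= => h; exfalso; apply: y1.
by apply/andP; split; nra.
Qed.

Lemma intB_slices2 g (I : R -> R) : cont_cdisc g ->
  (forall x : R, -1 < x < 1 ->
     (\int[mu]_(y in `](- chord x)%R, (chord x)%R[) (g (x, y))%:E = (I x)%:E)%E) ->
  intB g = \int[mu]_(x in `]-1, 1[) I x.
Proof.
move=> cg hI; rewrite /intB /Rintegral; congr fine.
rewrite [LHS]integral_mkcond [RHS]integral_mkcond.
rewrite -(integral12_prod_meas1 (ext_integrable cg)).
apply: eq_integral => y _; rewrite /fubini_F [RHS]patchE.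
case: ifPn => [/set_mem /=|]; rewrite ?notin_setE /= in_itv /= => y1.
  rewrite -hI// [RHS]integral_mkcond; apply: eq_integral => x _.
  rewrite !patchE; congr (if _ then _ else _).
  have y1' : -1 <= y <= 1 by case/andP: y1 => ? ?; rewrite !ltW.
  apply/idP/idP => /set_mem h; apply/mem_set; move: h; rewrite /disc /= in_itv /=.
    by rewrite -chord_disc// /nrm2 /= addrC.
  by rewrite -chord_disc// /nrm2 /= addrC.
rewrite (eq_integral (cst 0%E)) ?integral0// => x _; rewrite patchE.
case: ifPn => // /set_mem; rewrite /disc /nrm2 /= => h; exfalso; apply: y1.
by apply/andP; split; nra.
Qed.

(** The ends of a chord make sense only for heights in [-1, 1]. Composing with [clamp] makes
    functions of these ends continuous on the whole line, as [antiderivative] requires. *)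
Definition clamp (y : R) : R := Num.max (-1) (Num.min 1 y).

Lemma clamp_itv y : -1 <= clamp y <= 1.
Proof. rewrite /clamp /Num.max /Num.min.
by case: (ltP 1 y) => h1; case: (ltP (-1) _) => h2; apply/andP; split; lra. Qed.

Lemma clamp_id y : -1 <= y <= 1 -> clamp y = y.
Proof. by rewrite /clamp => /andP[h1 h2]; rewrite min_r// max_r. Qed.

Lemma cont_at_clamp (T : topologicalType) (f : T -> R) z :
  cont_at f z -> cont_at (fun y => clamp (f y)) z.
Proof.
move=> cf; rewrite /clamp.
under eq_fun do rewrite maxr_absE minr_absE.
have c1 : cont_at (fun y => `|1 - f y|) z by apply: cvg_norm; apply: (@cont_atD _ _ (fun=> 1) (fun y => - f y)); cont.
have c2 : cont_at (fun y => `|-1 - (1 + f y - `|1 - f y|) / 2|) z.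
  by apply: cvg_norm; apply: (@cont_atD _ _ (fun=> -1) (fun y => - ((1 + f y - `|1 - f y|) / 2))); cont.
rewrite /cont_at; change (cont_at (fun y => (-1 + (1 + f y - `|1 - f y|) / 2 + `|-1 - (1 + f y - `|1 - f y|) / 2|) / 2) z).
by cont.
Qed.

Lemma cont_at_sqrt (T : topologicalType) (f : T -> R) z :
  cont_at f z -> cont_at (fun y => Num.sqrt (f y)) z.
Proof. by move=> cf; apply: cont_at_comp1 => //; exact: sqrt_continuous. Qed.

Lemma has_deriv_shift (A : R -> R) (c th d : R) :
  has_deriv A (th + c) d -> has_deriv (fun t => A (t + c)) th d.
Proof.
move=> hA; have h : has_deriv (fun t => t + c) th (1 + 0) by deriv.
by apply: has_deriv_eq (@has_deriv_comp _ A (fun t => t + c) th _ _ hA h) _; ring.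
Qed.

Lemma has_deriv_refl (A : R -> R) (c th d : R) :
  has_deriv A (c - th) d -> has_deriv (fun t => A (c - t)) th (- d).
Proof.
move=> hA; have h : has_deriv (fun t => c - t) th (0 + - 1) by deriv.
by apply: has_deriv_eq (@has_deriv_comp _ A (fun t => c - t) th _ _ hA h) _; ring.
Qed.

(** The integral over a period does not depend on its starting point: A(th + 2 pi) - A(th) has
    derivative h(th + 2 pi) - h(th) = 0. *)
Lemma periodic_antideriv (h A : R -> R) (a : R) : a <= 0 ->
  (forall th, h (th + 2 * pi) = h th) ->
  (forall th, a <= th <= 2 * pi -> has_deriv A th (h th)) ->
  A (a + 2 * pi) - A a = A (2 * pi) - A 0.
Proof.
move=> a0 hp hA; have pi0 := pi_gt0 R.
rewrite -[2 * pi in RHS]add0r.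
apply: (@has_deriv0_cst R (fun th => A (th + 2 * pi) - A th) a 0) => // th thb.
apply: has_deriv_eq.
  apply: has_derivD; first by apply: has_deriv_shift; apply: hA; lra.
  by apply: has_derivN; apply: hA; lra.
by rewrite hp subrr.
Qed.

Lemma cos2pi_per (th : R) : cos (th + 2 * pi) = cos th.
Proof. by rewrite mulrDl mul1r addrA !cosDpi opprK. Qed.

Lemma sin2pi_per (th : R) : sin (th + 2 * pi) = sin th.
Proof. by rewrite mulrDl mul1r addrA !sinDpi opprK. Qed.

(** Integrating along horizontal chords leaves the integral over y of the difference of [P] at the
    two ends. With y = sin th, th in [-pi/2, pi/2], the right end runs over the arc at angle th and
    the left end over the arc at angle pi - th; together these arcs form one turn. *)
Lemma divergence_x P Px : cont_cdisc P -> cont_cdisc Px ->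
  (forall z, cdisc z -> has_deriv (fun x => P (x, z.2)) z.1 (Px z)) ->
  intB Px = intS (fun z => P z * z.1).
Proof.
move=> cP cPx hP; have pi0 := pi_gt0 R.
pose h y := P (chord (clamp y), clamp y) - P (- chord (clamp y), clamp y).
have cc y : cont_at clamp y by apply: cont_at_clamp; exact: cont_at_id.
have cs y : cont_at (fun y => chord (clamp y)) y.
  by apply: (@cont_at_sqrt _ (fun y => 1 - clamp y ^+ 2)); cont.
have ch y : cont_at h y.
  have [c1 c2] := chord_cdisc2 (clamp_itv y).
  by rewrite /h; cont; first [exact: cs|exact: cc|exact: (cP _ c1)|exact: (cP _ c2)].
have -> : intB Px = \int[mu]_(y in `]-1, 1[) h y.
  apply: intB_slices1 => // y y1.
  have y1' : -1 <= y <= 1 by case/andP: y1 => ? ?; rewrite !ltW.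
  have cd x : - chord y <= x <= chord y -> cdisc (x, y) by rewrite chord_cdisc.
  rewrite (@FTC_oo _ (fun x => P (x, y)))//.
  - by rewrite /h clamp_id.
  - exact: chord_gt0.
  - by move=> x /cd xd; cont; exact: cPx.
  - by move=> x /cd xd; exact: (hP _ xd).
(* An interval larger than [-1, 1], so that [H] has two-sided derivatives at the ends too. The same
   margin is taken for [A] below. *)
have [H hH] := antiderivative (-2) 2 ch.
pose k th := P (cos th, sin th) * cos th.
have ck th : cont_at k th.
  by rewrite /k; cont; [exact: cP (cdisc_cis _)|exact: cont_at_id..].
have kp th : k (th + 2 * pi) = k th by rewrite /k cos2pi_per sin2pi_per.
have [A hA] := antiderivative (- (4 * pi)) (4 * pi) ck.
have hH1 (y : R) : -1 <= y <= 1 -> has_deriv H y (h y) by move=> y1; apply: hH; lra.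
have lt11 : -1 < 1 :> R by lra.
rewrite {1}/Rintegral (FTC_oo lt11 (fun y _ => ch y) hH1) /=.
rewrite /intS (_ : Rintegral _ _ _ = \int[mu]_(th in turn) k th) // /turn.
have pi1 : 0 <= 2 * pi :> R by lra.
have hA1 (th : R) : 0 <= th <= 2 * pi -> has_deriv A th (k th) by move=> thb; apply: hA; lra.
rewrite (FTC_seg pi1 (fun y _ => ck y) hA1).
have hA2 (th : R) : - (pi / 2) <= th <= 2 * pi -> has_deriv A th (k th) by move=> thb; apply: hA; lra.
have pi2 : - (pi / 2) <= 0 :> R by lra.
rewrite -(periodic_antideriv pi2 kp hA2).
(* The substitution y = sin th, carried out on antiderivatives: the derivative of this function is
   zero because the half chord at height sin th is cos th, which is nonnegative here. *)
have := @has_deriv0_cst R (fun th => H (sin th) - A th + A (pi - th)) (- (pi / 2)) (pi / 2).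
rewrite sinN sin_pihalf => /(_ _ _)/[dup] /[swap].
have -> : pi - - (pi / 2) = - (pi / 2) + 2 * pi :> R by field.
have -> : pi - pi / 2 = pi / 2 :> R by field.
move=> D _; have {D} : H (-1) - A (- (pi / 2)) + A (- (pi / 2) + 2 * pi) = H 1 - A (pi / 2) + A (pi / 2).
  apply: D; first by lra.
  move=> th thb; have cth : 0 <= cos th by exact: cos_ge0_pihalf.
  have sth : -1 <= sin th <= 1 by rewrite sin_geN1 sin_le1.
  have e1 : has_deriv H (sin th) (h (sin th)) by apply: hH; lra.
  have e2 : has_deriv A th (k th) by apply: hA; lra.
  have e3 : has_deriv A (pi - th) (k (pi - th)) by apply: hA; lra.
  apply: has_deriv_eq.
    apply: has_derivD; last exact: has_deriv_refl e3.
    apply: has_derivD; last exact: has_derivN e2.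
    apply: has_deriv_comp e1 (has_deriv_sin (has_deriv_id _)).
  rewrite /h /k clamp_id// addrC [pi - th]addrC cosDpi sinDpi cosN sinN opprK.
  by rewrite -cos2sin2 sqrtr_sqr ger0_norm//; ring.
by move=> D; lra.
Qed.

(** As for [divergence_x], with vertical chords and x = cos th on [0, pi]; the lower ends correspond
    to the angles -th. *)
Lemma divergence_y Q Qy : cont_cdisc Q -> cont_cdisc Qy ->
  (forall z, cdisc z -> has_deriv (fun y => Q (z.1, y)) z.2 (Qy z)) ->
  intB Qy = intS (fun z => Q z * z.2).
Proof.
move=> cQ cQy hQ; have pi0 := pi_gt0 R.
pose h x := Q (clamp x, chord (clamp x)) - Q (clamp x, - chord (clamp x)).
have cc y : cont_at clamp y by apply: cont_at_clamp; exact: cont_at_id.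
have cs y : cont_at (fun y => chord (clamp y)) y.
  by apply: (@cont_at_sqrt _ (fun y => 1 - clamp y ^+ 2)); cont.
have ch y : cont_at h y.
  have [/cdisc_swap c1 /cdisc_swap c2] := chord_cdisc2 (clamp_itv y).
  by rewrite /h; cont; first [exact: cs|exact: cc|exact: (cQ _ c1)|exact: (cQ _ c2)].
have -> : intB Qy = \int[mu]_(y in `]-1, 1[) h y.
  apply: intB_slices2 => // x y1.
  have y1' : -1 <= x <= 1 by case/andP: y1 => ? ?; rewrite !ltW.
  have cd y : - chord x <= y <= chord x -> cdisc (x, y).
    by move=> yx; apply: cdisc_swap; rewrite chord_cdisc.
  rewrite (@FTC_oo _ (fun y => Q (x, y)))//.
  - by rewrite /h clamp_id.
  - exact: chord_gt0.
  - by move=> y /cd xd; cont; exact: cQy.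
  - by move=> y /cd xd; exact: (hQ _ xd).
have [H hH] := antiderivative (-2) 2 ch.
pose k th := Q (cos th, sin th) * sin th.
have ck th : cont_at k th.
  by rewrite /k; cont; [exact: cQ (cdisc_cis _)|exact: cont_at_id..].
have kp th : k (th + 2 * pi) = k th by rewrite /k cos2pi_per sin2pi_per.
have [A hA] := antiderivative (- (4 * pi)) (4 * pi) ck.
have hH1 (y : R) : -1 <= y <= 1 -> has_deriv H y (h y) by move=> y1; apply: hH; lra.
have lt11 : -1 < 1 :> R by lra.
rewrite {1}/Rintegral (FTC_oo lt11 (fun y _ => ch y) hH1) /=.
rewrite /intS (_ : Rintegral _ _ _ = \int[mu]_(th in turn) k th) // /turn.
have pi1 : 0 <= 2 * pi :> R by lra.
have hA1 (th : R) : 0 <= th <= 2 * pi -> has_deriv A th (k th) by move=> thb; apply: hA; lra.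
rewrite (FTC_seg pi1 (fun y _ => ck y) hA1).
have hA2 (th : R) : - pi <= th <= 2 * pi -> has_deriv A th (k th) by move=> thb; apply: hA; lra.
have pi2 : - pi <= 0 :> R by lra.
rewrite -(periodic_antideriv pi2 kp hA2).
have -> : - pi + 2 * pi = pi :> R by ring.
have : H (cos 0) + A 0 - A (0 - 0) = H (cos pi) + A pi - A (0 - pi).
  apply: (@has_deriv0_cst R (fun th => H (cos th) + A th - A (0 - th)) 0 pi); first by lra.
  move=> th thb; have cth : 0 <= sin th by apply: sin_ge0_pi.
  have sth : -1 <= cos th <= 1 by rewrite cos_geN1 cos_le1.
  have e1 : has_deriv H (cos th) (h (cos th)) by apply: hH; lra.
  have e2 : has_deriv A th (k th) by apply: hA; lra.
  have e3 : has_deriv A (0 - th) (k (0 - th)) by apply: hA; lra.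
  apply: has_deriv_eq.
    apply: has_derivD; last by apply: has_derivN; exact: has_deriv_refl e3.
    apply: has_derivD; last exact: e2.
    apply: has_deriv_comp e1 (has_deriv_cos (has_deriv_id _)).
  rewrite /h /k clamp_id// sub0r cosN sinN.
  by rewrite -sin2cos2 sqrtr_sqr ger0_norm//; ring.
by rewrite subr0 cos0 cospi sub0r => D; lra.
Qed.

Lemma disc_divergence P Q Px Qy :
  cont_cdisc P -> cont_cdisc Q -> cont_cdisc Px -> cont_cdisc Qy ->
  (forall z, cdisc z -> has_deriv (fun x => P (x, z.2)) z.1 (Px z)) ->
  (forall z, cdisc z -> has_deriv (fun y => Q (z.1, y)) z.2 (Qy z)) ->
  intB (fun z => Px z + Qy z) = intS (fun z => P z * z.1 + Q z * z.2).
Proof.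
move=> cP cQ cPx cQy hP hQ.
rewrite intBD// (divergence_x cP)// (divergence_y cQ)// intSD//.
- by apply: cont_cdisc_circle => z zd; cont; exact: cP.
- by apply: cont_cdisc_circle => z zd; cont; exact: cQ.
Qed.

End Divergence.

(** * Differentiation under the integral sign *)

Section ParametricDerivative.
Context {R : realType}.

(** Free of the quotient by s - s0, so that estimates uniform in the integration variable can be
    integrated and inserted directly. *)
Lemma has_deriv_of_bound (F : R -> R) (s0 d : R) :
  (forall e, 0 < e ->
     \forall s \near s0, `|F s - F s0 - (s - s0) * d| <= e * `|s - s0|) ->
  has_deriv F s0 d.
Proof.
move=> h; apply/is_derive1_caratheodory.
exists (fun s => if s == s0 then d else (F s - F s0) / (s - s0)); split.
- move=> s; case: eqVneq => [->|ss0]; first by rewrite !subrr mulr0.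
  by rewrite divfK// subr_eq0.
- apply/cvgrPdist_le => e e0; near=> s; rewrite eqxx.
  case: (eqVneq s s0) => [_|ss0]; first by rewrite subrr normr0 ltW.
  have ds : s - s0 != 0 by rewrite subr_eq0.
  rewrite distrC -(@ler_pM2r _ `|s - s0|) ?normr_gt0// -normrM mulrBl divfK// [d * _]mulrC.
  by near: s; exact: h.
- by rewrite eqxx.
Unshelve. all: by end_near. Qed.

Lemma has_deriv_bound (F : R -> R) (s0 d : R) : has_deriv F s0 d ->
  forall e, 0 < e ->
     \forall s \near s0, `|F s - F s0 - (s - s0) * d| <= e * `|s - s0|.
Proof.
move=> /is_derive1_caratheodory[g [gE gc <-]] e e0.
move/cvgrPdist_le : gc => /(_ e e0) gc.
near=> s; rewrite gE [_ * g s0]mulrC -mulrBl normrM ler_wpM2r// distrC.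
by near: s; exact: gc.
Unshelve. all: by end_near. Qed.

(** By the mean value theorem the error is (Gs c y - Gs s0 y) (s - s0) for some c between s and s0,
    and [compact_unif_near] bounds the first factor uniformly in y. *)
Lemma unif_derive (Y : topologicalType) (K : set Y) (G Gs : R -> Y -> R) (s0 : R) :
  compact K ->
  (forall y, K y -> cont_at (fun q : R * Y => Gs q.1 q.2) (s0, y)) ->
  (\forall s \near s0, forall y, K y -> has_deriv (G^~ y) s (Gs s y)) ->
  forall e, 0 < e -> \forall s \near s0, forall y, K y ->
    `|G s y - G s0 y - (s - s0) * Gs s0 y| <= e * `|s - s0|.
Proof.
move=> cK cGs hG e e0.
have cG := compact_unif_near cK cGs e0.
have /nbhs_ballP[d /= d0 hd] : nbhs s0 [set s | (forall y, K y -> has_deriv (G^~ y) s (Gs s y)) /\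
    (forall y, K y -> `|Gs s y - Gs s0 y| < e)] by apply: filterI.
apply/nbhs_ballP; exists d => //= s sd y Ky.
have main a b : a < b -> ball s0 d a -> ball s0 d b -> exists2 c, ball s0 d c & G b y - G a y = Gs c y * (b - a).
  move=> ab; rewrite /ball /= => ha hb.
  have inb x : a <= x <= b -> ball s0 d x.
    by move: ha hb; rewrite /ball /= !ltr_distlC => /andP[? ?] /andP[? ?] /andP[? ?]; apply/andP; split; lra.
  have hab x : a <= x <= b -> has_deriv (G^~ y) x (Gs x y).
    by move=> /inb /hd[/(_ y Ky)].
  have [x xab||c cab ->] := @MVT R (G^~ y) (Gs^~ y) a b ab.
  - by apply: hab; move: xab; rewrite in_itv /= => /andP[? ?]; rewrite !ltW.
  - apply: continuous_in_subspaceT => x /set_mem /=; rewrite in_itv /= => /hab.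
    exact: has_deriv_cont.
  - exists c => //; apply: inb; move: cab; rewrite in_itv /= => /andP[? ?].
    by rewrite !ltW.
have b0 : ball s0 d s0 by exact: ballxx.
have est c : ball s0 d c -> `|(Gs c y - Gs s0 y) * (s - s0)| <= e * `|s - s0|.
  by move=> /hd[_ /(_ y Ky) h]; rewrite normrM ler_wpM2r// ltW.
have [ss0|ss0|->] := ltgtP s s0; last by rewrite !subrr mul0r subrr normr0 mulr0.
- have [c cd E] := main _ _ ss0 sd b0.
  rewrite (_ : _ - _ = (Gs c y - Gs s0 y) * (s - s0)); first exact: est.
  by rewrite -[G s y - G s0 y]opprB E; ring.
- have [c cd E] := main _ _ ss0 b0 sd.
  rewrite (_ : _ - _ = (Gs c y - Gs s0 y) * (s - s0)); first exact: est.
  by rewrite E; ring.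
Qed.

Lemma cont_at_section (X Y : topologicalType) (G : X -> Y -> R) x y :
  cont_at (fun q : X * Y => G q.1 q.2) (x, y) -> cont_at (G x) y.
Proof.
move=> h; apply: (@cont_at_comp _ _ _ (fun q : X * Y => G q.1 q.2) (fun y => (x, y))) => //.
by apply: cvg_pair; [exact: cvg_cst|exact: cvg_id].
Qed.

Lemma intB_derive (G Gs : R -> plane R -> R) (s0 : R) :
  (forall z, cdisc z -> cont_at (fun q : R * plane R => Gs q.1 q.2) (s0, z)) ->
  (\forall s \near s0, cont_cdisc (G s)) ->
  (\forall s \near s0, forall z, cdisc z -> has_deriv (G^~ z) s (Gs s z)) ->
  has_deriv (fun s => intB (G s)) s0 (intB (Gs s0)).
Proof.
move=> cGs cG hG; apply: has_deriv_of_bound => e e0.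
(* The added 1 makes the divisor positive at once. *)
have m0 : 0 < fine (mu2 (@disc R)) + 1 by rewrite ltr_wpDl// fine_ge0.
have cGs0 : cont_cdisc (Gs s0) by move=> z zd; apply: cont_at_section; exact: cGs.
have U := unif_derive (@cdisc_compact R) cGs hG (divr_gt0 e0 m0).
have cG0 : cont_cdisc (G s0) := nbhs_singleton cG.
near=> s.
have cGs1 : cont_cdisc (G s) by near: s.
rewrite (_ : _ - _ = intB (G s) - intB (fun z => G s0 z + (s - s0) * Gs s0 z)); last first.
  rewrite intBD ?intBZ//; first by ring.
  by move=> z zd; cont; exact: cGs0.
have US : forall z, cdisc z -> `|G s z - G s0 z - (s - s0) * Gs s0 z| <= e / (fine (mu2 (@disc R)) + 1) * `|s - s0| by near: s.
apply: (@le_trans _ _ (e / (fine (mu2 (@disc R)) + 1) * `|s - s0| * fine (mu2 (@disc R)))).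
  apply: intB_close => //.
    by move=> z zd; cont; [exact: cG0|exact: cGs0].
  by move=> z /disc_cdisc /US; rewrite opprD addrA.
rewrite mulrAC ler_wpM2r// -mulrA ler_piMr//; first exact: ltW.
by rewrite mulrC ler_pdivrMr// mul1r lerDl.
Unshelve. all: by end_near. Qed.

Lemma intS_derive (G Gs : R -> plane R -> R) (s0 : R) :
  (forall th, cont_at (fun q : R * R => Gs q.1 (cis q.2)) (s0, th)) ->
  (\forall s \near s0, cont_circle (G s)) ->
  (\forall s \near s0, forall z, circle z -> has_deriv (G^~ z) s (Gs s z)) ->
  has_deriv (fun s => intS (G s)) s0 (intS (Gs s0)).
Proof.
move=> cGs cG hG; apply: has_deriv_of_bound => e e0.
have m0 : 0 < 2 * pi :> R by rewrite mulr_gt0// pi_gt0.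
have cGs0 : cont_circle (Gs s0).
  by move=> th; apply: (@cont_at_section R R (fun s th => Gs s (cis th)) s0 th); exact: cGs.
have U := @unif_derive R turn (fun s th => G s (cis th)) (fun s th => Gs s (cis th)) s0 (@turn_compact R) (fun th _ => cGs th) _ _ (divr_gt0 e0 m0).
have cG0 : cont_circle (G s0) := nbhs_singleton cG.
have cd : cont_circle (fun z => (s0 - s0) * Gs s0 z) by move=> th; cont; exact: cGs0.
near=> s.
have cGs1 : cont_circle (G s) by near: s.
have cd1 : cont_circle (fun z => (s - s0) * Gs s0 z) by move=> th; cont; exact: cGs0.
have cd2 : cont_circle (fun z => G s0 z + (s - s0) * Gs s0 z) by move=> th; cont; [exact: cG0|exact: cGs0].
rewrite (_ : _ - _ = intS (G s) - intS (fun z => G s0 z + (s - s0) * Gs s0 z)); last first.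
  by rewrite intSD ?intSZ//; ring.
have US : forall th, turn th -> `|G s (cis th) - G s0 (cis th) - (s - s0) * Gs s0 (cis th)| <= e / (2 * pi) * `|s - s0|.
  near: s; apply: U; apply: filterS hG => s hs th _; apply: hs; exact: circle_cis.
rewrite -intSB//; rewrite /intS.
apply: (@le_trans _ _ (\int[@lebesgue_measure R]_(th in turn) `|G s (cis th) - (G s0 (cis th) + (s - s0) * Gs s0 (cis th))|)).
  apply: (le_normr_Rintegral measurable_turn); apply: (@cont_circle_integrable R (fun z => G s z - (G s0 z + (s - s0) * Gs s0 z))).
  by move=> th; cont; [exact: cGs1|exact: cG0|exact: cGs0].
apply: (@le_trans _ _ (\int[@lebesgue_measure R]_(th in turn) (e / (2 * pi) * `|s - s0|))).
  apply: (le_Rintegral measurable_turn).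
  - apply: (@cont_circle_integrable R (fun z => `|G s z - (G s0 z + (s - s0) * Gs s0 z)|)).
    move=> th; apply: cvg_norm.
    by apply: (@cont_atD _ _ (fun t => G s (cis t)) (fun t => - (G s0 (cis t) + (s - s0) * Gs s0 (cis t)))); cont; [exact: cGs1|exact: cG0|exact: cGs0].
  - by apply: (@cont_circle_integrable R (fun=> e / (2 * pi) * `|s - s0|)) => th; cont.
  - by move=> th /US; rewrite opprD addrA.
rewrite Rintegral_cst; last exact: measurable_turn.
by rewrite turn_measure mulrAC divfK// gt_eqF.
Unshelve. all: by end_near. Qed.

End ParametricDerivative.

(** * The chain rule for two variables *)

Section ChainRule.
Context {R : realType}.
Implicit Types (k kx ky : plane R -> R).

(** Partial derivatives are taken along coordinate lines; their joint continuity on the whole plane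
    is what yields the chain rule. *)
Record C1 k kx ky : Prop := BuildC1 {
  C1_cont : forall z, cont_at k z;
  C1_contx : forall z, cont_at kx z;
  C1_conty : forall z, cont_at ky z;
  C1_derx : forall x y, has_deriv (fun t => k (t, y)) x (kx (x, y));
  C1_dery : forall x y, has_deriv (fun t => k (x, t)) y (ky (x, y)) }.

Lemma MVT_slope (f df : R -> R) (a b : R) : (forall x, has_deriv f x (df x)) ->
  exists2 c, `|c - a| <= `|b - a| & f b - f a = df c * (b - a).
Proof.
move=> hf.
have cw x y : {within `[x, y], continuous f}.
  by apply: continuous_subspaceT => t; exact: has_deriv_cont.
have [ab|ab|->] := ltgtP a b; last by exists b; rewrite // !subrr mulr0.
- have [x _||c] := @MVT R f df a b ab; [exact: hf|exact: cw|].
  rewrite in_itv /= => /andP[ac cb] E; exists c => //.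
  by rewrite !gtr0_norm ?subr_gt0//; lra.
- have [x _||c] := @MVT R f df b a ab; [exact: hf|exact: cw|].
  rewrite in_itv /= => /andP[ac cb] E; exists c; last by rewrite -[LHS]opprB E; ring.
  by rewrite !ltr0_norm ?subr_lt0//; lra.
Qed.

Lemma C1_bound k kx ky z0 : C1 k kx ky -> forall e, 0 < e ->
  \forall z \near z0,
   `|k z - k z0 - kx z0 * (z.1 - z0.1) - ky z0 * (z.2 - z0.2)|
     <= e * (`|z.1 - z0.1| + `|z.2 - z0.2|).
Proof.
case: z0 => x0 y0 [_ ckx cky hx hy] e e0.
have /nbhs_ballP[d1 /= d10 h1] : nbhs (x0, y0) [set z | `|kx (x0, y0) - kx z| <= e].
  by move: (ckx (x0, y0)) => /cvgrPdist_le /(_ _ e0).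
have /nbhs_ballP[d2 /= d20 h2] : nbhs (x0, y0) [set z | `|ky (x0, y0) - ky z| <= e].
  by move: (cky (x0, y0)) => /cvgrPdist_le /(_ _ e0).
have d0 : 0 < Num.min d1 d2 by rewrite lt_min d10.
apply/nbhs_ballP; exists (Num.min d1 d2) => //= -[x y] [/=].
rewrite /ball /= !lt_min => /andP[bx1 bx2] /andP[by1 by2].
have [c cx Ec] := @MVT_slope (fun t => k (t, y)) (fun t => kx (t, y)) x0 x (fun t => hx t y).
have [b byy Eb] := @MVT_slope (fun t => k (x0, t)) (fun t => ky (x0, t)) y0 y (fun t => hy x0 t).
(* The increment is split at the corner (x0, y), and the mean value theorem is applied to each of
   the two segments. *)
rewrite (_ : k (x, y) - _ - _ - _ = (kx (c, y) - kx (x0, y0)) * (x - x0) + (ky (x0, b) - ky (x0, y0)) * (y - y0)); last first.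
  have -> : k (x, y) - k (x0, y0) = (k (x, y) - k (x0, y)) + (k (x0, y) - k (x0, y0)) by ring.
  by rewrite Ec Eb; ring.
apply: (le_trans (ler_normD _ _)); rewrite [e * _]mulrDr !normrM.
apply: lerD; apply: ler_wpM2r => //.
  rewrite distrC; apply: (h1 (c, y)); split => //=; rewrite /ball /= distrC.
  by rewrite (le_lt_trans cx)// distrC.
rewrite distrC; apply: (h2 (x0, b)); split => /=; first exact: ballxx.
by rewrite /ball /= distrC (le_lt_trans byy)// distrC.
Qed.

Lemma has_deriv_comp2 k kx ky (a b : R -> R) (x da db : R) : C1 k kx ky ->
  has_deriv a x da -> has_deriv b x db ->
  has_deriv (fun t => k (a t, b t)) x
    (kx (a x, b x) * da + ky (a x, b x) * db).
Proof.
move=> hk ha hb; have ca := has_deriv_cont ha; have cb := has_deriv_cont hb.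
set K1 := kx _; set K2 := ky _.
apply: has_deriv_of_bound => e e0.
(* [M] bounds the sum of the slopes of [a] and [b] near [x], with 1 to spare for each, and [N]
   exceeds [|K1| + |K2|]. The linearization error of [k] and those of [a], [b] then each contribute
   at most half of [e]. *)
pose M : R := `|da| + `|db| + 2; have M0 : 0 < M by rewrite ltr_wpDl// addr_ge0.
pose N : R := `|K1| + `|K2| + 1; have N0 : 0 < N by rewrite ltr_wpDl// addr_ge0.
have e1 : 0 < e / (2 * M) by rewrite divr_gt0// mulr_gt0.
have e2 : 0 < e / (2 * N) by rewrite divr_gt0// mulr_gt0.
have hc : (fun t => (a t, b t)) @ x --> (a x, b x) by exact: (cvg_pair ca cb).
near=> t.
have B : `|k (a t, b t) - k (a x, b x) - K1 * (a t - a x) - K2 * (b t - b x)|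
     <= e / (2 * M) * (`|a t - a x| + `|b t - b x|).
  near: t; exact: (hc _ (C1_bound (a x, b x) hk e1)).
have A1 : `|a t - a x - (t - x) * da| <= 1 * `|t - x| by near: t; apply: has_deriv_bound.
have A2 : `|b t - b x - (t - x) * db| <= 1 * `|t - x| by near: t; apply: has_deriv_bound.
have A3 : `|a t - a x - (t - x) * da| <= e / (2 * N) * `|t - x| by near: t; apply: has_deriv_bound.
have A4 : `|b t - b x - (t - x) * db| <= e / (2 * N) * `|t - x| by near: t; apply: has_deriv_bound.
have C1' : `|a t - a x| <= (`|da| + 1) * `|t - x|.
  rewrite (_ : a t - a x = (a t - a x - (t - x) * da) + da * (t - x)); last by ring.
  by apply: (le_trans (ler_normD _ _)); rewrite normrM [(_ + 1) * _]mulrDl addrC; apply: lerD.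
have C2' : `|b t - b x| <= (`|db| + 1) * `|t - x|.
  rewrite (_ : b t - b x = (b t - b x - (t - x) * db) + db * (t - x)); last by ring.
  by apply: (le_trans (ler_normD _ _)); rewrite normrM [(_ + 1) * _]mulrDl addrC; apply: lerD.
rewrite (_ : _ - _ = (k (a t, b t) - k (a x, b x) - K1 * (a t - a x) - K2 * (b t - b x)) +
   (K1 * (a t - a x - (t - x) * da) + K2 * (b t - b x - (t - x) * db))); last by ring.
apply: (le_trans (ler_normD _ _)).
have -> : e * `|t - x| = e / 2 * `|t - x| + e / 2 * `|t - x| by field.
apply: lerD.
  rewrite (le_trans B)//.
  apply: (@le_trans _ _ (e / (2 * M) * (M * `|t - x|))).
    by apply: ler_wpM2l; [exact: ltW|rewrite /M; lra].
  by rewrite le_eqVlt; apply/orP; left; apply/eqP; field; rewrite gt_eqF.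
apply: (le_trans (ler_normD _ _)); rewrite !normrM.
apply: (@le_trans _ _ ((`|K1| + `|K2|) * (e / (2 * N) * `|t - x|))).
  have := ler_wpM2l (normr_ge0 K1) A3; have := ler_wpM2l (normr_ge0 K2) A4.
  by set X := _ * `|t - x|; lra.
apply: (@le_trans _ _ (N * (e / (2 * N) * `|t - x|))).
  by apply: ler_wpM2r; [rewrite mulr_ge0 ?(ltW e2)|rewrite /N; lra].
by rewrite le_eqVlt; apply/orP; left; apply/eqP; field; rewrite gt_eqF.
Unshelve. all: by end_near. Qed.

End ChainRule.

(** * Conservation of integrals under transport *)

Section Transport.
Context {R : realType}.
Variables (O : set R).
Hypotheses (O_open : open O) (O01 : forall s : R, 0 <= s <= 1 -> O s).

(** [O] is an open set of times containing [0, 1], so derivatives at the two end times are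
    two-sided. Joint continuity in time and position is what differentiation under the integral asks
    for. *)
Definition jcont_disc (F : R -> plane R -> R) : Prop :=
  forall s z, O s -> cdisc z -> cont_at (fun q : R * plane R => F q.1 q.2) (s, z).

Lemma O_near s : O s -> \forall t \near s, O t.
Proof. by move=> Os; apply: open_nbhs_nbhs. Qed.

(* [E s] is the density at time [s] of a quantity transported with flux [(P s, Q s)], which is tangent to the circle. *)
Lemma transport_disc (E P Q Px Qy : R -> plane R -> R) :
  jcont_disc E -> jcont_disc P -> jcont_disc Q -> jcont_disc Px -> jcont_disc Qy ->
  (forall s z, O s -> cdisc z -> has_deriv (fun x => P s (x, z.2)) z.1 (Px s z)) ->
  (forall s z, O s -> cdisc z -> has_deriv (fun y => Q s (z.1, y)) z.2 (Qy s z)) ->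
  (forall s z, O s -> cdisc z -> has_deriv (E^~ z) s (Px s z + Qy s z)) ->
  (forall s z, O s -> circle z -> P s z * z.1 + Q s z * z.2 = 0) ->
  intB (E 0) = intB (E 1).
Proof.
move=> cE cP cQ cPx cQy hP hQ hE tan.
have sec F s : jcont_disc F -> O s -> cont_cdisc (F s).
  by move=> cF Os z zd; apply: cont_at_section; exact: cF.
apply: (@has_deriv0_cst R (fun s => intB (E s)) 0 1) => // s /O01 Os.
apply: has_deriv_eq.
  apply: (@intB_derive R E (fun s z => Px s z + Qy s z)).
  - by move=> z zd; apply: (@cont_atD _ _ (fun q => Px q.1 q.2) (fun q => Qy q.1 q.2)); [exact: cPx|exact: cQy].
  - by apply: filterS (O_near Os) => t Ot; exact: sec.
  - by apply: filterS (O_near Os) => t Ot z zd; exact: hE.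
rewrite (@disc_divergence R (P s) (Q s)); try exact: sec.
- by rewrite (@eq_intS _ _ (fun=> 0)) ?intS_cst ?mul0r// => z zc; exact: tan.
- by move=> z zd; exact: hP.
- by move=> z zd; exact: hQ.
Qed.

Lemma jcont_disc_circle (F : R -> plane R -> R) s th : jcont_disc F -> O s ->
  cont_at (fun q : R * R => F q.1 (cis q.2)) (s, th).
Proof.
move=> cF Os; apply: (@cont_at_pair _ _ _ F (fun q : R * R => q.1) (fun q : R * R => cis q.2)).
- exact: cF (cdisc_cis _).
- exact: cont_at_fst.
- have c1 : cont_at (fun q : R * R => cos q.2) (s, th) by cont.
  have c2 : cont_at (fun q : R * R => sin q.2) (s, th) by cont.
  exact: (cvg_pair c1 c2).
Qed.

(** One-dimensional continuity equation: the time derivative of the density is the angular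
    derivative of the flux [F], whose periodicity makes the total derivative vanish. *)
Lemma transport_circle (E G : R -> plane R -> R) (F : R -> R -> R) :
  jcont_disc E -> jcont_disc G ->
  (forall s th, O s -> has_deriv (F s) th (G s (cis th))) ->
  (forall s z, O s -> circle z -> has_deriv (E^~ z) s (G s z)) ->
  (forall s, O s -> F s (2 * pi) = F s 0) ->
  intS (E 0) = intS (E 1).
Proof.
move=> cE cG hF hE per; have pi0 := pi_gt0 R.
have pi2 : 0 <= 2 * pi :> R by lra.
have sec H s : jcont_disc H -> O s -> cont_cdisc (H s).
  by move=> cH Os z zd; apply: cont_at_section; exact: cH.
apply: (@has_deriv0_cst R (fun s => intS (E s)) 0 1) => // s /O01 Os.
apply: has_deriv_eq.
  apply: (@intS_derive R E G).
  - by move=> th; exact: jcont_disc_circle.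
  - by apply: filterS (O_near Os) => t Ot; apply: cont_cdisc_circle; exact: sec.
  - by apply: filterS (O_near Os) => t Ot z zd; exact: hE.
rewrite /intS (@FTC_seg R (F s)) ?per ?subrr//.
  by move=> th _; apply: (cont_cdisc_circle (sec _ _ cG Os)).
by move=> th _; exact: hF.
Qed.

End Transport.

(** * Rotation invariance of the integrals *)

Section Rotation.
Context {R : realType}.
Implicit Types (k : plane R -> R) (z : plane R).

Lemma rotpE (th : R) z :
  rotp th z = (cos th * z.1 - sin th * z.2, cos th * z.2 + sin th * z.1).
Proof. by []. Qed.

Lemma rotp0 z : rotp 0 z = z.
Proof. by rewrite rotpE cos0 sin0 !mul1r !mul0r subr0 addr0; case: z. Qed.

Lemma jcont_rotp k (th : R) O : (forall z, cont_at k z) ->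
  jcont_disc O (fun s z => k (rotp (s * th) z)).
Proof.
move=> ck s z Os zd.
apply: (@cont_at_comp2 _ _ k (fun q : R * plane R => cos (q.1 * th) * q.2.1 - sin (q.1 * th) * q.2.2)
  (fun q : R * plane R => cos (q.1 * th) * q.2.2 + sin (q.1 * th) * q.2.1)); first exact: ck.
  by cont.
by cont.
Qed.

(** The rotations by s th, s in [0, 1], connect the identity to [rotp th]. Their velocity field th
    (-y, x) is divergence free and tangent to the circle, and the flux is this field times the
    density. *)
Lemma intB_rotp k kx ky (th : R) : C1 k kx ky ->
  intB (fun z => k (rotp th z)) = intB k.
Proof.
move=> hk; symmetry.
have := @transport_disc R setT openT (fun _ _ => I)
  (fun s z => k (rotp (s * th) z))
  (fun s z => - (th * z.2) * k (rotp (s * th) z))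
  (fun s z => th * z.1 * k (rotp (s * th) z))
  (fun s z => - (th * z.2) * (kx (rotp (s * th) z) * cos (s * th) + ky (rotp (s * th) z) * sin (s * th)))
  (fun s z => th * z.1 * (kx (rotp (s * th) z) * - sin (s * th) + ky (rotp (s * th) z) * cos (s * th))).
have -> : (fun z => k (rotp (0 * th) z)) = k by apply/funext => z; rewrite mul0r rotp0.
have -> : (fun z => k (rotp (1 * th) z)) = (fun z => k (rotp th z)) by apply/funext => z; rewrite mul1r.
have ck := jcont_rotp (th := th) (O := setT) (C1_cont hk).
have ckx := jcont_rotp (th := th) (O := setT) (C1_contx hk).
have cky := jcont_rotp (th := th) (O := setT) (C1_conty hk).
apply.
- exact: ck.
- by move=> s z Os zd; cont; exact: (ck s z).
- by move=> s z Os zd; cont; exact: (ck s z).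
- by move=> s z Os zd; cont; [exact: (ckx s z)|exact: (cky s z)].
- by move=> s z Os zd; cont; [exact: (ckx s z)|exact: (cky s z)].
- move=> s z _ _ /=; apply: has_deriv_eq.
    apply: has_derivM; first by deriv.
    apply: (has_deriv_comp2 hk (a := fun x => cos (s * th) * x - sin (s * th) * z.2)
      (b := fun x => cos (s * th) * z.2 + sin (s * th) * x)); by deriv.
  by rewrite !rotpE /=; ring.
- move=> s z _ _ /=; apply: has_deriv_eq.
    apply: has_derivM; first by deriv.
    apply: (has_deriv_comp2 hk (a := fun y => cos (s * th) * z.1 - sin (s * th) * y)
      (b := fun y => cos (s * th) * y + sin (s * th) * z.1)); by deriv.
  by rewrite !rotpE /=; ring.
- move=> s z _ _ /=; apply: has_deriv_eq.
    apply: (has_deriv_comp2 hk (a := fun s => cos (s * th) * z.1 - sin (s * th) * z.2)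
      (b := fun s => cos (s * th) * z.2 + sin (s * th) * z.1)); by deriv.
  by rewrite !rotpE /=; ring.
- by move=> s z _ _; ring.
Qed.

(** Same path as for the disc; the angular flux is th times the density. *)
Lemma intS_rotp k kx ky (th : R) : C1 k kx ky ->
  intS (fun z => k (rotp th z)) = intS k.
Proof.
move=> hk; symmetry.
have := @transport_circle R setT openT (fun _ _ => I)
  (fun s z => k (rotp (s * th) z))
  (fun s z => th * (kx (rotp (s * th) z) * (- cos (s * th) * z.2 - sin (s * th) * z.1)
                  + ky (rotp (s * th) z) * (cos (s * th) * z.1 - sin (s * th) * z.2)))
  (fun s t => th * k (rotp (s * th) (cis t))).
have -> : (fun z => k (rotp (0 * th) z)) = k by apply/funext => z; rewrite mul0r rotp0.
have -> : (fun z => k (rotp (1 * th) z)) = (fun z => k (rotp th z)) by apply/funext => z; rewrite mul1r.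
have ck := jcont_rotp (th := th) (O := setT) (C1_cont hk).
have ckx := jcont_rotp (th := th) (O := setT) (C1_contx hk).
have cky := jcont_rotp (th := th) (O := setT) (C1_conty hk).
apply.
- exact: ck.
- by move=> s z Os zd; cont; [exact: (ckx s z)|exact: (cky s z)].
- move=> s t _ /=; apply: has_deriv_eq.
    apply: has_derivM; first by deriv.
    apply: (has_deriv_comp2 hk (a := fun t => cos (s * th) * cos t - sin (s * th) * sin t)
      (b := fun t => cos (s * th) * sin t + sin (s * th) * cos t)); by deriv.
  by rewrite !rotpE /=; ring.
- move=> s z _ _ /=; apply: has_deriv_eq.
    apply: (has_deriv_comp2 hk (a := fun s => cos (s * th) * z.1 - sin (s * th) * z.2)
      (b := fun s => cos (s * th) * z.2 + sin (s * th) * z.1)); by deriv.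
  by rewrite !rotpE /=; ring.
- by move=> s _; rewrite /cis -[2 * pi]add0r cos2pi_per sin2pi_per.
Qed.

End Rotation.

(** * The Moebius path and its derivatives *)

Section Moebius.
Context {R : realType}.
Implicit Types (k : plane R -> R) (z p : plane R) (s : R).

(* [Phi (s p) z = (z + s p) / (a + i b)] with [a + i b = 1 + s conj(p) z]. *)
Definition mob_a p s z : R := 1 + s * (p.1 * z.1 + p.2 * z.2).
Definition mob_b p s z : R := s * (p.1 * z.2 - p.2 * z.1).
Definition mob_D p s z : R := mob_a p s z ^+ 2 + mob_b p s z ^+ 2.
Definition mob1 p s z : R :=
  ((z.1 + s * p.1) * mob_a p s z + (z.2 + s * p.2) * mob_b p s z) / mob_D p s z.
Definition mob2 p s z : R :=
  ((z.2 + s * p.2) * mob_a p s z - (z.1 + s * p.1) * mob_b p s z) / mob_D p s z.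
Definition mob_S p s : R := 1 - s ^+ 2 * nrm2 p.
(** The Jacobian determinant of [Phi (s p)]; its square root [mob_sigma] is the modulus of the
    complex derivative. *)
Definition mob_J p s z : R := mob_S p s ^+ 2 / mob_D p s z ^+ 2.
Definition mob_sigma p s z : R := mob_S p s / mob_D p s z.

(* Real and imaginary part of [p - conj(p) z^2]; up to the factor [mob_S p s] this is the vector field generating the path [s |-> Phi (s p)]. *)
Definition mob_W1 p z : R := p.1 * (1 - (z.1 ^+ 2 - z.2 ^+ 2)) - 2 * p.2 * z.1 * z.2.
Definition mob_W2 p z : R := p.2 * (1 + (z.1 ^+ 2 - z.2 ^+ 2)) - 2 * p.1 * z.1 * z.2.
(** The complex derivative of [Phi (s p)] is mob_S / (a + i b)^2 = mob_x - i mob_y, so all four real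
    partial derivatives are read off by Cauchy-Riemann. *)
Definition mob_x p s z : R :=
  mob_S p s * (mob_a p s z ^+ 2 - mob_b p s z ^+ 2) / mob_D p s z ^+ 2.
Definition mob_y p s z : R :=
  2 * mob_S p s * (mob_a p s z * mob_b p s z) / mob_D p s z ^+ 2.

Lemma mob_D_neq0 p s z : s ^+ 2 * nrm2 p < 1 -> cdisc z -> mob_D p s z != 0.
Proof.
move=> sp zd; apply/eqP => D0.
have a0 : mob_a p s z ^+ 2 = 0.
  by apply/eqP; rewrite eq_le sqr_ge0 andbT -D0 /mob_D lerDl sqr_ge0.
have b0 : mob_b p s z ^+ 2 = 0 by move: D0; rewrite /mob_D a0 add0r.
have a0' : mob_a p s z = 0 by apply/eqP; rewrite -sqrf_eq0 a0.
(* This is |s conj(p) z|^2, which is less than 1 but would equal 1 at a zero of the denominator. *)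
have : (mob_a p s z - 1) ^+ 2 + mob_b p s z ^+ 2 = (s ^+ 2 * nrm2 p) * nrm2 z.
  by rewrite /mob_a /mob_b /nrm2; ring.
rewrite a0' b0 => E.
have np := nrm2_ge0 p; have s2 : 0 <= s ^+ 2 * nrm2 p by rewrite mulr_ge0// sqr_ge0.
by move: zd E; rewrite /cdisc /=; have := nrm2_ge0 z; nra.
Qed.

Lemma mob_D_gt0 p s z : s ^+ 2 * nrm2 p < 1 -> cdisc z -> 0 < mob_D p s z.
Proof.
move=> sp zd; rewrite lt_neqAle eq_sym mob_D_neq0//= /mob_D.
by rewrite addr_ge0// sqr_ge0.
Qed.

Lemma has_deriv_mob1_x p s z : mob_D p s z != 0 ->
  has_deriv (fun x => mob1 p s (x, z.2)) z.1 (mob_x p s z).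
Proof.
case: z p => [x y] [p1 p2] D0; apply: has_deriv_eq.
  by rewrite /mob1 /mob_D /mob_a /mob_b /=; deriv; exact: D0.
by move: D0; rewrite /mob_x /mob_D /mob_S /mob_a /mob_b /nrm2 /= => D0; field.
Qed.

Lemma has_deriv_mob1_y p s z : mob_D p s z != 0 ->
  has_deriv (fun y => mob1 p s (z.1, y)) z.2 (mob_y p s z).
Proof.
case: z p => [x y] [p1 p2] D0; apply: has_deriv_eq.
  by rewrite /mob1 /mob_D /mob_a /mob_b /=; deriv; exact: D0.
by move: D0; rewrite /mob_y /mob_D /mob_S /mob_a /mob_b /nrm2 /= => D0; field.
Qed.

Lemma has_deriv_mob2_x p s z : mob_D p s z != 0 ->
  has_deriv (fun x => mob2 p s (x, z.2)) z.1 (- mob_y p s z).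
Proof.
case: z p => [x y] [p1 p2] D0; apply: has_deriv_eq.
  by rewrite /mob2 /mob_D /mob_a /mob_b /=; deriv; exact: D0.
by move: D0; rewrite /mob_y /mob_D /mob_S /mob_a /mob_b /nrm2 /= => D0; field.
Qed.

Lemma has_deriv_mob2_y p s z : mob_D p s z != 0 ->
  has_deriv (fun y => mob2 p s (z.1, y)) z.2 (mob_x p s z).
Proof.
case: z p => [x y] [p1 p2] D0; apply: has_deriv_eq.
  by rewrite /mob2 /mob_D /mob_a /mob_b /=; deriv; exact: D0.
by move: D0; rewrite /mob_x /mob_D /mob_S /mob_a /mob_b /nrm2 /= => D0; field.
Qed.

Lemma has_deriv_mob1_s p s z : mob_D p s z != 0 ->
  has_deriv (fun s => mob1 p s z) s
    (((mob_a p s z ^+ 2 - mob_b p s z ^+ 2) * mob_W1 p z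
      + 2 * (mob_a p s z * mob_b p s z) * mob_W2 p z) / mob_D p s z ^+ 2).
Proof.
case: z p => [x y] [p1 p2] D0; apply: has_deriv_eq.
  by rewrite /mob1 /mob_D /mob_a /mob_b /=; deriv; exact: D0.
by move: D0; rewrite /mob_W1 /mob_W2 /mob_D /mob_S /mob_a /mob_b /nrm2 /= => D0; field.
Qed.

Lemma has_deriv_mob2_s p s z : mob_D p s z != 0 ->
  has_deriv (fun s => mob2 p s z) s
    (((mob_a p s z ^+ 2 - mob_b p s z ^+ 2) * mob_W2 p z
      - 2 * (mob_a p s z * mob_b p s z) * mob_W1 p z) / mob_D p s z ^+ 2).
Proof.
case: z p => [x y] [p1 p2] D0; apply: has_deriv_eq.
  by rewrite /mob2 /mob_D /mob_a /mob_b /=; deriv; exact: D0.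
by move: D0; rewrite /mob_W1 /mob_W2 /mob_D /mob_S /mob_a /mob_b /nrm2 /= => D0; field.
Qed.

Definition mob_Ux p s z : R := mob_S p s * (- 2 * (p.1 * z.1 + p.2 * z.2) / mob_D p s z ^+ 2
  - 4 * mob_W1 p z * (s * (mob_a p s z * p.1 - mob_b p s z * p.2)) / mob_D p s z ^+ 3).
Definition mob_Vy p s z : R := mob_S p s * (- 2 * (p.1 * z.1 + p.2 * z.2) / mob_D p s z ^+ 2
  - 4 * mob_W2 p z * (s * (mob_a p s z * p.2 + mob_b p s z * p.1)) / mob_D p s z ^+ 3).

Lemma has_deriv_mob_U p s z : mob_D p s z != 0 ->
  has_deriv (fun x => mob_S p s * mob_W1 p (x, z.2) / mob_D p s (x, z.2) ^+ 2) z.1 (mob_Ux p s z).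
Proof.
case: z p => [x y] [p1 p2] D0; apply: has_deriv_eq.
  by rewrite /mob_W1 /mob_D /mob_a /mob_b /=; deriv; rewrite expf_neq0//; exact: D0.
by move: D0; rewrite /mob_Ux /mob_W1 /mob_D /mob_S /mob_a /mob_b /nrm2 /= => D0; field.
Qed.

Lemma has_deriv_mob_V p s z : mob_D p s z != 0 ->
  has_deriv (fun y => mob_S p s * mob_W2 p (z.1, y) / mob_D p s (z.1, y) ^+ 2) z.2 (mob_Vy p s z).
Proof.
case: z p => [x y] [p1 p2] D0; apply: has_deriv_eq.
  by rewrite /mob_W2 /mob_D /mob_a /mob_b /=; deriv; rewrite expf_neq0//; exact: D0.
by move: D0; rewrite /mob_Vy /mob_W2 /mob_D /mob_S /mob_a /mob_b /nrm2 /= => D0; field.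
Qed.

(** The continuity equation for the Jacobian itself, that is, the case of constant [k] in
    [intB_mob]. *)
Lemma has_deriv_mob_J p s z : mob_D p s z != 0 ->
  has_deriv (fun s => mob_J p s z) s (mob_Ux p s z + mob_Vy p s z).
Proof.
case: z p => [x y] [p1 p2] D0; apply: has_deriv_eq.
  by rewrite /mob_J /mob_S /mob_D /mob_a /mob_b /=; deriv; rewrite expf_neq0//; exact: D0.
by move: D0; rewrite /mob_Vy /mob_Ux /mob_W1 /mob_W2 /mob_D /mob_S /mob_a /mob_b /nrm2 /= => D0; field.
Qed.

End Moebius.

(** * Moebius changes of variables and pullbacks *)

Section MoebiusChange.
Context {R : realType}.
Implicit Types (k g : plane R -> R) (z p : plane R).

(** The times at which [Phi (s p)] is an automorphism of the disc. This set serves as [O] in the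
    transport lemmas. *)
Definition mob_dom p : set R := [set s | s ^+ 2 * nrm2 p < 1].

Lemma mob_dom_open p : open (mob_dom p).
Proof.
apply: (@open_comp _ _ (fun s : R => s ^+ 2 * nrm2 p) [set x | x < 1]).
  by move=> s _; apply: (_ : cont_at (fun s : R => s ^+ 2 * nrm2 p) s); cont.
exact: open_lt.
Qed.

Lemma mob_dom01 p : disc p -> forall s, 0 <= s <= 1 -> mob_dom p s.
Proof.
rewrite /disc /mob_dom /= => p1 s /andP[s0 s1].
have s2 : s ^+ 2 <= 1 by nra.
by have := nrm2_ge0 p; nra.
Qed.

Lemma jcont_mob_D p s z : cont_at (fun q : R * plane R => mob_D p q.1 q.2) (s, z).
Proof. by rewrite /mob_D /mob_a /mob_b; cont. Qed.

Lemma jcont_mob p s z : mob_dom p s -> cdisc z ->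
  cont_at (fun q : R * plane R => mob1 p q.1 q.2) (s, z) /\
  cont_at (fun q : R * plane R => mob2 p q.1 q.2) (s, z).
Proof.
move=> Os zd; have D0 := mob_D_neq0 Os zd; have cD := @jcont_mob_D p s z.
by split; rewrite /mob1 /mob2 /mob_a /mob_b; cont.
Qed.

Lemma jcont_mob_comp p k s z : (forall z, cont_at k z) -> mob_dom p s -> cdisc z ->
  cont_at (fun q : R * plane R => k (mob1 p q.1 q.2, mob2 p q.1 q.2)) (s, z).
Proof.
move=> ck Os zd; have [c1 c2] := jcont_mob Os zd.
exact: (@cont_at_comp2 _ _ k (fun q : R * plane R => mob1 p q.1 q.2) (fun q => mob2 p q.1 q.2)).
Qed.

Lemma mob_s0 p z : (mob1 p 0 z, mob2 p 0 z) = z.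
Proof.
by rewrite /mob1 /mob2 /mob_D /mob_a /mob_b; case: z => x y /=; congr pair; field.
Qed.

Lemma mob_D0 p z : mob_D p 0 z = 1.
Proof. by rewrite /mob_D /mob_a /mob_b; ring. Qed.

Lemma mob_S0 p : mob_S p 0 = 1.
Proof. by rewrite /mob_S; ring. Qed.

(** At s = 0 the map is the identity. Its s-derivative is its complex derivative applied to the
    field W / mob_S, so the density k(Phi (s p)) times the Jacobian is carried by the flux k(Phi (s
    p)) mob_S W / mob_D^2. *)
Lemma intB_mob k kx ky p : C1 k kx ky -> disc p ->
  intB (fun z => k (mob1 p 1 z, mob2 p 1 z) * mob_J p 1 z) = intB k.
Proof.
move=> hk p1; symmetry.
pose K s z := k (mob1 p s z, mob2 p s z).
pose Kx s z := kx (mob1 p s z, mob2 p s z).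
pose Ky s z := ky (mob1 p s z, mob2 p s z).
pose U s z := mob_S p s * mob_W1 p z / mob_D p s z ^+ 2.
pose V s z := mob_S p s * mob_W2 p z / mob_D p s z ^+ 2.
have cD s z := @jcont_mob_D p s z.
have D0 s z : mob_dom p s -> cdisc z -> mob_D p s z != 0 by exact: mob_D_neq0.
have D2 s z n : mob_dom p s -> cdisc z -> mob_D p s z ^+ n != 0 by move=> *; rewrite expf_neq0// D0.
have cK s z Os zd : cont_at (fun q : R * plane R => K q.1 q.2) (s, z) := @jcont_mob_comp p k s z (C1_cont hk) Os zd.
have cKx s z Os zd : cont_at (fun q : R * plane R => Kx q.1 q.2) (s, z) := @jcont_mob_comp p kx s z (C1_contx hk) Os zd.
have cKy s z Os zd : cont_at (fun q : R * plane R => Ky q.1 q.2) (s, z) := @jcont_mob_comp p ky s z (C1_conty hk) Os zd.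
have cS s z : cont_at (fun q : R * plane R => mob_S p q.1) (s, z) by rewrite /mob_S; cont.
have cW1 (s : R) z : cont_at (fun q : R * plane R => mob_W1 p q.2) (s, z) by rewrite /mob_W1; cont.
have cW2 (s : R) z : cont_at (fun q : R * plane R => mob_W2 p q.2) (s, z) by rewrite /mob_W2; cont.
have cU s z : mob_dom p s -> cdisc z -> cont_at (fun q : R * plane R => U q.1 q.2) (s, z).
  by move=> Os zd; have ? := D2 s z 2 Os zd; have ? := cD s z; have ? := cS s z; have ? := cW1 s z; rewrite /U; cont.
have cV s z : mob_dom p s -> cdisc z -> cont_at (fun q : R * plane R => V q.1 q.2) (s, z).
  by move=> Os zd; have ? := D2 s z 2 Os zd; have ? := cD s z; have ? := cS s z; have ? := cW2 s z; rewrite /V; cont.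
have cJ s z : mob_dom p s -> cdisc z -> cont_at (fun q : R * plane R => mob_J p q.1 q.2) (s, z).
  by move=> Os zd; have ? := D2 s z 2 Os zd; have ? := cD s z; have ? := cS s z; rewrite /mob_J; cont.
have cx s z : mob_dom p s -> cdisc z -> cont_at (fun q : R * plane R => mob_x p q.1 q.2) (s, z).
  by move=> Os zd; have ? := D2 s z 2 Os zd; have ? := cD s z; have ? := cS s z; rewrite /mob_x /mob_a /mob_b; cont.
have cy s z : mob_dom p s -> cdisc z -> cont_at (fun q : R * plane R => mob_y p q.1 q.2) (s, z).
  by move=> Os zd; have ? := D2 s z 2 Os zd; have ? := cD s z; have ? := cS s z; rewrite /mob_y /mob_a /mob_b; cont.
have cUx s z : mob_dom p s -> cdisc z -> cont_at (fun q : R * plane R => mob_Ux p q.1 q.2) (s, z).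
  by move=> Os zd; have ? := D2 s z 2 Os zd; have ? := D2 s z 3 Os zd; have ? := cD s z; have ? := cS s z; have ? := cW1 s z; rewrite /mob_Ux /mob_a /mob_b; cont.
have cVy s z : mob_dom p s -> cdisc z -> cont_at (fun q : R * plane R => mob_Vy p q.1 q.2) (s, z).
  by move=> Os zd; have ? := D2 s z 2 Os zd; have ? := D2 s z 3 Os zd; have ? := cD s z; have ? := cS s z; have ? := cW2 s z; rewrite /mob_Vy /mob_a /mob_b; cont.
have := @transport_disc R (mob_dom p) (@mob_dom_open p) (mob_dom01 p1)
  (fun s z => K s z * mob_J p s z) (fun s z => K s z * U s z) (fun s z => K s z * V s z)
  (fun s z => (Kx s z * mob_x p s z + Ky s z * - mob_y p s z) * U s z + K s z * mob_Ux p s z)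
  (fun s z => (Kx s z * mob_y p s z + Ky s z * mob_x p s z) * V s z + K s z * mob_Vy p s z).
have -> : (fun z => K 0 z * mob_J p 0 z) = k.
  apply/funext => z; by rewrite /K mob_s0 /mob_J mob_D0 mob_S0 expr1n divr1 mulr1.
apply.
- by move=> s z Os zd; apply: cont_atM; [exact: cK|exact: cJ].
- by move=> s z Os zd; apply: cont_atM; [exact: cK|exact: cU].
- by move=> s z Os zd; apply: cont_atM; [exact: cK|exact: cV].
- move=> s z Os zd; have h1 := cK _ _ Os zd; have h2 := cKx _ _ Os zd; have h3 := cKy _ _ Os zd.
  by have h4 := cU _ _ Os zd; have h5 := cUx _ _ Os zd; have h6 := cx _ _ Os zd; have h7 := cy _ _ Os zd; cont.
- move=> s z Os zd; have h1 := cK _ _ Os zd; have h2 := cKx _ _ Os zd; have h3 := cKy _ _ Os zd.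
  by have h4 := cV _ _ Os zd; have h5 := cVy _ _ Os zd; have h6 := cx _ _ Os zd; have h7 := cy _ _ Os zd; cont.
- move=> s z Os zd; have D := D0 _ _ Os zd; apply: has_deriv_eq.
    apply: has_derivM; last exact: has_deriv_mob_U.
    exact: (has_deriv_comp2 hk (has_deriv_mob1_x D) (has_deriv_mob2_x D)).
  by case: z {zd D} => x y.
- move=> s z Os zd; have D := D0 _ _ Os zd; apply: has_deriv_eq.
    apply: has_derivM; last exact: has_deriv_mob_V.
    exact: (has_deriv_comp2 hk (has_deriv_mob1_y D) (has_deriv_mob2_y D)).
  by case: z {zd D} => x y.
- move=> s z Os zd; have D := D0 _ _ Os zd; apply: has_deriv_eq.
    apply: has_derivM; last exact: has_deriv_mob_J.
    exact: (has_deriv_comp2 hk (has_deriv_mob1_s D) (has_deriv_mob2_s D)).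
  by rewrite /K /Kx /Ky /U /V /mob_x /mob_y /mob_J; move: (mob_Ux p s z) (mob_Vy p s z) => ux vy; field.
(* For |z| = 1 one has p - conj(p) z^2 = z (conj(z) p - z conj(p)), an imaginary multiple of z,
   hence tangent to the circle. *)
- move=> s [x y] Os; rewrite /circle /nrm2 /= => zc; rewrite /U /V /mob_W1 /mob_W2 /=.
  have -> : 1 - (x ^+ 2 - y ^+ 2) = 2 * y ^+ 2 :> R by lra.
  have -> : 1 + (x ^+ 2 - y ^+ 2) = 2 * x ^+ 2 :> R by lra.
  by ring.
Qed.

(** Writing conj(p) z = m + i n, the generating field on the circle has angular speed -2 n / mob_S,
    so the density k(Phi (s p)) mob_sigma has angular flux -2 n k(Phi (s p)) / mob_D. *)
Lemma intS_mob k kx ky p : C1 k kx ky -> disc p ->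
  intS (fun z => k (mob1 p 1 z, mob2 p 1 z) * mob_sigma p 1 z) = intS k.
Proof.
move=> hk p1; symmetry.
pose K s z := k (mob1 p s z, mob2 p s z).
pose Kx s z := kx (mob1 p s z, mob2 p s z).
pose Ky s z := ky (mob1 p s z, mob2 p s z).
pose m z : R := p.1 * z.1 + p.2 * z.2.
pose n z : R := p.1 * z.2 - p.2 * z.1.
have cD s z := @jcont_mob_D p s z.
have D0 s z : mob_dom p s -> cdisc z -> mob_D p s z != 0 by exact: mob_D_neq0.
have D2 s z (i : nat) : mob_dom p s -> cdisc z -> mob_D p s z ^+ i != 0 by move=> *; rewrite expf_neq0// D0.
have cK s z Os zd : cont_at (fun q : R * plane R => K q.1 q.2) (s, z) := @jcont_mob_comp p k s z (C1_cont hk) Os zd.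
have cKx s z Os zd : cont_at (fun q : R * plane R => Kx q.1 q.2) (s, z) := @jcont_mob_comp p kx s z (C1_contx hk) Os zd.
have cKy s z Os zd : cont_at (fun q : R * plane R => Ky q.1 q.2) (s, z) := @jcont_mob_comp p ky s z (C1_conty hk) Os zd.
have cS s z : cont_at (fun q : R * plane R => mob_S p q.1) (s, z) by rewrite /mob_S; cont.
have cm (s : R) z : cont_at (fun q : R * plane R => m q.2) (s, z) by rewrite /m; cont.
have cn (s : R) z : cont_at (fun q : R * plane R => n q.2) (s, z) by rewrite /n; cont.
have cx s z : mob_dom p s -> cdisc z -> cont_at (fun q : R * plane R => mob_x p q.1 q.2) (s, z).
  by move=> Os zd; have ? := D2 s z 2 Os zd; have ? := cD s z; have ? := cS s z; rewrite /mob_x /mob_a /mob_b; cont.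
have cy s z : mob_dom p s -> cdisc z -> cont_at (fun q : R * plane R => mob_y p q.1 q.2) (s, z).
  by move=> Os zd; have ? := D2 s z 2 Os zd; have ? := cD s z; have ? := cS s z; rewrite /mob_y /mob_a /mob_b; cont.
have := @transport_circle R (mob_dom p) (@mob_dom_open p) (mob_dom01 p1)
  (fun s z => K s z * mob_sigma p s z)
  (fun s z => (Kx s z * (mob_y p s z * z.1 - mob_x p s z * z.2)
       + Ky s z * (mob_x p s z * z.1 + mob_y p s z * z.2)) * (- 2 * n z / mob_D p s z)
     + K s z * ((- 2 * m z * mob_D p s z - 4 * s * n z ^+ 2) / mob_D p s z ^+ 2))
  (fun s t => K s (cis t) * (- 2 * n (cis t) / mob_D p s (cis t))).
have -> : (fun z => K 0 z * mob_sigma p 0 z) = k.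
  apply/funext => z; by rewrite /K mob_s0 /mob_sigma mob_D0 mob_S0 divr1 mulr1.
apply.
- move=> s z Os zd; have h1 := cK _ _ Os zd; have h2 := D0 _ _ Os zd; have h3 := cD s z; have h4 := cS s z.
  by rewrite /mob_sigma; cont.
- move=> s z Os zd; have h1 := cK _ _ Os zd; have h2 := cKx _ _ Os zd; have h3 := cKy _ _ Os zd.
  have h4 := cm s z; have h5 := cn s z; have h6 := cx _ _ Os zd; have h7 := cy _ _ Os zd.
  by have h8 := D0 _ _ Os zd; have h9 := cD s z; have h10 := D2 s z 2 Os zd; cont.
- move=> s t Os /=; have zd : cdisc (cis t) := cdisc_cis t.
  have D := D0 _ _ Os zd; move: (D); rewrite {1}/mob_D {1}/mob_a {1}/mob_b /cis /= => D'.
  apply: has_deriv_eq.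
    apply: has_derivM.
      apply: (has_deriv_comp2 hk (a := fun t => mob1 p s (cis t)) (b := fun t => mob2 p s (cis t))).
        by rewrite /mob1 /mob_D /mob_a /mob_b /cis /=; deriv; exact: D'.
      by rewrite /mob2 /mob_D /mob_a /mob_b /cis /=; deriv; exact: D'.
    by rewrite /n /mob_D /mob_a /mob_b /cis /=; deriv; exact: D'.
  rewrite -/(Kx s (cis t)) -/(Ky s (cis t)); move: (K s (cis t)) (Kx s (cis t)) (Ky s (cis t)) => K0 K1 K2.
  rewrite /mob_x /mob_y /mob_D /mob_a /mob_b /n /m /mob_S /nrm2 /cis /=.
  by move: D'; move: (cos t) (sin t) => c s' D'; field.
- move=> s z Os zc; have zd := circle_cdisc zc; have D := D0 _ _ Os zd.
  (* True because |z| = 1. With it [mob_S], [mob_a] and [mob_b] depend on m and n only, which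
     reduces the derivative of [mob_sigma] to a rational identity in m, n and s. *)
  have q : nrm2 p = m z ^+ 2 + n z ^+ 2.
    by rewrite -[LHS]mulr1 -[X in _ * X]zc /nrm2 /m /n; ring.
  have W1 : mob_W1 p z = 2 * n z * z.2.
    move: zc; rewrite /circle /nrm2 /= /mob_W1 /n => zc.
    by rewrite (_ : 1 - (z.1 ^+ 2 - z.2 ^+ 2) = 2 * z.2 ^+ 2); [ring|lra].
  have W2 : mob_W2 p z = - 2 * n z * z.1.
    move: zc; rewrite /circle /nrm2 /= /mob_W2 /n => zc.
    by rewrite (_ : 1 + (z.1 ^+ 2 - z.2 ^+ 2) = 2 * z.1 ^+ 2); [ring|lra].
  have hs : has_deriv (fun s => mob_sigma p s z) s ((- 2 * m z * mob_D p s z - 4 * s * n z ^+ 2) / mob_D p s z ^+ 2).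
    apply: has_deriv_eq.
      by rewrite /mob_sigma /mob_S /mob_D /mob_a /mob_b; deriv; exact: D.
    move: D; rewrite /mob_D /mob_a /mob_b q -/(m z) -/(n z).
    by move: (m z) (n z) => m0 n0 D; field.
  apply: has_deriv_eq.
    apply: has_derivM; last exact: hs.
    exact: (has_deriv_comp2 hk (has_deriv_mob1_s D) (has_deriv_mob2_s D)).
  by rewrite W1 W2 /K /Kx /Ky /mob_x /mob_y /mob_sigma; field.
- by move=> s _; rewrite /cis cos0 sin0 -[2 * pi]add0r cos2pi_per sin2pi_per cos0 sin0.
Qed.

Lemma PhiE p z : Phi p z = (mob1 p 1 z, mob2 p 1 z).
Proof.
case: z p => [x y] [p1 p2].
rewrite /Phi /ofC /toC /mob1 /mob2 /mob_D /mob_a /mob_b /=.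
have E1 : 1 + (p1 * x - - p2 * y) = 1 + 1 * (p1 * x + p2 * y) by ring.
have E2 : 0 + (p1 * y + - p2 * x) = 1 * (p1 * y - p2 * x) by ring.
rewrite E1 E2; move: (_ ^+ 2 + _ ^+ 2)^-1 => d.
by congr pair; ring.
Qed.

Lemma Dx_has_deriv g z d : has_deriv (fun x => g (x, z.2)) z.1 d ->
  derivable g z (1, 0) /\ Dx g z = d.
Proof.
case=> h1 h2; rewrite /Dx.
have E : (fun h : R => h^-1 *: ((g \o shift z) (h *: ((1, 0) : plane R)) - g z)) =
   (fun h : R => h^-1 *: (((fun x => g (x, z.2)) \o shift z.1) (h *: 1) - g (z.1, z.2))).
  apply/funext => h /=; case: z {h1 h2} => x y /=.
  congr (_ *: (g _ - _)); rewrite /GRing.scale /= /GRing.add /=.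
  by rewrite /add_pair /scale_pair /= scaler0 add0r.
split; first by rewrite /derivable E.
by rewrite -h2 /derive E.
Qed.

Lemma Dy_has_deriv g z d : has_deriv (fun y => g (z.1, y)) z.2 d ->
  derivable g z (0, 1) /\ Dy g z = d.
Proof.
case=> h1 h2; rewrite /Dy.
have E : (fun h : R => h^-1 *: ((g \o shift z) (h *: ((0, 1) : plane R)) - g z)) =
   (fun h : R => h^-1 *: (((fun y => g (z.1, y)) \o shift z.2) (h *: 1) - g (z.1, z.2))).
  apply/funext => h /=; case: z {h1 h2} => x y /=.
  congr (_ *: (g _ - _)); rewrite /GRing.scale /= /GRing.add /=.
  by rewrite /add_pair /scale_pair /= scaler0 add0r.
split; first by rewrite /derivable E.
by rewrite -h2 /derive E.
Qed.

Lemma mob_S_gt0 p : disc p -> 0 < mob_S p 1.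
Proof. by rewrite /disc /mob_S /= expr1n mul1r subr_gt0. Qed.

Lemma jacdet_Phi p z : disc p -> cdisc z -> jacdet (Phi p) z = mob_J p 1 z.
Proof.
move=> p1 zd; have D : mob_D p 1 z != 0.
  by apply: mob_D_neq0 => //; rewrite expr1n mul1r.
rewrite /jacdet; under [fun y => (Phi p y).1]eq_fun do rewrite PhiE.
under [fun y => (Phi p y).2]eq_fun do rewrite PhiE.
rewrite /=.
have [_ ->] := Dx_has_deriv (has_deriv_mob1_x D).
have [_ ->] := Dx_has_deriv (has_deriv_mob2_x D).
have [_ ->] := Dy_has_deriv (has_deriv_mob1_y D).
have [_ ->] := Dy_has_deriv (has_deriv_mob2_y D).
by move: D; rewrite /mob_x /mob_y /mob_J /mob_D; move: (mob_a p 1 z) (mob_b p 1 z) (mob_S p 1) => a b S D; field.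
Qed.

Lemma mob_J_sigma p z : mob_J p 1 z = mob_sigma p 1 z ^+ 2.
Proof. by rewrite /mob_J /mob_sigma expr_div_n. Qed.

Lemma mob_sigma_gt0 p z : disc p -> cdisc z -> 0 < mob_sigma p 1 z.
Proof.
by move=> p1 zd; rewrite divr_gt0 ?mob_S_gt0// mob_D_gt0// expr1n mul1r.
Qed.

Lemma pullbackE (u : plane R -> R) p z : disc p -> cdisc z ->
  pullback u (Phi p) z = u (Phi p z) + ln (mob_sigma p 1 z).
Proof.
move=> p1 zd; rewrite /pullback jacdet_Phi// mob_J_sigma.
by rewrite lnXn ?mob_sigma_gt0// mulr2n; field.
Qed.

Lemma expR_pullback (u : plane R -> R) p z : disc p -> cdisc z ->
  expR (pullback u (Phi p) z) = expR (u (Phi p z)) * mob_sigma p 1 z.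
Proof. by move=> p1 zd; rewrite pullbackE// expRD lnK// posrE mob_sigma_gt0. Qed.

Lemma expR2_pullback (u : plane R -> R) p z : disc p -> cdisc z ->
  expR (2 * pullback u (Phi p) z) = expR (2 * u (Phi p z)) * mob_J p 1 z.
Proof.
move=> p1 zd; rewrite mulrC expRM_natr expR_pullback// mob_J_sigma exprMn.
by rewrite -expRM_natr [2 * _]mulrC.
Qed.

(** Conformal invariance of the area: the logarithmic term of [pullback] contributes exactly the
    Jacobian. *)
Lemma intB_pullback (u k kx ky : plane R -> R) p : disc p ->
  C1 (fun z => k z * expR (2 * u z)) kx ky ->
  intB (fun z => k (Phi p z) * expR (2 * pullback u (Phi p) z)) =
  intB (fun z => k z * expR (2 * u z)).
Proof.
move=> p1 hk; rewrite -(intB_mob hk p1); apply: eq_intB => z /disc_cdisc zd.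
by rewrite expR2_pullback// PhiE mulrA.
Qed.

Lemma intS_pullback (u k kx ky : plane R -> R) p : disc p ->
  C1 (fun z => k z * expR (u z)) kx ky ->
  intS (fun z => k (Phi p z) * expR (pullback u (Phi p) z)) =
  intS (fun z => k z * expR (u z)).
Proof.
move=> p1 hk; rewrite -(intS_mob hk p1); apply: eq_intS => z /circle_cdisc zd.
by rewrite expR_pullback// PhiE mulrA.
Qed.

(** This identity gives the invariance of the closed disc and, later, the rate at which [Phi p]
    approaches the boundary when |p| tends to 1. *)
Lemma nrm2_Phi p z : disc p -> cdisc z ->
  1 - nrm2 (Phi p z) = mob_S p 1 * (1 - nrm2 z) / mob_D p 1 z.
Proof.
move=> p1 zd; have D : mob_D p 1 z != 0.
  by apply: mob_D_neq0 => //; rewrite expr1n mul1r.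
rewrite PhiE; move: D; rewrite /mob1 /mob2 /mob_S /mob_D /mob_a /mob_b /nrm2 /= expr1n !mul1r.
by move: z.1 z.2 p.1 p.2 => x y q1 q2 D; field.
Qed.

End MoebiusChange.

(** * Closure properties of C^1 functions *)

Section ContinuouslyDifferentiable.
Context {R : realType}.
Implicit Types (f g k : plane R -> R).

Definition is_C1 k : Prop := exists kx ky, C1 k kx ky.

Lemma is_C1_cont k : is_C1 k -> forall z, cont_at k z.
Proof. by move=> [kx [ky [ck _ _ _ _]]]. Qed.

Lemma is_C1_cdisc k : is_C1 k -> cont_cdisc k.
Proof. by move=> hk z _; exact: is_C1_cont. Qed.

Lemma is_C1_circle k : is_C1 k -> cont_circle k.
Proof. by move=> hk; apply: cont_cdisc_circle; exact: is_C1_cdisc. Qed.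

Lemma is_C1_cst (c : R) : is_C1 (fun=> c).
Proof.
exists (fun=> 0), (fun=> 0).
by split=> *; by [exact: cont_at_cst|exact: has_deriv_cst].
Qed.

Lemma is_C1_fst : is_C1 (fun z : plane R => z.1).
Proof.
exists (fun=> 1), (fun=> 0).
by split=> *; by [exact: cont_at_cst|exact: has_deriv_cst|exact: cont_at_fst|exact: has_deriv_id].
Qed.

Lemma is_C1_snd : is_C1 (fun z : plane R => z.2).
Proof.
exists (fun=> 0), (fun=> 1).
by split=> *; by [exact: cont_at_cst|exact: has_deriv_cst|exact: cont_at_snd|exact: has_deriv_id].
Qed.

Lemma is_C1D f g : is_C1 f -> is_C1 g -> is_C1 (fun z => f z + g z).
Proof.
move=> [fx [fy [? ? ? ? ?]]] [gx [gy [? ? ? ? ?]]].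
exists (fun z => fx z + gx z), (fun z => fy z + gy z).
split=> [z|z|z|x y|x y]; do ?by cont.
  exact: (@has_derivD _ (fun t => f (t, y)) (fun t => g (t, y))).
exact: (@has_derivD _ (fun t => f (x, t)) (fun t => g (x, t))).
Qed.

Lemma is_C1N f : is_C1 f -> is_C1 (fun z => - f z).
Proof.
move=> [fx [fy [? ? ? ? ?]]]; exists (fun z => - fx z), (fun z => - fy z).
split=> [z|z|z|x y|x y]; do ?by cont.
  exact: (@has_derivN _ (fun t => f (t, y))).
exact: (@has_derivN _ (fun t => f (x, t))).
Qed.

Lemma is_C1M f g : is_C1 f -> is_C1 g -> is_C1 (fun z => f z * g z).
Proof.
move=> [fx [fy [? ? ? ? ?]]] [gx [gy [? ? ? ? ?]]].
exists (fun z => fx z * g z + f z * gx z), (fun z => fy z * g z + f z * gy z).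
split=> [z|z|z|x y|x y]; do ?by cont.
  exact: (@has_derivM _ (fun t => f (t, y)) (fun t => g (t, y))).
exact: (@has_derivM _ (fun t => f (x, t)) (fun t => g (x, t))).
Qed.

Lemma is_C1X f n : is_C1 f -> is_C1 (fun z => f z ^+ n).
Proof.
move=> hf; elim: n => [|n IH]; first exact: is_C1_cst.
have -> : (fun z => f z ^+ n.+1) = (fun z => f z * f z ^+ n).
  by apply/funext => z; rewrite exprS.
exact: is_C1M.
Qed.

Lemma is_C1V f : (forall z, f z != 0) -> is_C1 f -> is_C1 (fun z => (f z)^-1).
Proof.
move=> f0 [fx [fy [? ? ? ? ?]]].
exists (fun z => - fx z / f z ^+ 2), (fun z => - fy z / f z ^+ 2).
have f2 z : f z ^+ 2 != 0 by rewrite expf_neq0.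
split=> [z|z|z|x y|x y]; do ?by cont.
  exact: (@has_derivV _ (fun t => f (t, y))).
exact: (@has_derivV _ (fun t => f (x, t))).
Qed.

Lemma is_C1_expR f : is_C1 f -> is_C1 (fun z => expR (f z)).
Proof.
move=> [fx [fy [? ? ? ? ?]]].
exists (fun z => expR (f z) * fx z), (fun z => expR (f z) * fy z).
split=> [z|z|z|x y|x y]; do ?by cont.
  exact: (@has_deriv_expR _ (fun t => f (t, y))).
exact: (@has_deriv_expR _ (fun t => f (x, t))).
Qed.

End ContinuouslyDifferentiable.

Ltac isC1 := repeat (first [assumption | lazymatch goal with
  | |- is_C1 (fun _ => ?c) => exact: is_C1_cst
  | |- is_C1 (fun x => @?f x + @?g x) => apply: (@is_C1D _ f g)
  | |- is_C1 (fun x => - @?f x) => apply: (@is_C1N _ f)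
  | |- is_C1 (fun x => @?f x * @?g x) => apply: (@is_C1M _ f g)
  | |- is_C1 (fun x => (@?f x)^-1) => apply: (@is_C1V _ f)
  | |- is_C1 (fun x => (@?f x) ^+ ?n) => apply: (@is_C1X _ f n)
  | |- is_C1 (fun x => expR (@?f x)) => apply: (@is_C1_expR _ f)
  | |- is_C1 (fun x => fst x) => exact: is_C1_fst
  | |- is_C1 (fun x => snd x) => exact: is_C1_snd
  end]).

(** * The balance function and its divided differences in p *)

Section BalanceFunction.
Context {R : realType}.
Variable r : R.
Hypothesis r0 : 0 < r.
Implicit Types (z p y : plane R).

(* [(bal_N1 p z, bal_N2 p z) = (z - p)(1 - p conj(z))] and [bal_D p z = |1 - conj(p) z|^2 + r^2 |z - p|^2], so that [bal1], [bal2] are the components of [psi r (Phi (- p) z)]. *)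
Definition bal_D p z : R := (1 - (p.1 * z.1 + p.2 * z.2)) ^+ 2 + (p.1 * z.2 - p.2 * z.1) ^+ 2
  + r ^+ 2 * ((z.1 - p.1) ^+ 2 + (z.2 - p.2) ^+ 2).
Definition bal_N1 p z : R := z.1 - p.1 * (1 + nrm2 z) + ((p.1 ^+ 2 - p.2 ^+ 2) * z.1 + 2 * p.1 * p.2 * z.2).
Definition bal_N2 p z : R := z.2 - p.2 * (1 + nrm2 z) + (2 * p.1 * p.2 * z.1 - (p.1 ^+ 2 - p.2 ^+ 2) * z.2).
Definition bal1 p z : R := 2 * r * bal_N1 p z / bal_D p z.
Definition bal2 p z : R := 2 * r * bal_N2 p z / bal_D p z.

(** A zero would force z = p and |p| = 1. The bound covers the pole 1 / conj(p) of [Phi (- p)] as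
    well: composed with [psi r], a map into the sphere, the pole disappears. Hence [bal1] and [bal2]
    are C^1 on the whole plane. *)
Lemma bal_D_neq0 p z : disc p -> bal_D p z != 0.
Proof.
case: p z => [p1 p2] [x y]; rewrite /disc /nrm2 /bal_D /= => p1lt.
have r2 : 0 < r ^+ 2 by rewrite exprn_gt0.
apply/eqP => D0.
have hA := sqr_ge0 (1 - (p1 * x + p2 * y)); have hB := sqr_ge0 (p1 * y - p2 * x).
have hX := sqr_ge0 (x - p1); have hY := sqr_ge0 (y - p2).
have hX' : 0 <= r ^+ 2 * (x - p1) ^+ 2 by rewrite mulr_ge0// ltW.
have hY' : 0 <= r ^+ 2 * (y - p2) ^+ 2 by rewrite mulr_ge0// ltW.
have eA : (1 - (p1 * x + p2 * y)) ^+ 2 = 0 by lra.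
have eX : r ^+ 2 * (x - p1) ^+ 2 = 0 by lra.
have eY : r ^+ 2 * (y - p2) ^+ 2 = 0 by lra.
move/eqP : eA; rewrite sqrf_eq0 => /eqP eA.
move/eqP : eX; rewrite mulf_eq0 (gt_eqF r2) /= sqrf_eq0 subr_eq0 => /eqP eX.
move/eqP : eY; rewrite mulf_eq0 (gt_eqF r2) /= sqrf_eq0 subr_eq0 => /eqP eY.
by move: eA; rewrite eX eY -!expr2; lra.
Qed.

(* The divided differences of [bal_N] and [bal_D] in the variable [p]; their sum [s] is [p + q]. *)
Definition dif_c1 (s : plane R) z : R := - (1 + nrm2 z) + (s.1 * z.1 + s.2 * z.2).
Definition dif_c2 (s : plane R) z : R := s.2 * z.1 - s.1 * z.2.
Definition dif_D1 (s : plane R) z : R := - 2 * (1 + r ^+ 2) * z.1 + (nrm2 z + r ^+ 2) * s.1.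
Definition dif_D2 (s : plane R) z : R := - 2 * (1 + r ^+ 2) * z.2 + (nrm2 z + r ^+ 2) * s.2.

Definition psum p q : plane R := (p.1 + q.1, p.2 + q.2).

(** Entries of a matrix that takes p - q to the increment of ([bal1], [bal2]), from N_p/D_p -
    N_q/D_q = (N_p - N_q)/D_p - N_q (D_p - D_q)/(D_p D_q). At p = q they are the partial
    derivatives. *)
Definition dif11 q p z : R := 2 * r * (dif_c1 (psum p q) z / bal_D p z
  - bal_N1 q z * dif_D1 (psum p q) z / (bal_D p z * bal_D q z)).
Definition dif12 q p z : R := 2 * r * (- dif_c2 (psum p q) z / bal_D p z
  - bal_N1 q z * dif_D2 (psum p q) z / (bal_D p z * bal_D q z)).
Definition dif21 q p z : R := 2 * r * (dif_c2 (psum p q) z / bal_D p z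
  - bal_N2 q z * dif_D1 (psum p q) z / (bal_D p z * bal_D q z)).
Definition dif22 q p z : R := 2 * r * (dif_c1 (psum p q) z / bal_D p z
  - bal_N2 q z * dif_D2 (psum p q) z / (bal_D p z * bal_D q z)).

(** An exact identity in place of a Taylor expansion: no remainder has to be controlled, so
    continuity of p in time suffices later. *)
Lemma bal1_dif q p z : disc q -> disc p ->
  bal1 p z - bal1 q z = dif11 q p z * (p.1 - q.1) + dif12 q p z * (p.2 - q.2).
Proof.
move=> /(@bal_D_neq0 _ z) Dq /(@bal_D_neq0 _ z) Dp.
rewrite /bal1 /dif11 /dif12.
have EN : bal_N1 p z = bal_N1 q z + (dif_c1 (psum p q) z * (p.1 - q.1) - dif_c2 (psum p q) z * (p.2 - q.2)).
  by rewrite /bal_N1 /dif_c1 /dif_c2 /psum /=; ring.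
have ED : dif_D1 (psum p q) z * (p.1 - q.1) + dif_D2 (psum p q) z * (p.2 - q.2) = bal_D p z - bal_D q z.
  by rewrite /bal_D /dif_D1 /dif_D2 /psum /nrm2 /=; ring.
rewrite EN; move: ED Dq Dp; move: (bal_D p z) (bal_D q z) (dif_D1 _ _) (dif_D2 _ _) => Dp Dq e1 e2 ED Dq0 Dp0.
have -> : Dp = Dq + (e1 * (p.1 - q.1) + e2 * (p.2 - q.2)) by rewrite ED; ring.
by field; apply/andP; split => //; apply: contra Dp0 => /eqP h; apply/eqP; lra.
Qed.

Lemma bal2_dif q p z : disc q -> disc p ->
  bal2 p z - bal2 q z = dif21 q p z * (p.1 - q.1) + dif22 q p z * (p.2 - q.2).
Proof.
move=> /(@bal_D_neq0 _ z) Dq /(@bal_D_neq0 _ z) Dp.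
rewrite /bal2 /dif21 /dif22.
have EN : bal_N2 p z = bal_N2 q z + (dif_c2 (psum p q) z * (p.1 - q.1) + dif_c1 (psum p q) z * (p.2 - q.2)).
  by rewrite /bal_N2 /dif_c1 /dif_c2 /psum /=; ring.
have ED : dif_D1 (psum p q) z * (p.1 - q.1) + dif_D2 (psum p q) z * (p.2 - q.2) = bal_D p z - bal_D q z.
  by rewrite /bal_D /dif_D1 /dif_D2 /psum /nrm2 /=; ring.
rewrite EN; move: ED Dq Dp; move: (bal_D p z) (bal_D q z) (dif_D1 _ _) (dif_D2 _ _) => Dp Dq e1 e2 ED Dq0 Dp0.
have -> : Dp = Dq + (e1 * (p.1 - q.1) + e2 * (p.2 - q.2)) by rewrite ED; ring.
by field; apply/andP; split => //; apply: contra Dp0 => /eqP h; apply/eqP; lra.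
Qed.

Definition cap_D y : R := 1 + r ^+ 2 * nrm2 y.

Lemma cap_D_gt0 y : 0 < cap_D y.
Proof. by rewrite ltr_pwDl// mulr_ge0 ?sqr_ge0// nrm2_ge0. Qed.

(** With z = Phi_p(y) one has z - p = S y / (1 + conj(p) y) and 1 - conj(p) z = S / (1 + conj(p) y),
    where S = 1 - |p|^2. The formulas for [bal_N1] and [bal_N2] have the same source. *)
Lemma bal_D_Phi p y : disc p -> cdisc y ->
  bal_D p (Phi p y) = mob_S p 1 ^+ 2 * cap_D y / mob_D p 1 y.
Proof.
move=> p1 yd; have D : mob_D p 1 y != 0 by apply: mob_D_neq0 => //; rewrite expr1n mul1r.
rewrite PhiE; move: D; rewrite /bal_D /cap_D /mob1 /mob2 /mob_S /mob_D /mob_a /mob_b /nrm2 /= expr1n !mul1r.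
by move: y.1 y.2 p.1 p.2 => a b q1 q2 D; field.
Qed.

Lemma bal_N1_Phi p y : disc p -> cdisc y ->
  bal_N1 p (Phi p y) = mob_S p 1 ^+ 2 * y.1 / mob_D p 1 y.
Proof.
move=> p1 yd; have D : mob_D p 1 y != 0 by apply: mob_D_neq0 => //; rewrite expr1n mul1r.
rewrite PhiE; move: D; rewrite /bal_N1 /mob1 /mob2 /mob_S /mob_D /mob_a /mob_b /nrm2 /= expr1n !mul1r.
by move: y.1 y.2 p.1 p.2 => a b q1 q2 D; field.
Qed.

Lemma bal_N2_Phi p y : disc p -> cdisc y ->
  bal_N2 p (Phi p y) = mob_S p 1 ^+ 2 * y.2 / mob_D p 1 y.
Proof.
move=> p1 yd; have D : mob_D p 1 y != 0 by apply: mob_D_neq0 => //; rewrite expr1n mul1r.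
rewrite PhiE; move: D; rewrite /bal_N2 /mob1 /mob2 /mob_S /mob_D /mob_a /mob_b /nrm2 /= expr1n !mul1r.
by move: y.1 y.2 p.1 p.2 => a b q1 q2 D; field.
Qed.

Lemma bal1_Phi p y : disc p -> cdisc y -> bal1 p (Phi p y) = (psi r y).1.
Proof.
move=> p1 yd; rewrite /bal1 bal_N1_Phi// bal_D_Phi// /psi /= -/(cap_D y).
have := cap_D_gt0 y; have := mob_S_gt0 p1; move=> S0 c0.
have D : mob_D p 1 y != 0 by apply: mob_D_neq0 => //; rewrite expr1n mul1r.
by field; rewrite D !gt_eqF.
Qed.

Lemma bal2_Phi p y : disc p -> cdisc y -> bal2 p (Phi p y) = (psi r y).2.
Proof.
move=> p1 yd; rewrite /bal2 bal_N2_Phi// bal_D_Phi// /psi /= -/(cap_D y).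
have := cap_D_gt0 y; have := mob_S_gt0 p1; move=> S0 c0.
have D : mob_D p 1 y != 0 by apply: mob_D_neq0 => //; rewrite expr1n mul1r.
by field; rewrite D !gt_eqF.
Qed.

(** With [mat12] and [mat22], the density of the matrix M: minus the derivative of
    [psi r (Phi (- p) y)] with respect to p at p = 0. *)
Definition mat11 y : R := 2 * r * ((1 + nrm2 y) * cap_D y - 2 * (1 + r ^+ 2) * y.1 ^+ 2) / cap_D y ^+ 2.
Definition mat12 y : R := 2 * r * (- (2 * (1 + r ^+ 2) * (y.1 * y.2))) / cap_D y ^+ 2.
Definition mat22 y : R := 2 * r * ((1 + nrm2 y) * cap_D y - 2 * (1 + r ^+ 2) * y.2 ^+ 2) / cap_D y ^+ 2.

Lemma dif_c1_Phi p y : disc p -> cdisc y ->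
  dif_c1 (psum p p) (Phi p y) = - mob_S p 1 * ((1 + nrm2 y) + 2 * (p.1 * y.1 + p.2 * y.2)) / mob_D p 1 y.
Proof.
move=> p1 yd; have D : mob_D p 1 y != 0 by apply: mob_D_neq0 => //; rewrite expr1n mul1r.
rewrite PhiE; move: D; rewrite /dif_c1 /psum /mob1 /mob2 /mob_S /mob_D /mob_a /mob_b /nrm2 /= expr1n !mul1r.
by move: y.1 y.2 p.1 p.2 => a b q1 q2 D; field.
Qed.
Lemma dif_c2_Phi p y : disc p -> cdisc y ->
  dif_c2 (psum p p) (Phi p y) = - 2 * mob_S p 1 * (p.1 * y.2 - p.2 * y.1) / mob_D p 1 y.
Proof.
move=> p1 yd; have D : mob_D p 1 y != 0 by apply: mob_D_neq0 => //; rewrite expr1n mul1r.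
rewrite PhiE; move: D; rewrite /dif_c2 /psum /mob1 /mob2 /mob_S /mob_D /mob_a /mob_b /nrm2 /= expr1n !mul1r.
by move: y.1 y.2 p.1 p.2 => a b q1 q2 D; field.
Qed.

Lemma dif_D1_Phi p y : disc p -> cdisc y -> dif_D1 (psum p p) (Phi p y) =
  - 2 * mob_S p 1 * ((y.1 + p.1) + r ^+ 2 * (y.1 + p.1 * nrm2 y)) / mob_D p 1 y.
Proof.
move=> p1 yd; have D : mob_D p 1 y != 0 by apply: mob_D_neq0 => //; rewrite expr1n mul1r.
rewrite PhiE; move: D; rewrite /dif_D1 /psum /mob1 /mob2 /mob_S /mob_D /mob_a /mob_b /nrm2 /= expr1n !mul1r.
by move: y.1 y.2 p.1 p.2 => a b q1 q2 D; field.
Qed.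

Lemma dif_D2_Phi p y : disc p -> cdisc y -> dif_D2 (psum p p) (Phi p y) =
  - 2 * mob_S p 1 * ((y.2 + p.2) + r ^+ 2 * (y.2 + p.2 * nrm2 y)) / mob_D p 1 y.
Proof.
move=> p1 yd; have D : mob_D p 1 y != 0 by apply: mob_D_neq0 => //; rewrite expr1n mul1r.
rewrite PhiE; move: D; rewrite /dif_D2 /psum /mob1 /mob2 /mob_S /mob_D /mob_a /mob_b /nrm2 /= expr1n !mul1r.
by move: y.1 y.2 p.1 p.2 => a b q1 q2 D; field.
Qed.

(* The terms with [psi] come from an infinitesimal rotation; they disappear after integration because of the balance condition. *)
Lemma dif_Phi p y : disc p -> cdisc y ->
  [/\ dif11 p p (Phi p y) = - (mat11 y + 2 * p.2 * (psi r y).2) / mob_S p 1,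
      dif12 p p (Phi p y) = - (mat12 y - 2 * p.1 * (psi r y).2) / mob_S p 1,
      dif21 p p (Phi p y) = - (mat12 y - 2 * p.2 * (psi r y).1) / mob_S p 1 &
      dif22 p p (Phi p y) = - (mat22 y + 2 * p.1 * (psi r y).1) / mob_S p 1].
Proof.
move=> p1 yd; have D : mob_D p 1 y != 0 by apply: mob_D_neq0 => //; rewrite expr1n mul1r.
have S0 : mob_S p 1 != 0 by rewrite gt_eqF// mob_S_gt0.
have c0 : cap_D y != 0 by rewrite gt_eqF// cap_D_gt0.
rewrite /dif11 /dif12 /dif21 /dif22 dif_c1_Phi// dif_c2_Phi// dif_D1_Phi// dif_D2_Phi//.
rewrite bal_D_Phi// bal_N1_Phi// bal_N2_Phi// /mat11 /mat12 /mat22 /psi /= -/(cap_D y).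
move: D S0 c0; rewrite /cap_D /nrm2; move: (mob_D p 1 y) (mob_S p 1) y.1 y.2 p.1 p.2 => D S y1 y2 q1 q2 D0 S0 c0.
by split; field; rewrite D0 S0 c0.
Qed.

Lemma is_C1_nrm2 : is_C1 (@nrm2 R).
Proof. by rewrite /nrm2; isC1. Qed.

Lemma is_C1_bal_D p : is_C1 (bal_D p).
Proof. by rewrite /bal_D; isC1. Qed.

Lemma is_C1_bal p : disc p -> is_C1 (bal1 p) /\ is_C1 (bal2 p).
Proof.
move=> p1; have h1 := is_C1_bal_D p; have h2 := is_C1_nrm2; have D0 z := @bal_D_neq0 p z p1.
by split; rewrite /bal1 /bal2 /bal_N1 /bal_N2; isC1.
Qed.

Lemma is_C1_dif q p : disc q -> disc p ->
  [/\ is_C1 (dif11 q p), is_C1 (dif12 q p), is_C1 (dif21 q p) & is_C1 (dif22 q p)].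
Proof.
move=> q1 p1; have h1 := is_C1_bal_D p; have h2 := is_C1_nrm2; have D0 z := @bal_D_neq0 p z p1.
have h3 := is_C1_bal_D q; have D1 z := @bal_D_neq0 q z q1.
have D2 z : bal_D p z * bal_D q z != 0 by rewrite mulf_neq0.
by split; rewrite /dif11 /dif12 /dif21 /dif22 /bal_N1 /bal_N2 /dif_c1 /dif_c2 /dif_D1 /dif_D2; isC1.
Qed.

Lemma is_C1_mat : [/\ is_C1 mat11, is_C1 mat12 & is_C1 mat22].
Proof.
have h2 := is_C1_nrm2; have D0 z : cap_D z ^+ 2 != 0 by rewrite expf_neq0// gt_eqF// cap_D_gt0.
have h1 : is_C1 cap_D by rewrite /cap_D; isC1.
by split; rewrite /mat11 /mat12 /mat22; isC1.
Qed.

Lemma is_C1_psi : is_C1 (fun z => (psi r z).1) /\ is_C1 (fun z => (psi r z).2).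
Proof.
have h2 := is_C1_nrm2; have D0 z : 1 + r ^+ 2 * nrm2 z != 0 by rewrite gt_eqF// cap_D_gt0.
by split; rewrite /psi /=; isC1.
Qed.

Lemma cont_dif (P : R -> plane R) q (t : R) z : disc q -> disc (P t) ->
  cont_at (fun s => (P s).1) t -> cont_at (fun s => (P s).2) t ->
  [/\ cont_at (fun x : R * plane R => dif11 q (P x.1) x.2) (t, z),
      cont_at (fun x : R * plane R => dif12 q (P x.1) x.2) (t, z),
      cont_at (fun x : R * plane R => dif21 q (P x.1) x.2) (t, z) &
      cont_at (fun x : R * plane R => dif22 q (P x.1) x.2) (t, z)].
Proof.
move=> q1 p1 c1 c2.
have k1 : cont_at (fun x : R * plane R => (P x.1).1) (t, z).
  by apply: (@cont_at_comp R _ _ (fun s => (P s).1) (fun x : R * plane R => x.1)) => //; exact: cvg_fst.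
have k2 : cont_at (fun x : R * plane R => (P x.1).2) (t, z).
  by apply: (@cont_at_comp R _ _ (fun s => (P s).2) (fun x : R * plane R => x.1)) => //; exact: cvg_fst.
have kD : cont_at (fun x : R * plane R => bal_D (P x.1) x.2) (t, z) by rewrite /bal_D; cont.
have kq : cont_at (fun x : R * plane R => bal_D q x.2) (t, z) by rewrite /bal_D; cont.
have D0 := @bal_D_neq0 _ z p1; have D1 := @bal_D_neq0 _ z q1.
have D2 : bal_D (P t) z * bal_D q z != 0 by rewrite mulf_neq0.
by split; rewrite /dif11 /dif12 /dif21 /dif22 /bal_N1 /bal_N2 /dif_c1 /dif_c2 /dif_D1 /dif_D2 /psum /nrm2 /=; cont.
Qed.

(** The form degenerates on the circle in the radial direction, hence the weak inequality on the
    closed disc and the strict one inside; this is the pair that [moment_gt0] takes. *)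
Lemma mat_pos (d1 d2 : R) y : r < 1 -> cdisc y ->
  0 <= mat11 y * d1 ^+ 2 + 2 * mat12 y * d1 * d2 + mat22 y * d2 ^+ 2 /\
  (disc y -> (d1, d2) != (0, 0) -> 0 < mat11 y * d1 ^+ 2 + 2 * mat12 y * d1 * d2 + mat22 y * d2 ^+ 2).
Proof.
move=> r1 yd; have c0 := cap_D_gt0 y.
(* Lagrange's identity replaces (d . y)^2 by |d|^2 |y|^2 minus the squared cross product, which
   turns the form into a sum of two nonnegative terms for r < 1. *)
have E : mat11 y * d1 ^+ 2 + 2 * mat12 y * d1 * d2 + mat22 y * d2 ^+ 2 =
  2 * r * ((1 - nrm2 y) * (1 - r ^+ 2 * nrm2 y) * (d1 ^+ 2 + d2 ^+ 2)
     + 2 * (1 + r ^+ 2) * (d1 * y.2 - d2 * y.1) ^+ 2) / cap_D y ^+ 2.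
  by move: c0; rewrite /mat11 /mat12 /mat22 /cap_D /nrm2 => c0; field; rewrite gt_eqF.
have r2 : r ^+ 2 < 1 by rewrite expr_lt1// ltW.
have n0 := nrm2_ge0 y.
have rn : r ^+ 2 * nrm2 y < 1 by move: yd; rewrite /cdisc /=; have := sqr_ge0 r; nra.
have T : 0 <= 2 * (1 + r ^+ 2) * (d1 * y.2 - d2 * y.1) ^+ 2.
  by rewrite mulr_ge0 ?sqr_ge0// mulr_ge0// addr_ge0// sqr_ge0.
have d0 : 0 <= d1 ^+ 2 + d2 ^+ 2 by rewrite addr_ge0// sqr_ge0.
rewrite E; split=> [|yd' dn].
  rewrite divr_ge0 ?sqr_ge0// mulr_ge0 ?mulr_ge0 ?(ltW r0)// addr_ge0// mulr_ge0// mulr_ge0//.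
    by rewrite subr_ge0.
  by rewrite subr_ge0 ltW.
rewrite divr_gt0 ?exprn_gt0// mulr_gt0 ?mulr_gt0// ltr_pwDl// mulr_gt0//.
  by rewrite mulr_gt0// subr_gt0.
rewrite lt_neqAle d0 andbT eq_sym; apply: contra dn => /eqP dd.
have e1 : d1 ^+ 2 = 0 by have := sqr_ge0 d1; have := sqr_ge0 d2; lra.
have e2 : d2 ^+ 2 = 0 by have := sqr_ge0 d1; have := sqr_ge0 d2; lra.
by move/eqP: e1; move/eqP: e2; rewrite !sqrf_eq0 => /eqP -> /eqP ->.
Qed.

End BalanceFunction.

(** * Differentiating a solution of a linear system *)

Section ImplicitDerivative.
Context {R : realType}.

(** The increments of [p1], [p2] solve a linear system exactly, and its matrix is continuous at [t]
    and invertible there, hence nearby. Solving it exhibits slope functions of [p1] and [p2] that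
    are continuous at [t], which is differentiability in Caratheodory's form. *)
Lemma implicit_deriv (p1 p2 q11 q12 q21 q22 f1 f2 : R -> R) (t g1 g2 : R) :
  cont_at q11 t -> cont_at q12 t -> cont_at q21 t -> cont_at q22 t ->
  q11 t * q22 t - q12 t * q21 t != 0 ->
  has_deriv f1 t g1 -> has_deriv f2 t g2 ->
  (\forall s \near t,
     q11 s * (p1 s - p1 t) + q12 s * (p2 s - p2 t) + (f1 s - f1 t) = 0 /\
     q21 s * (p1 s - p1 t) + q22 s * (p2 s - p2 t) + (f2 s - f2 t) = 0) ->
  exists d1 d2, [/\ has_deriv p1 t d1, has_deriv p2 t d2,
    q11 t * d1 + q12 t * d2 + g1 = 0 & q21 t * d1 + q22 t * d2 + g2 = 0].
Proof.
move=> c11 c12 c21 c22 D0 /is_derive1_caratheodory[F1 [E1 cF1 <-]] /is_derive1_caratheodory[F2 [E2 cF2 <-]] eqs.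
pose D s := q11 s * q22 s - q12 s * q21 s.
have cD : cont_at D t by rewrite /D; cont.
(* Cramer's rule, with the slopes [F1], [F2] of [f1], [f2] as right-hand side. *)
pose e1 s := (q12 s * F2 s - q22 s * F1 s) / D s.
pose e2 s := (q21 s * F1 s - q11 s * F2 s) / D s.
have ce1 : cont_at e1 t by rewrite /e1; cont.
have ce2 : cont_at e2 t by rewrite /e2; cont.
have Dn : \forall s \near t, D s != 0.
  by apply: (cD [set x | x != 0]); apply: open_nbhs_nbhs; split => //; exact: open_neq.
exists (e1 t), (e2 t); split.
- apply: (@has_deriv_near _ (fun s => p1 t + e1 s * (s - t))).
    near=> s; have Ds : D s != 0 by near: s.
    have [h1 h2] : q11 s * (p1 s - p1 t) + q12 s * (p2 s - p2 t) + (f1 s - f1 t) = 0 /\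
      q21 s * (p1 s - p1 t) + q22 s * (p2 s - p2 t) + (f2 s - f2 t) = 0 by near: s.
    rewrite E1 in h1; rewrite E2 in h2.
    have De : D s * e1 s = q12 s * F2 s - q22 s * F1 s by rewrite /e1 mulrC divfK.
    apply: (mulfI Ds); rewrite mulrDr mulrA De.
    have k1 : q11 s * (p1 s - p1 t) + q12 s * (p2 s - p2 t) = - (F1 s * (s - t)) by lra.
    have k2 : q21 s * (p1 s - p1 t) + q22 s * (p2 s - p2 t) = - (F2 s * (s - t)) by lra.
    have : q22 s * (q11 s * (p1 s - p1 t) + q12 s * (p2 s - p2 t)) - q12 s * (q21 s * (p1 s - p1 t) + q22 s * (p2 s - p2 t))
       = D s * (p1 s - p1 t) by rewrite /D; ring.
    by rewrite k1 k2 => h; lra.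
  apply/is_derive1_caratheodory; exists e1; split=> // s.
  by rewrite subrr mulr0; ring.
- apply: (@has_deriv_near _ (fun s => p2 t + e2 s * (s - t))).
    near=> s; have Ds : D s != 0 by near: s.
    have [h1 h2] : q11 s * (p1 s - p1 t) + q12 s * (p2 s - p2 t) + (f1 s - f1 t) = 0 /\
      q21 s * (p1 s - p1 t) + q22 s * (p2 s - p2 t) + (f2 s - f2 t) = 0 by near: s.
    rewrite E1 in h1; rewrite E2 in h2.
    have De : D s * e2 s = q21 s * F1 s - q11 s * F2 s by rewrite /e2 mulrC divfK.
    apply: (mulfI Ds); rewrite mulrDr mulrA De.
    have k1 : q11 s * (p1 s - p1 t) + q12 s * (p2 s - p2 t) = - (F1 s * (s - t)) by lra.
    have k2 : q21 s * (p1 s - p1 t) + q22 s * (p2 s - p2 t) = - (F2 s * (s - t)) by lra.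
    have : q11 s * (q21 s * (p1 s - p1 t) + q22 s * (p2 s - p2 t)) - q21 s * (q11 s * (p1 s - p1 t) + q12 s * (p2 s - p2 t))
       = D s * (p2 s - p2 t) by rewrite /D; ring.
    by rewrite k1 k2 => h; lra.
  apply/is_derive1_caratheodory; exists e2; split=> // s.
  by rewrite subrr mulr0; ring.
- by move: D0; rewrite /e1 /e2 /D => D0; field.
- by move: D0; rewrite /e1 /e2 /D => D0; field.
Unshelve. all: by end_near. Qed.

Lemma cont_intB (G : R -> plane R -> R) (t : R) :
  (forall z, cdisc z -> cont_at (fun q : R * plane R => G q.1 q.2) (t, z)) ->
  (\forall s \near t, cont_cdisc (G s)) ->
  cont_at (fun s => intB (G s)) t.
Proof.
move=> cG cs; apply/cvgrPdist_le => e e0.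
have m0 : 0 < fine (mu2 (@disc R)) + 1 by rewrite ltr_wpDl// fine_ge0.
have U := compact_unif_near (@cdisc_compact R) cG (divr_gt0 e0 m0).
have c0 : cont_cdisc (G t) := nbhs_singleton cs.
near=> s.
have c1 : cont_cdisc (G s) by near: s.
have US : forall z, cdisc z -> `|G s z - G t z| < e / (fine (mu2 (@disc R)) + 1) by near: s.
apply: (@le_trans _ _ (e / (fine (mu2 (@disc R)) + 1) * fine (mu2 (@disc R)))).
  by apply: intB_close => // z /disc_cdisc /US; rewrite distrC => /ltW.
rewrite -mulrA ler_piMr//; first exact: ltW.
by rewrite mulrC ler_pdivrMr// mul1r lerDl.
Unshelve. all: by end_near. Qed.

Lemma cont_intS (G : R -> plane R -> R) (t : R) :
  (forall z, cdisc z -> cont_at (fun q : R * plane R => G q.1 q.2) (t, z)) ->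
  (\forall s \near t, cont_cdisc (G s)) ->
  cont_at (fun s => intS (G s)) t.
Proof.
move=> cG cs; apply/cvgrPdist_le => e e0.
have m0 : 0 < 2 * pi :> R by rewrite mulr_gt0// pi_gt0.
have U := compact_unif_near (@cdisc_compact R) cG (divr_gt0 e0 m0).
have c0 : cont_cdisc (G t) := nbhs_singleton cs.
near=> s.
have c1 : cont_cdisc (G s) by near: s.
have US : forall z, cdisc z -> `|G s z - G t z| < e / (2 * pi) by near: s.
apply: (@le_trans _ _ (e / (2 * pi) * (2 * pi))); last by rewrite divfK// gt_eqF.
apply: intS_close; [exact: cont_cdisc_circle|exact: cont_cdisc_circle|].
by move=> z /circle_cdisc /US; rewrite distrC => /ltW.
Unshelve. all: by end_near. Qed.

End ImplicitDerivative.

(** * From smoothness in space-time to slices; passage to the boundary *)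

Section SmoothSlices.
Context {R : realType}.
Implicit Types (z : plane R) (s : R).

Definition halfspace : set (R * plane R) := [set q | 0 < q.1].
Definition dir_t : R * plane R := (1, (0, 0)).
Definition dir_x : R * plane R := (0, (1, 0)).
Definition dir_y : R * plane R := (0, (0, 1)).

Lemma smooth_on_cont (V : normedModType R) (D : set V) (F : V -> R) q :
  smooth_on D F -> D q -> F @ q --> F q.
Proof. by move=> hF Dq; have [h _] := hF 0%N; exact: h. Qed.

Lemma smooth_on_derivable (V : normedModType R) (D : set V) (F : V -> R) q v :
  smooth_on D F -> D q -> derivable F q v.
Proof. by move=> hF Dq; have [_ h] := hF 1%N; have [h1 _] := h v; exact: h1. Qed.

Lemma smooth_on_derive (V : normedModType R) (D : set V) (F : V -> R) v :
  smooth_on D F -> smooth_on D ('D_v F).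
Proof. by move=> hF k; have [_ h] := hF k.+1; have [_] := h v. Qed.

Lemma has_deriv_line (V : normedModType R) (F : V -> R) (q v : V) (g : R -> R) (x : R) :
  derivable F q v -> (forall h : R, g (h + x) = F (h *: v + q)) ->
  has_deriv g x ('D_v F q).
Proof.
move=> hF hg.
have E : (fun h : R => h^-1 *: ((F \o shift q) (h *: v) - F q)) =
   (fun h : R => h^-1 *: ((g \o shift x) (h *: 1) - g x)).
  apply/funext => h /=; rewrite -[h *: 1]/(h * 1) mulr1 hg.
  by rewrite -[in g x](add0r x) hg scale0r add0r.
by apply: DeriveDef; [rewrite /derivable -E; exact: hF|rewrite /derive -E].
Qed.

Lemma halfspace_deriv_t (F : R * plane R -> R) s z : smooth_on halfspace F -> 0 < s ->
  has_deriv (fun t => F (t, z)) s ('D_dir_t F (s, z)).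
Proof.
move=> hF s0; apply: has_deriv_line; first exact: smooth_on_derivable hF _.
move=> h; congr (F _); rewrite /dir_t; case: z => x y.
by congr ((_, (_, _))); rewrite /= ?scaler0 ?add0r// /GRing.scale /= mulr1.
Qed.

Lemma halfspace_deriv_x (F : R * plane R -> R) s x y : smooth_on halfspace F -> 0 < s ->
  has_deriv (fun x => F (s, (x, y))) x ('D_dir_x F (s, (x, y))).
Proof.
move=> hF s0; apply: has_deriv_line; first exact: smooth_on_derivable hF _.
move=> h; congr (F _); rewrite /dir_x.
by congr ((_, (_, _))); rewrite /= ?scaler0 ?add0r// /GRing.scale /= mulr1.
Qed.

Lemma halfspace_deriv_y (F : R * plane R -> R) s x y : smooth_on halfspace F -> 0 < s ->
  has_deriv (fun y => F (s, (x, y))) y ('D_dir_y F (s, (x, y))).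
Proof.
move=> hF s0; apply: has_deriv_line; first exact: smooth_on_derivable hF _.
move=> h; congr (F _); rewrite /dir_y.
by congr ((_, (_, _))); rewrite /= ?scaler0 ?add0r// /GRing.scale /= mulr1.
Qed.

Lemma halfspace_C1 (F : R * plane R -> R) s : smooth_on halfspace F -> 0 < s ->
  C1 (fun z => F (s, z)) (fun z => 'D_dir_x F (s, z)) (fun z => 'D_dir_y F (s, z)).
Proof.
move=> hF s0.
have sec (G : R * plane R -> R) z : smooth_on halfspace G -> cont_at (fun z => G (s, z)) z.
  move=> hG; apply: (@cont_at_section R R (plane R) (fun s z => G (s, z)) s z).
  have -> : (fun q : R * plane R => G (q.1, q.2)) = G by apply/funext => -[].
  exact: smooth_on_cont hG _.
split=> [z|z|z|x y|x y].
- exact: sec.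
- by apply: (sec ('D_dir_x F)); exact: smooth_on_derive.
- by apply: (sec ('D_dir_y F)); exact: smooth_on_derive.
- exact: halfspace_deriv_x.
- exact: halfspace_deriv_y.
Qed.

Lemma C1_Dxy (k kx ky : plane R -> R) : C1 k kx ky -> Dx k = kx /\ Dy k = ky.
Proof.
move=> [_ _ _ hx hy]; split; apply/funext => -[x y].
  by have [_ ->] := @Dx_has_deriv R k (x, y) _ (hx x y).
by have [_ ->] := @Dy_has_deriv R k (x, y) _ (hy x y).
Qed.

Lemma is_C1_Dxy (k : plane R -> R) : is_C1 k -> C1 k (Dx k) (Dy k).
Proof. by move=> [kx [ky h]]; have [-> ->] := C1_Dxy h. Qed.

Lemma smooth_plane_C1 (F : plane R -> R) : smooth_on setT F -> is_C1 F.
Proof.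
move=> hF; exists ('D_((1, 0) : plane R) F), ('D_((0, 1) : plane R) F).
split=> [z|z|z|x y|x y].
- exact: smooth_on_cont hF _.
- by apply: smooth_on_cont I; exact: smooth_on_derive.
- by apply: smooth_on_cont I; exact: smooth_on_derive.
- apply: has_deriv_line; first exact: smooth_on_derivable hF _.
  by move=> h; congr (F (_, _)); rewrite /= ?scaler0 ?add0r// /GRing.scale /= mulr1.
- apply: has_deriv_line; first exact: smooth_on_derivable hF _.
  by move=> h; congr (F (_, _)); rewrite /= ?scaler0 ?add0r// /GRing.scale /= mulr1.
Qed.

Lemma Dnu_C1 (k kx ky : plane R -> R) z : C1 k kx ky ->
  Dnu k z = kx z * z.1 + ky z * z.2.
Proof.
move=> hk; case: z => x y.
have h : has_deriv (fun h => k (h * x + x, h * y + y)) 0 (kx (x, y) * x + ky (x, y) * y).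
  apply: has_deriv_eq.
    by apply: (has_deriv_comp2 hk (a := fun h => h * x + x) (b := fun h => h * y + y)); deriv.
  by rewrite !mul0r !add0r; ring.
have [_ /= <-] := h; rewrite /Dnu /derive.
suff -> : (fun h : R => h^-1 *: ((k \o shift (x, y)) (h *: ((x, y) : plane R)) - k (x, y))) =
  (fun h : R => h^-1 *: (((fun h => k (h * x + x, h * y + y)) \o shift 0) (h *: 1) - k (0 * x + x, 0 * y + y))) by [].
by apply/funext => s /=; rewrite addr0 -[s *: 1]/(s * 1) mulr1 !mul0r !add0r.
Qed.

(** A point of the closed disc is the limit of the interior points h z as h increases to 1. *)
Lemma le_cdisc (g : plane R -> R) (c : R) : cont_cdisc g ->
  (forall z, disc z -> g z <= c) -> forall z, cdisc z -> g z <= c.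
Proof.
move=> cg hg [x y] zd; rewrite leNgt; apply/negP => gz.
have ch : cont_at (fun h : R => g (h * x, h * y)) (1 : R).
  by cont; rewrite !mul1r; exact: cg.
have /nbhs_ballP[d /= d0 hd] : nbhs (1 : R) [set h : R | c < g (h * x, h * y)].
  apply: (ch [set t | c < t]); apply: open_nbhs_nbhs; split; first exact: open_gt.
  by rewrite /= !mul1r.
(* Within [d] of 1 and in [1/2, 1), so that h z lies in the open disc. *)
pose h : R := 1 - Num.min d 1 / 2.
have m0 : 0 < Num.min d 1 by rewrite lt_min d0 ltr01.
have m1 : Num.min d 1 <= 1 by rewrite ge_min lexx orbT.
have md : Num.min d 1 <= d by rewrite ge_min lexx.
have : c < g (h * x, h * y).
  apply: hd; rewrite /ball /= /h opprB addrC subrK ger0_norm; first by lra.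
  by rewrite divr_ge0// ltW.
rewrite ltNge hg//; move: zd; rewrite /cdisc /disc /nrm2 /=.
have h01 : 0 <= h < 1 by rewrite /h; lra.
have h2 : h ^+ 2 < 1 by nra.
have : 0 <= x ^+ 2 + y ^+ 2 by rewrite addr_ge0// sqr_ge0.
rewrite !exprMn -mulrDr; have := sqr_ge0 h; move: (x ^+ 2 + y ^+ 2) (h ^+ 2) h2 => n hh; nra.
Qed.

Lemma eq0_cdisc (g : plane R -> R) : cont_cdisc g ->
  (forall z, disc z -> g z = 0) -> forall z, cdisc z -> g z = 0.
Proof.
move=> cg hg z zd; apply/eqP; rewrite eq_le (@le_cdisc g)//=; last by move=> y /hg ->.
rewrite -oppr_le0 (@le_cdisc (fun z => - g z))//; last by move=> y /hg ->; rewrite oppr0.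
by move=> y yd; cont; exact: cg.
Qed.

End SmoothSlices.

(** * Regularity and the conserved mass of the flow *)

Section Flow.
Context {R : realType}.
Variables (f j : plane R -> R) (u : R -> plane R -> R) (rho : R -> R).
Hypotheses (f_smooth : smooth_cdisc f) (f_gt0 : forall z, cdisc z -> 0 < f z).
Hypotheses (j_ext : smooth_bdry_harmonic j) (j_gt0 : forall z, circle z -> 0 < j z).
Hypothesis flow : curvature_flow f j u rho.
Implicit Types (z : plane R) (s : R).

Let U (q : R * plane R) : R := u q.1 q.2.
Definition flow_dt s z : R := 'D_dir_t U (s, z).
Local Notation ut := flow_dt.

Let U_smooth : smooth_on (@halfspace R) U := flow_smooth flow.

Lemma flow_jcont s z : 0 < s -> cont_at (fun q : R * plane R => u q.1 q.2) (s, z).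
Proof. by move=> s0; exact: (smooth_on_cont U_smooth). Qed.

Lemma flow_dt_jcont s z : 0 < s -> cont_at (fun q : R * plane R => ut q.1 q.2) (s, z).
Proof.
move=> s0; rewrite (_ : (fun q => _) = 'D_dir_t U); last by apply/funext => -[].
by apply: smooth_on_cont (s0 : halfspace (s, z)); exact: smooth_on_derive.
Qed.

Lemma flow_has_deriv s z : 0 < s -> has_deriv (fun t => u t z) s (ut s z).
Proof. by move=> s0; exact: (halfspace_deriv_t z U_smooth). Qed.

Lemma flow_C1 s : 0 < s -> is_C1 (u s).
Proof. by move=> s0; eexists; eexists; exact: (halfspace_C1 U_smooth s0). Qed.

Lemma flow_dt_C1 s : 0 < s -> is_C1 (ut s).
Proof. by move=> s0; eexists; eexists; exact: (halfspace_C1 (smooth_on_derive dir_t U_smooth) s0). Qed.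

Lemma flow_Dx_C1 s : 0 < s -> is_C1 (Dx (u s)) /\ is_C1 (Dy (u s)).
Proof.
move=> s0; have [-> ->] := C1_Dxy (halfspace_C1 U_smooth s0); split; eexists; eexists.
  exact: (halfspace_C1 (smooth_on_derive dir_x U_smooth) s0).
exact: (halfspace_C1 (smooth_on_derive dir_y U_smooth) s0).
Qed.

Lemma f_extension : exists2 G, is_C1 G & forall z, cdisc z -> f z = G z.
Proof. by case: f_smooth => G [/smooth_plane_C1 hG fG]; exists G. Qed.

Lemma lap_cont s z : 0 < s -> cont_at (lap (u s)) z.
Proof.
move=> /flow_Dx_C1[/is_C1_Dxy h1 /is_C1_Dxy h2].
by rewrite /lap; apply: cont_atD; [exact: C1_contx h1 _|exact: C1_conty h2 _].
Qed.

Lemma near_pos s : 0 < s -> \forall t \near s, 0 < t.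
Proof. by move=> s0; apply: open_nbhs_nbhs; split => //; exact: open_gt. Qed.

Lemma flow_derive1 s z : 0 < s -> derive1 (fun t => u t z) s = ut s z.
Proof. by move=> s0; rewrite derive1E; have [] := flow_has_deriv z s0. Qed.

Lemma flow_dt_disc s z : 0 < s -> disc z ->
  ut s z = alpha_ f (u s) (rho s) * f z - Kg (u s) z.
Proof. by move=> s0 zd; rewrite -flow_derive1// (flow_inside flow). Qed.

(* On the circle this is the compatibility condition [K - alpha f = k - beta j], obtained by continuity from the interior. *)
Lemma flow_dt_cdisc s z : 0 < s -> cdisc z ->
  Kg (u s) z - alpha_ f (u s) (rho s) * f z = - ut s z.
Proof.
move=> s0; have [G hG fG] := f_extension; move=> zd; rewrite fG//.
set al := alpha_ _ _ _.
have cu := is_C1_cont (flow_C1 s0); have ct := is_C1_cont (flow_dt_C1 s0).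
have cG := is_C1_cont hG; have cl y := @lap_cont s y s0.
apply/eqP; rewrite -subr_eq0; apply/eqP; move: z zd.
apply: eq0_cdisc => [z _|z zd].
  by rewrite /Kg; cont; first [exact: cu|exact: cl|exact: cG|exact: ct].
by rewrite flow_dt_disc// (fG z (disc_cdisc zd)) -/al; ring.
Qed.

Definition mass (v : plane R -> R) : R :=
  2^-1 * intB (fun z => expR (2 * v z)) + intS (fun z => expR (v z)).

(** The weight 1/2 cancels the 2 from differentiating the exponential, so that disc and circle
    contribute [ut] with the same factor. *)
Lemma intB_flow_deriv (k : plane R -> R) s : 0 < s -> is_C1 k ->
  has_deriv (fun t => 2^-1 * intB (fun z => k z * expR (2 * u t z))) s
    (intB (fun z => k z * ut s z * expR (2 * u s z))).
Proof.
move=> s0 hk; have ck := is_C1_cont hk.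
apply: has_deriv_eq.
  apply: has_derivM; first exact: has_deriv_cst.
  apply: (@intB_derive R (fun s z => k z * expR (2 * u s z)) (fun s z => k z * (expR (2 * u s z) * (2 * ut s z)))).
  - move=> z _; have h1 := @flow_jcont s z s0; have h2 := @flow_dt_jcont s z s0.
    have h3 : cont_at (fun q : R * plane R => k q.2) (s, z).
      by apply: (@cont_at_comp R _ _ k snd) => //; exact: cvg_snd.
    by cont.
  - apply: filterS (near_pos s0) => t t0 z _; have h1 := is_C1_cont (flow_C1 t0).
    by cont; first [exact: ck|exact: h1].
  - apply: filterS (near_pos s0) => t t0 z _; have h1 := @flow_has_deriv t z t0.
    by apply: has_deriv_eq; [deriv|ring].
rewrite mul0r add0r -intBZ.
  by apply: eq_intB => z _; field.
move=> z _; have h1 := is_C1_cont (flow_C1 s0); have h2 := is_C1_cont (flow_dt_C1 s0).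
by cont; first [exact: ck|exact: h1|exact: h2].
Qed.

Lemma intS_flow_deriv (k : plane R -> R) s : 0 < s -> is_C1 k ->
  has_deriv (fun t => intS (fun z => k z * expR (u t z))) s
    (intS (fun z => k z * ut s z * expR (u s z))).
Proof.
move=> s0 hk; have ck := is_C1_cont hk.
apply: (@intS_derive R (fun s z => k z * expR (u s z)) (fun s z => k z * ut s z * expR (u s z))).
- move=> th; apply: (@jcont_disc_circle R [set s | 0 < s] (fun s z => k z * ut s z * expR (u s z))) => //.
  move=> t z t0 _; have h1 := @flow_jcont t z t0; have h2 := @flow_dt_jcont t z t0.
  have h3 : cont_at (fun q : R * plane R => k q.2) (t, z).
    by apply: (@cont_at_comp R _ _ k snd) => //; exact: cvg_snd.
  by cont.
- apply: filterS (near_pos s0) => t t0; apply: cont_cdisc_circle => z _; have h1 := is_C1_cont (flow_C1 t0).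
  by cont; first [exact: ck|exact: h1].
- apply: filterS (near_pos s0) => t t0 z _; have h1 := @flow_has_deriv t z t0.
  by apply: has_deriv_eq; [deriv|ring].
Qed.

Lemma j_cont_circle : cont_circle j.
Proof. by case: j_ext => hj _ _ _ th; exact: smooth_on_cont hj _. Qed.

(** The flow equations and the definitions of alpha and beta give 2 rho plus the integral of the
    Laplacian from the disc, and 2 (pi - rho) minus the integral of the normal derivative minus 2 pi
    from the circle. The divergence theorem makes the sum zero. *)
Lemma mass_deriv s : 0 < s -> has_deriv (fun t => mass (u t)) s 0.
Proof.
move=> s0; have [G hG fG] := f_extension.
have hu := flow_C1 s0; have ht := flow_dt_C1 s0; have [hx hy] := flow_Dx_C1 s0.
have cu := is_C1_cont hu; have ct := is_C1_cont ht; have cG := is_C1_cont hG.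
have cl z := @lap_cont s z s0.
have cx := is_C1_cont hx; have cy := is_C1_cont hy.
have h1 := is_C1_cst (1 : R).
have E1 t : mass (u t) = 2^-1 * intB (fun z => 1 * expR (2 * u t z)) + intS (fun z => 1 * expR (u t z)).
  by rewrite /mass; congr (_ * intB _ + Defs.intS _); apply/funext => z; rewrite mul1r.
apply: (@has_deriv_near _ (fun t => 2^-1 * intB (fun z => 1 * expR (2 * u t z)) + intS (fun z => 1 * expR (u t z)))).
  by near=> t; rewrite E1.
apply: has_deriv_eq (has_derivD (intB_flow_deriv s0 h1) (intS_flow_deriv s0 h1)) _.
set al := alpha_ f (u s) (rho s); set be := beta_ j (u s) (rho s).
(* Positivity of the two denominators allows the quotients in [alpha_] and [beta_] to be
   cancelled. *)
have fe0 : 0 < intB (fun z => f z * expR (2 * u s z)).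
  rewrite (@eq_intB _ _ (fun z => G z * expR (2 * u s z))); last by move=> z /disc_cdisc/fG ->.
  apply: intB_gt0 => [z _|z /disc_cdisc zd]; first by cont; [exact: cG|exact: cu].
  by rewrite -fG// mulr_gt0 ?f_gt0// expR_gt0.
have cje : cont_circle (fun z => j z * expR (u s z)).
  by move=> th; cont; [exact: j_cont_circle|exact: (is_C1_circle hu)].
have je0 : 0 < intS (fun z => j z * expR (u s z)).
  by apply: intS_gt0 => // z zc; rewrite mulr_gt0 ?j_gt0// expR_gt0.
have -> : intB (fun z => 1 * ut s z * expR (2 * u s z)) = 2 * rho s + intS (fun z => Dx (u s) z * z.1 + Dy (u s) z * z.2).
  rewrite -(@disc_divergence _ _ _ (Dx (Dx (u s))) (Dy (Dy (u s)))).
  - have -> : 2 * rho s = al * intB (fun z => f z * expR (2 * u s z)) by rewrite /al /alpha_ divfK// gt_eqF.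
    rewrite (@eq_intB _ (fun z => f z * _) (fun z => G z * expR (2 * u s z))); last by move=> z /disc_cdisc/fG ->.
    have c1 : cont_cdisc (fun z => G z * expR (2 * u s z)) by move=> z _; cont; [exact: cG|exact: cu].
    rewrite -intBZ// -intBD.
    + apply: eq_intB => z zd; rewrite flow_dt_disc// (fG z (disc_cdisc zd)) -/al /Kg /lap.
      have EE : expR (- (2 * u s z)) * expR (2 * u s z) = 1 by rewrite -expRD addNr expR0.
      apply: (@eq_trans _ _ (al * (G z * expR (2 * u s z)) + expR (- (2 * u s z)) * expR (2 * u s z) *
        (Dx (Dx (u s)) z + Dy (Dy (u s)) z))); [by ring|by rewrite EE mul1r].
    + by move=> z zd; apply: cont_atM; [exact: cont_at_cst|exact: c1].
    + by move=> z _; exact: cl.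
  - by move=> z _; exact: cx.
  - by move=> z _; exact: cy.
  - by move=> z _; exact: C1_contx (is_C1_Dxy hx) z.
  - by move=> z _; exact: C1_conty (is_C1_Dxy hy) z.
  - by move=> [x y] _; exact: C1_derx (is_C1_Dxy hx) x y.
  - by move=> [x y] _; exact: C1_dery (is_C1_Dxy hy) x y.
have -> : intS (fun z => 1 * ut s z * expR (u s z)) =
    2 * (pi - rho s) - (intS (fun z => Dx (u s) z * z.1 + Dy (u s) z * z.2) + 2 * pi).
  have -> : 2 * (pi - rho s) = be * intS (fun z => j z * expR (u s z)) by rewrite /be /beta_ divfK// gt_eqF.
  (* The length of the circle comes from the summand 1, the curvature of the flat circle, in
     [kg]. *)
  have -> : 2 * pi = intS (fun=> 1) :> R by rewrite intS_cst mul1r.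
  have c1 : cont_circle (fun z => Dx (u s) z * z.1 + Dy (u s) z * z.2).
    by apply: cont_cdisc_circle => z _; cont; [exact: cx|exact: cy].
  have c2 : cont_circle (fun=> 1 : R) by move=> th; cont.
  rewrite -intSZ// -intSD// -intSB.
  - apply: eq_intS => z zc; rewrite -flow_derive1// (flow_bdry flow)// -/be /kg (Dnu_C1 _ (is_C1_Dxy hu)).
    have EE : expR (- u s z) * expR (u s z) = 1 by rewrite -expRD addNr expR0.
    apply: (@eq_trans _ _ (be * (j z * expR (u s z)) - expR (- u s z) * expR (u s z) *
      (Dx (u s) z * z.1 + Dy (u s) z * z.2 + 1))); [by ring|by rewrite EE mul1r].
  - move=> th; apply: (@cont_atM _ _ (fun=> be) (fun t => j (cis t) * expR (u s (cis t)))).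
      exact: cont_at_cst.
    exact: cje.
  - move=> th; apply: (@cont_atD _ _ (fun t => Dx (u s) (cis t) * (cis t).1 + Dy (u s) (cis t) * (cis t).2) (fun=> 1)).
      exact: c1.
    exact: cont_at_cst.
by ring.
Unshelve. all: by end_near. Qed.

Lemma mass_conserved s t : 0 < s -> 0 < t -> mass (u s) = mass (u t).
Proof.
wlog st : s t / s <= t.
  move=> h s0 t0; have [st|/ltW ts] := leP s t; first exact: h.
  by symmetry; exact: h.
move=> s0 t0; apply: (@has_deriv0_cst _ (fun t => mass (u t))) => // x /andP[sx _].
by apply: mass_deriv; exact: lt_le_trans sx.
Qed.

End Flow.

(** * Moments of the area and length measures *)

Section Moments.
Context {R : realType}.
Implicit Types (k v : plane R -> R) (z p : plane R).

Definition moment k v : R :=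
  2^-1 * intB (fun z => k z * expR (2 * v z)) + intS (fun z => k z * expR (v z)).

Lemma eq_moment k l v w : (forall z, cdisc z -> k z = l z) ->
  (forall z, cdisc z -> v z = w z) -> moment k v = moment l w.
Proof.
move=> kl vw; rewrite /moment.
rewrite (@eq_intB _ _ (fun z => l z * expR (2 * w z))); last by move=> z /disc_cdisc zd; rewrite kl ?vw.
by rewrite (@eq_intS _ _ (fun z => l z * expR (w z)))// => z /circle_cdisc zd; rewrite kl ?vw.
Qed.

Lemma cont_weight k v : cont_cdisc k -> cont_cdisc v ->
  cont_cdisc (fun z => k z * expR (2 * v z)) /\ cont_circle (fun z => k z * expR (v z)).
Proof.
move=> ck cv; split.
  by move=> z zd; have h1 := ck _ zd; have h2 := cv _ zd; cont.
by apply: cont_cdisc_circle => z zd; have h1 := ck _ zd; have h2 := cv _ zd; cont.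
Qed.

Lemma momentD k l v : cont_cdisc k -> cont_cdisc l -> cont_cdisc v ->
  moment (fun z => k z + l z) v = moment k v + moment l v.
Proof.
move=> ck cl cv; have [h1 h2] := cont_weight ck cv; have [h3 h4] := cont_weight cl cv.
rewrite /moment.
have -> : (fun z => (k z + l z) * expR (2 * v z)) = (fun z => k z * expR (2 * v z) + l z * expR (2 * v z)).
  by apply/funext => z; rewrite mulrDl.
have -> : (fun z => (k z + l z) * expR (v z)) = (fun z => k z * expR (v z) + l z * expR (v z)).
  by apply/funext => z; rewrite mulrDl.
by rewrite intBD// intSD//; ring.
Qed.

Lemma momentZ (c : R) k v : cont_cdisc k -> cont_cdisc v ->
  moment (fun z => c * k z) v = c * moment k v.
Proof.
move=> ck cv; have [h1 h2] := cont_weight ck cv.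
rewrite /moment.
have -> : (fun z => c * k z * expR (2 * v z)) = (fun z => c * (k z * expR (2 * v z))).
  by apply/funext => z; rewrite mulrA.
have -> : (fun z => c * k z * expR (v z)) = (fun z => c * (k z * expR (v z))).
  by apply/funext => z; rewrite mulrA.
by rewrite intBZ// intSZ//; ring.
Qed.

Lemma moment_gt0 k v : cont_cdisc k -> cont_cdisc v ->
  (forall z, cdisc z -> 0 <= k z) -> (forall z, disc z -> 0 < k z) -> 0 < moment k v.
Proof.
move=> ck cv k0 k1; have [h1 h2] := cont_weight ck cv.
rewrite ltr_pwDl// ?mulr_gt0 ?invr_gt0//.
  by apply: intB_gt0 => // z zd; rewrite mulr_gt0 ?k1// expR_gt0.
by apply: intS_ge0 => z /circle_cdisc zd; rewrite mulr_ge0 ?k0// expR_ge0.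
Qed.

Lemma cdisc_Phi p z : disc p -> cdisc z -> cdisc (Phi p z).
Proof.
move=> p1 zd; rewrite /cdisc /= -subr_ge0 nrm2_Phi// divr_ge0//.
  by rewrite mulr_ge0 ?(ltW (mob_S_gt0 p1))// subr_ge0.
by rewrite /mob_D addr_ge0// sqr_ge0.
Qed.

Lemma mob_D_gt0' p z : disc p -> cdisc z -> 0 < mob_D p 1 z.
Proof. by move=> p1 zd; apply: mob_D_gt0 => //; rewrite expr1n mul1r. Qed.

(** Neighbourhoods of a boundary point leave the closed disc, where [jacdet_Phi] does not apply; the
    Jacobian is therefore computed wherever [mob_D] is positive. *)
Lemma cont_pullback (u : plane R -> R) p : disc p -> (forall z, cont_at u z) ->
  cont_cdisc (pullback u (Phi p)).
Proof.
move=> p1 cu z zd; have D0 := mob_D_gt0' p1 zd; have S0 := mob_S_gt0 p1.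
have cD y : cont_at (mob_D p 1) y by rewrite /mob_D /mob_a /mob_b; cont.
have Dn : \forall y \near z, 0 < mob_D p 1 y.
  by apply: (cD z [set t | 0 < t]); apply: open_nbhs_nbhs; split => //; exact: open_gt.
have D1 : mob_D p 1 z != 0 by rewrite gt_eqF.
apply: (@cont_at_near _ _ (fun z => u (mob1 p 1 z, mob2 p 1 z) + ln (mob_sigma p 1 z))).
  near=> y; have Dy : 0 < mob_D p 1 y by near: y.
  have Dy' : mob_D p 1 y != 0 by rewrite gt_eqF.
  rewrite /pullback /jacdet; under [fun y => (Phi p y).1]eq_fun do rewrite PhiE.
  under [fun y => (Phi p y).2]eq_fun do rewrite PhiE.
  have [_ ->] := Dx_has_deriv (has_deriv_mob1_x Dy').
  have [_ ->] := Dx_has_deriv (has_deriv_mob2_x Dy').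
  have [_ ->] := Dy_has_deriv (has_deriv_mob1_y Dy').
  have [_ ->] := Dy_has_deriv (has_deriv_mob2_y Dy').
  have -> : mob_x p 1 y * mob_x p 1 y - mob_y p 1 y * - mob_y p 1 y = mob_sigma p 1 y ^+ 2.
    by move: Dy'; rewrite /mob_x /mob_y /mob_sigma /mob_D; move: (mob_a p 1 y) (mob_b p 1 y) (mob_S p 1) => a b S D; field.
  rewrite lnXn ?divr_gt0// PhiE mulr2n; congr (_ + _); by field.
have c1 : cont_at (mob1 p 1) z by rewrite /mob1 /mob_a /mob_b; cont; exact: cD.
have c2 : cont_at (mob2 p 1) z by rewrite /mob2 /mob_a /mob_b; cont; exact: cD.
have cs : cont_at (mob_sigma p 1) z by rewrite /mob_sigma; cont; exact: cD.
apply: cont_atD; first exact: (@cont_at_comp2 _ _ u (mob1 p 1) (mob2 p 1)).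
by apply: cont_at_ln => //; exact: mob_sigma_gt0.
Unshelve. all: by end_near. Qed.

(** This moves the dependence on p from the pulled back metric to the weight, leaving [u] to carry
    the time dependence of the measure. *)
Lemma moment_pullback (u k : plane R -> R) p : disc p -> is_C1 k -> is_C1 u ->
  moment (fun z => k (Phi p z)) (pullback u (Phi p)) = moment k u.
Proof.
move=> p1 hk hu; rewrite /moment.
have [kx [ky h]] : is_C1 (fun z => k z * expR (2 * u z)) by isC1.
have [lx [ly h']] : is_C1 (fun z => k z * expR (u z)) by isC1.
by rewrite (intB_pullback p1 h) (intS_pullback p1 h').
Qed.

Lemma cont_comp_Phi k p : disc p -> (forall z, cont_at k z) -> cont_cdisc (fun z => k (Phi p z)).
Proof.
move=> p1 ck z zd; have D1 : mob_D p 1 z != 0 by rewrite gt_eqF// mob_D_gt0'.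
have -> : (fun z => k (Phi p z)) = (fun z => k (mob1 p 1 z, mob2 p 1 z)).
  by apply/funext => y; rewrite PhiE.
have cD y : cont_at (mob_D p 1) y by rewrite /mob_D /mob_a /mob_b; cont.
have c1 : cont_at (mob1 p 1) z by rewrite /mob1 /mob_a /mob_b; cont; exact: cD.
have c2 : cont_at (mob2 p 1) z by rewrite /mob2 /mob_a /mob_b; cont; exact: cD.
exact: (@cont_at_comp2 _ _ k (mob1 p 1) (mob2 p 1)).
Qed.

(* First variation of [v |-> moment k v] in the direction [w]. *)
Definition dmoment k w v : R :=
  intB (fun z => k z * w z * expR (2 * v z)) + intS (fun z => k z * w z * expR (v z)).

Lemma dmomentN k w v : cont_cdisc k -> cont_cdisc w -> cont_cdisc v ->
  dmoment k (fun z => - w z) v = - dmoment k w v.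
Proof.
move=> ck cw cv.
have ckw : cont_cdisc (fun z => k z * w z).
  by move=> z zd; apply: cont_atM; [exact: ck|exact: cw].
have [h1 h2] := cont_weight ckw cv.
rewrite /dmoment.
have -> : (fun z => k z * - w z * expR (2 * v z)) = (fun z => -1 * (k z * w z * expR (2 * v z))).
  by apply/funext => z; ring.
have -> : (fun z => k z * - w z * expR (v z)) = (fun z => -1 * (k z * w z * expR (v z))).
  by apply/funext => z; ring.
by rewrite intBZ// intSZ//; ring.
Qed.

Lemma dmoment_pullback (u k w : plane R -> R) p : disc p -> is_C1 k -> is_C1 w -> is_C1 u ->
  dmoment (fun z => k (Phi p z)) (fun z => w (Phi p z)) (pullback u (Phi p)) = dmoment k w u.
Proof.
move=> p1 hk hw hu; rewrite /dmoment.
have [kx [ky h]] : is_C1 (fun z => k z * w z * expR (2 * u z)) by isC1.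
have [lx [ly h']] : is_C1 (fun z => k z * w z * expR (u z)) by isC1.
by rewrite (@intB_pullback _ u (fun z => k z * w z) _ _ p p1 h) (@intS_pullback _ u (fun z => k z * w z) _ _ p p1 h').
Qed.

Lemma eq_dmoment k l w w' v : (forall z, cdisc z -> k z = l z) ->
  (forall z, cdisc z -> w z = w' z) -> dmoment k w v = dmoment l w' v.
Proof.
move=> kl ww; rewrite /dmoment.
rewrite (@eq_intB _ _ (fun z => l z * w' z * expR (2 * v z))); last by move=> z /disc_cdisc zd; rewrite kl ?ww.
by rewrite (@eq_intS _ _ (fun z => l z * w' z * expR (v z)))// => z /circle_cdisc zd; rewrite kl ?ww.
Qed.

End Moments.

(** * Xi as a first variation *)

Section XiMoments.
Context {R : realType}.
Variables (r : R) (f U W : plane R -> R) (rho : R) (p : plane R).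
Hypotheses (r0 : 0 < r) (pt : disc p) (hU : is_C1 U) (hW : is_C1 W).
Hypothesis UW : forall z, cdisc z -> Kg U z - alpha_ f U rho * f z = - W z.

(** In the chart [piR r] the integrals over the cap are integrals over the disc and the circle, and
    K - alpha f is minus the time derivative [W] up to the boundary. *)
Lemma Xi_coord_dmoment (X : plane R * R -> R) (k : plane R -> R) :
  (forall z, X (Psi r z) = k z) -> cont_cdisc k ->
  Xi_coord X f U rho r p = - dmoment k (fun z => W (Phi p z)) (pullback U (Phi p)).
Proof.
move=> XE ck.
have cW : cont_cdisc (fun z => W (Phi p z)).
  by apply: cont_comp_Phi => //; exact: is_C1_cont.
have cv : cont_cdisc (pullback U (Phi p)) by apply: cont_pullback => //; exact: is_C1_cont.
rewrite -dmomentN// /Xi_coord /int_cap /int_cap_bdry /dmoment.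
have E z : cdisc z -> Kg U (Phi p z) - alpha_ f U rho * f (Phi p z) = - W (Phi p z).
  by move=> zd; apply: UW; exact: cdisc_Phi.
rewrite (@eq_intB _ _ (fun z => k z * - W (Phi p z) * expR (2 * pullback U (Phi p) z))); last first.
  by move=> z /disc_cdisc zd; rewrite PsiK// XE E.
by rewrite (@eq_intS _ _ (fun z => k z * - W (Phi p z) * expR (pullback U (Phi p) z)))// => z /circle_cdisc zd;
  rewrite PsiK// XE E.
Qed.

(** The first two coordinates of [Psi r] are the components of [psi r], hence of ([bal1], [bal2])
    after composition with [Phi p]. [U] and [W] are arbitrary so that rotated data can be inserted
    as well. *)
Lemma Xi_dmoment :
  Xi_coord (fun x => x.1.1) f U rho r p = - dmoment (bal1 r p) W U /\
  Xi_coord (fun x => x.1.2) f U rho r p = - dmoment (bal2 r p) W U.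
Proof.
have [h1 h2] := is_C1_bal r0 pt; have [/is_C1_cdisc l1 /is_C1_cdisc l2] := is_C1_psi r.
have PE z : (Psi r z).1 = psi r z.
  have En : nrm2 (r * z.1, r * z.2) = r ^+ 2 * nrm2 z by rewrite /nrm2 /=; ring.
  by rewrite /Psi /psi /= En !mulrA.
rewrite -(dmoment_pullback pt h1 hW hU) -(dmoment_pullback pt h2 hW hU); split.
  rewrite (@Xi_coord_dmoment _ (fun z => (psi r z).1))//; last by move=> z; rewrite PE.
  by congr (- _); apply: eq_dmoment => // z zd; rewrite bal1_Phi.
rewrite (@Xi_coord_dmoment _ (fun z => (psi r z).2))//; last by move=> z; rewrite PE.
by congr (- _); apply: eq_dmoment => // z zd; rewrite bal2_Phi.
Qed.

End XiMoments.

(** * The velocity of the normalizing parameter p *)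

Section CompanionVelocity.
Context {R : realType}.
Variables (f j : plane R -> R) (u : R -> plane R -> R) (rho : R -> R).
Hypothesis flow : curvature_flow f j u rho.
Variables (r : R) (p : R -> plane R).
Hypotheses (r0 : 0 < r) (r1 : r < 1) (comp : normalized_companion r u p).
Variable t0 : R.
Hypotheses (t0_gt0 : 0 < t0) (cp1 : cont_at (fun s => (p s).1) t0) (cp2 : cont_at (fun s => (p s).2) t0).

Let v := pullback (u t0) (Phi (p t0)).
Let ut := flow_dt u.

Let p_disc s : 0 <= s -> disc (p s). Proof. by move=> /comp[]. Qed.

Lemma balance_moment s : 0 < s ->
  moment (bal1 r (p s)) (u s) = 0 /\ moment (bal2 r (p s)) (u s) = 0.
Proof.
move=> s0; have [ps [b1 b2]] := comp (ltW s0); have hu := flow_C1 flow s0.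
have [h1 h2] := is_C1_bal r0 ps.
rewrite -(moment_pullback ps h1 hu) -(moment_pullback ps h2 hu); split.
  rewrite -[RHS]b1; apply: (@eq_moment _ _ (fun z => (psi r z).1)) => // z zd; exact: bal1_Phi.
rewrite -[RHS]b2; apply: (@eq_moment _ _ (fun z => (psi r z).2)) => // z zd; exact: bal2_Phi.
Qed.

Let cv : cont_cdisc v.
Proof. by apply: cont_pullback; [exact: p_disc (ltW t0_gt0)|exact: is_C1_cont (flow_C1 flow t0_gt0)]. Qed.

(** Integrated form of [dif_Phi]: the derivative of the balance condition in p is -M / (1 - |p|^2),
    the components of [psi r] having zero moment. *)
Lemma moment_dif_at :
  [/\ moment (dif11 r (p t0) (p t0)) (u t0) = - moment (mat11 r) v / mob_S (p t0) 1,
      moment (dif12 r (p t0) (p t0)) (u t0) = - moment (mat12 r) v / mob_S (p t0) 1,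
      moment (dif21 r (p t0) (p t0)) (u t0) = - moment (mat12 r) v / mob_S (p t0) 1 &
      moment (dif22 r (p t0) (p t0)) (u t0) = - moment (mat22 r) v / mob_S (p t0) 1].
Proof.
have [pt [b1 b2]] := comp (ltW t0_gt0); have hu := flow_C1 flow t0_gt0.
have [h11 h12 h21 h22] := is_C1_dif r0 pt pt.
have [k11 k12 k22] := is_C1_mat r; have [l1 l2] := is_C1_psi r.
rewrite -(moment_pullback pt h11 hu) -(moment_pullback pt h12 hu).
rewrite -(moment_pullback pt h21 hu) -(moment_pullback pt h22 hu) -/v.
have lin (m psi0 : plane R -> R) (c : R) : is_C1 m -> is_C1 psi0 -> moment psi0 v = 0 ->
    moment (fun z => - (m z + c * psi0 z) / mob_S (p t0) 1) v = - moment m v / mob_S (p t0) 1.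
  move=> /is_C1_cdisc cm /is_C1_cdisc cpsi E.
  rewrite (@eq_moment _ _ (fun z => - (mob_S (p t0) 1)^-1 * m z + (- c / mob_S (p t0) 1) * psi0 z) _ v) //; last first.
    by move=> z _; ring.
  rewrite momentD ?momentZ ?E// 1?mulr0 ?addr0; first by ring.
  - by move=> z zd; have := cm z zd => ?; cont.
  - by move=> z zd; have := cpsi z zd => ?; cont.
have B1 : moment (fun z => (psi r z).1) v = 0 by [].
have B2 : moment (fun z => (psi r z).2) v = 0 by [].
split.
- by rewrite -(@lin _ _ (2 * (p t0).2) k11 l2 B2); apply: eq_moment => // z zd; have [-> _ _ _] := dif_Phi r pt zd.
- by rewrite -(@lin _ _ (- (2 * (p t0).1)) k12 l2 B2); apply: eq_moment => // z zd; have [_ -> _ _] := dif_Phi r pt zd; ring.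
- by rewrite -(@lin _ _ (- (2 * (p t0).2)) k12 l1 B1); apply: eq_moment => // z zd; have [_ _ -> _] := dif_Phi r pt zd; ring.
- by rewrite -(@lin _ _ (2 * (p t0).1) k22 l1 B1); apply: eq_moment => // z zd; have [_ _ _ ->] := dif_Phi r pt zd.
Qed.

Lemma moment_mat_det : 0 < moment (mat11 r) v * moment (mat22 r) v - moment (mat12 r) v ^+ 2.
Proof.
have [/is_C1_cdisc k11 /is_C1_cdisc k12 /is_C1_cdisc k22] := is_C1_mat r.
have pos d1 d2 : (d1, d2) != (0, 0) ->
    0 < d1 ^+ 2 * moment (mat11 r) v + 2 * d1 * d2 * moment (mat12 r) v + d2 ^+ 2 * moment (mat22 r) v.
  move=> dn.
  have c1 : cont_cdisc (fun z => d1 ^+ 2 * mat11 r z) by move=> z zd; have := k11 z zd => ?; cont.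
  have c2 : cont_cdisc (fun z => 2 * d1 * d2 * mat12 r z) by move=> z zd; have := k12 z zd => ?; cont.
  have c3 : cont_cdisc (fun z => d2 ^+ 2 * mat22 r z) by move=> z zd; have := k22 z zd => ?; cont.
  have c12 : cont_cdisc (fun z => d1 ^+ 2 * mat11 r z + 2 * d1 * d2 * mat12 r z).
    by move=> z zd; apply: cont_atD; [exact: c1|exact: c2].
  rewrite -!momentZ// -!momentD//.
  have E z : d1 ^+ 2 * mat11 r z + 2 * d1 * d2 * mat12 r z + d2 ^+ 2 * mat22 r z =
     mat11 r z * d1 ^+ 2 + 2 * mat12 r z * d1 * d2 + mat22 r z * d2 ^+ 2 by ring.
  apply: moment_gt0 => //.
  - by move=> z zd; apply: cont_atD; [exact: c12|exact: c3].
  - by move=> z zd; rewrite E; have [] := mat_pos r0 d1 d2 r1 zd.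
  - by move=> z zd; rewrite E; have [_] := mat_pos r0 d1 d2 r1 (disc_cdisc zd); apply.
have M1 : 0 < moment (mat11 r) v.
  by have := pos 1 0; rewrite xpair_eqE oner_eq0 => /(_ isT); lra.
(* The form at (m12, -m11) equals m11 (m11 m22 - m12^2), and m11 is positive. *)
have := pos (moment (mat12 r) v) (- moment (mat11 r) v).
rewrite xpair_eqE oppr_eq0 (gt_eqF M1) andbF => /(_ isT).
move: (moment (mat11 r) v) (moment (mat12 r) v) (moment (mat22 r) v) M1 => a b c a0 h.
rewrite -(pmulr_rgt0 _ a0); nra.
Qed.

Lemma moment_flow_deriv (k : plane R -> R) : is_C1 k ->
  has_deriv (fun s => moment k (u s)) t0 (dmoment k (ut t0) (u t0)).
Proof.
by move=> hk; apply: has_derivD; [exact: (intB_flow_deriv flow)|exact: (intS_flow_deriv flow)].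
Qed.

Lemma cont_moment_near (K : R -> plane R -> R) :
  (forall z, cont_at (fun q : R * plane R => K q.1 q.2) (t0, z)) ->
  (forall s, 0 < s -> is_C1 (K s)) ->
  cont_at (fun s => moment (K s) (u s)) t0.
Proof.
move=> cK hK; have ju z := @flow_jcont _ _ _ _ _ flow t0 z t0_gt0.
have sec s : 0 < s -> cont_cdisc (fun z => K s z * expR (2 * u s z)) /\ cont_cdisc (fun z => K s z * expR (u s z)).
  move=> s0; have h1 := hK s s0; have h2 := flow_C1 flow s0.
  by split; apply: is_C1_cdisc; isC1.
apply: cont_atD.
  apply: cont_atM; first exact: cont_at_cst.
  apply: (@cont_intB _ (fun s z => K s z * expR (2 * u s z))).
    by move=> z _; have h1 := cK z; have h2 := ju z; cont.
  by apply: filterS (near_pos t0_gt0) => s s0; have [] := sec s s0.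
apply: (@cont_intS _ (fun s z => K s z * expR (u s z))).
  by move=> z _; have h1 := cK z; have h2 := ju z; cont.
by apply: filterS (near_pos t0_gt0) => s s0; have [] := sec s s0.
Qed.

(** The balance conditions at times s and t0 are subtracted and split into a change of p, with
    divided differences integrated against the measure of time s, and a change of the measure at
    frozen p. This is the system of [implicit_deriv]; multiplication by -(1 - |p|^2) gives the
    stated form. *)
Lemma companion_velocity : exists d1 d2,
  [/\ has_deriv (fun s => (p s).1) t0 d1, has_deriv (fun s => (p s).2) t0 d2,
      moment (mat11 r) v * d1 + moment (mat12 r) v * d2 = mob_S (p t0) 1 * dmoment (bal1 r (p t0)) (ut t0) (u t0) &
      moment (mat12 r) v * d1 + moment (mat22 r) v * d2 = mob_S (p t0) 1 * dmoment (bal2 r (p t0)) (ut t0) (u t0)].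
Proof.
have pt := p_disc (ltW t0_gt0); have S0 := mob_S_gt0 pt.
have [E11 E12 E21 E22] := moment_dif_at.
have Sn : mob_S (p t0) 1 != 0 by rewrite gt_eqF.
have [h1 h2] := is_C1_bal r0 pt.
have cd z := cont_dif r0 z pt pt cp1 cp2.
have hd s : 0 < s -> [/\ is_C1 (dif11 r (p t0) (p s)), is_C1 (dif12 r (p t0) (p s)),
    is_C1 (dif21 r (p t0) (p s)) & is_C1 (dif22 r (p t0) (p s))].
  by move=> s0; apply: is_C1_dif => //; exact: p_disc (ltW s0).
have := @implicit_deriv R (fun s => (p s).1) (fun s => (p s).2)
  (fun s => moment (dif11 r (p t0) (p s)) (u s)) (fun s => moment (dif12 r (p t0) (p s)) (u s))
  (fun s => moment (dif21 r (p t0) (p s)) (u s)) (fun s => moment (dif22 r (p t0) (p s)) (u s))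
  (fun s => moment (bal1 r (p t0)) (u s)) (fun s => moment (bal2 r (p t0)) (u s))
  t0 _ _ _ _ _ _ _ (moment_flow_deriv h1) (moment_flow_deriv h2).
case.
- by apply: (@cont_moment_near (fun s => dif11 r (p t0) (p s))) => [z|s /hd[]//]; have [] := cd z.
- by apply: (@cont_moment_near (fun s => dif12 r (p t0) (p s))) => [z|s /hd[]//]; have [] := cd z.
- by apply: (@cont_moment_near (fun s => dif21 r (p t0) (p s))) => [z|s /hd[]//]; have [] := cd z.
- by apply: (@cont_moment_near (fun s => dif22 r (p t0) (p s))) => [z|s /hd[]//]; have [] := cd z.
- rewrite E11 E12 E21 E22; have := moment_mat_det => det0.
  rewrite (_ : _ - _ = (moment (mat11 r) v * moment (mat22 r) v - moment (mat12 r) v ^+ 2) / mob_S (p t0) 1 ^+ 2); last by field.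
  by rewrite gt_eqF// divr_gt0// exprn_gt0.
- apply: filterS (near_pos t0_gt0) => s s0.
  have ps := p_disc (ltW s0); have [b1 b2] := balance_moment s0; have [b10 b20] := balance_moment t0_gt0.
  have cus : cont_cdisc (u s) by apply: is_C1_cdisc; exact: (flow_C1 flow s0).
  have [k1 k2] := is_C1_bal r0 ps.
  have [l11 l12 l21 l22] := hd s s0.
  have lin (a b c d : plane R -> R) (x y : R) : is_C1 a -> is_C1 b -> is_C1 c -> is_C1 d ->
      (forall z, a z - b z = c z * x + d z * y) ->
      moment c (u s) * x + moment d (u s) * y + moment b (u s) = moment a (u s).
    move=> ha hb hc hd' E.
    rewrite (@eq_moment _ a (fun z => x * c z + y * d z + b z) (u s) (u s)) => [|z _|//]; last first.
      by apply/eqP; rewrite -subr_eq E; apply/eqP; ring.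
    have c1 : cont_cdisc (fun z => x * c z) by apply: is_C1_cdisc; isC1.
    have c2 : cont_cdisc (fun z => y * d z) by apply: is_C1_cdisc; isC1.
    have c3 : cont_cdisc (fun z => x * c z + y * d z) by apply: is_C1_cdisc; isC1.
    rewrite (momentD c3 (is_C1_cdisc hb) cus) (momentD c1 c2 cus).
    by rewrite (momentZ x (is_C1_cdisc hc) cus) (momentZ y (is_C1_cdisc hd') cus); ring.
  split; rewrite ?b10 ?b20 subr0.
    by rewrite (@lin (bal1 r (p s)))// => z; exact: bal1_dif.
  by rewrite (@lin (bal2 r (p s)))// => z; exact: bal2_dif.
- move=> d1 [d2 [D1 D2]]; rewrite E11 E12 E21 E22 => F1 F2; exists d1, d2; split=> //.
    have -> : moment (mat11 r) v * d1 + moment (mat12 r) v * d2 =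
      - mob_S (p t0) 1 * (- moment (mat11 r) v / mob_S (p t0) 1 * d1 + - moment (mat12 r) v / mob_S (p t0) 1 * d2).
      by field.
    by rewrite -[_ * d1 + _](addrK (dmoment (bal1 r (p t0)) (ut t0) (u t0))) F1; ring.
  have -> : moment (mat12 r) v * d1 + moment (mat22 r) v * d2 =
    - mob_S (p t0) 1 * (- moment (mat12 r) v / mob_S (p t0) 1 * d1 + - moment (mat22 r) v / mob_S (p t0) 1 * d2).
    by field.
  by rewrite -[_ * d1 + _](addrK (dmoment (bal2 r (p t0)) (ut t0) (u t0))) F2; ring.
Qed.

End CompanionVelocity.

(** * Uniform convergence of v and limits of moments *)

Section UniformLimits.
Context {R : realType}.
Implicit Types (k v w : plane R -> R) (z p : plane R).

(** A neighbourhood need not be measurable, so the bound is put on its measurable supersets; each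
    contains a nondegenerate rectangle. *)
Lemma nbhs_mu2_gt0 z (A : set (plane R)) : nbhs z A ->
  forall N : set (mplane R), measurable N -> A `<=` N -> (0 < mu2 N)%E.
Proof.
move=> [[U V] /= [nU nV] UV] N mN AN.
have aux (c : R) (W : set R) : nbhs c W -> exists2 d, 0 < d & `[c, c + d]%classic `<=` W.
  move=> /nbhs_ballP[d /= d0 dW]; exists (d / 2); first by rewrite divr_gt0.
  move=> x /=; rewrite in_itv /= => /andP[h1 h2]; apply: dW.
  by rewrite /ball /= ltr_distlC; apply/andP; split; lra.
have [a a0 hU] := aux _ _ nU; have [b b0 hV] := aux _ _ nV.
apply: (@lt_le_trans _ _ (mu2 (`[z.1, z.1 + a]%classic `*` `[z.2, z.2 + b]%classic))).
  rewrite /Defs.mu2 product_measure1E; [|exact: measurable_itv|exact: measurable_itv].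
  rewrite /= !lebesgue_measure_itv /= !lte_fin !ltrDl a0 b0 -!EFinD -EFinM lte_fin.
  by rewrite mulr_gt0// addrAC subrr add0r.
apply: le_measure; rewrite ?inE //.
  by apply: measurableX; exact: measurable_itv.
by move=> [x y] [/= hx hy]; apply: AN; apply: UV; split; [exact: hU|exact: hV].
Qed.

(** An interior point where the bound fails has a whole neighbourhood of such points, of positive
    measure; the circle is then reached by continuity. *)
Lemma Linf_le w (e : R) : cont_cdisc w -> (Linf w <= e%:E)%E ->
  forall z, cdisc z -> `|w z| <= e.
Proof.
(* The norm is an essential supremum provided that the measure of the whole space is positive. *)
move=> cw; rewrite /Linf unlock ifT; last first.
  by apply: (@nbhs_mu2_gt0 (0, 0) setT) => //; exact: filterT.
move=> /ess_supP [N [mN N0 hN]].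
apply: le_cdisc => [z zd|z zd]; first by apply: cvg_norm; exact: cw.
rewrite leNgt; apply/negP => wz.
suff : (0 < mu2 N)%E by have N0' : mu2 N = 0%E := N0; rewrite N0' ltxx.
have nz : nbhs z (disc `&` [set y | e < `|w y|]).
  apply: filterI; first by apply: open_nbhs_nbhs; split => //; exact: disc_open.
  have : cont_at (fun y => `|w y|) z by apply: cvg_norm; apply: cw; exact: disc_cdisc.
  by move=> /(_ [set t | e < t]); apply; apply: open_nbhs_nbhs; split => //; exact: open_gt.
apply: (nbhs_mu2_gt0 nz) => // y [yd ey]; apply: hN => /=.
rewrite indicE mem_set// mul1r lee_fin => h; by move: ey; rewrite /= ltNge h.
Qed.

(** The real [s] stands for the pointwise difference of two functions, so that uniform closeness of
    functions reduces to a scalar parameter over a compact set. *)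
Lemma cont_unif_shift k v (c : R) : cont_cdisc k -> cont_cdisc v -> forall e, 0 < e ->
  exists2 d, 0 < d & forall s z, `|s| < d -> cdisc z ->
    `|k z * expR (c * (v z + s)) - k z * expR (c * v z)| < e.
Proof.
move=> ck cv e e0.
have [] := @compact_unif_near R R (plane R) (fun s z => k z * expR (c * (v z + s))) cdisc 0 (@cdisc_compact R) _ e e0.
  move=> z zd.
  have h1 : cont_at (fun q : R * plane R => k q.2) (0, z).
    by apply: (@cont_at_comp _ _ _ k) => /=; [exact: ck|exact: cvg_snd].
  have h2 : cont_at (fun q : R * plane R => v q.2) (0, z).
    by apply: (@cont_at_comp _ _ _ v) => /=; [exact: cv|exact: cvg_snd].
  by cont.
move=> d /= d0 h; exists d => // s z sd zd.
by have := h s; rewrite /ball /= sub0r normrN => /(_ sd z zd); rewrite addr0.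
Qed.

Lemma moment_cvg k v (vl : nat -> plane R -> R) :
  cont_cdisc k -> cont_cdisc v -> (forall l, cont_cdisc (vl l)) ->
  (forall e, 0 < e -> \forall l \near \oo, forall z, cdisc z -> `|vl l z - v z| <= e) ->
  (fun l => moment k (vl l)) @ \oo --> moment k v.
Proof.
move=> ck cv cvl hv; apply/cvgrPdist_le => e e0.
pose C : R := 2^-1 * fine (mu2 (@disc R)) + 2 * pi.
have C0 : 0 < C.
  by rewrite ltr_wpDl ?mulr_gt0 ?pi_gt0// mulr_ge0// fine_ge0.
have e1 : 0 < e / C by rewrite divr_gt0.
have [d d0 hd] := cont_unif_shift 2 ck cv e1.
have [d' d'0 hd'] := cont_unif_shift 1 ck cv e1.
have m0 : 0 < Num.min d d' / 2 by rewrite divr_gt0// lt_min d0.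
apply: filterS (hv _ m0) => l hl.
have small z : cdisc z -> `|vl l z - v z| < d /\ `|vl l z - v z| < d'.
  move=> zd; have := hl z zd; have h1 : Num.min d d' <= d by rewrite ge_min lexx.
  have h2 : Num.min d d' <= d' by rewrite ge_min lexx orbT.
  by split; lra.
have [h1 h2] := cont_weight ck cv; have [h3 h4] := cont_weight ck (cvl l).
have B1 : `|intB (fun z => k z * expR (2 * vl l z)) - intB (fun z => k z * expR (2 * v z))|
    <= e / C * fine (mu2 (@disc R)).
  apply: intB_close => // z /disc_cdisc zd; apply: ltW.
  by have [s1 _] := small z zd; have := hd _ z s1 zd; rewrite [v z + _]addrC subrK.
have B2 : `|intS (fun z => k z * expR (vl l z)) - intS (fun z => k z * expR (v z))|
    <= e / C * (2 * pi).
  apply: intS_close => // z /circle_cdisc zd; apply: ltW.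
  by have [_ s1] := small z zd; have := hd' _ z s1 zd; rewrite [v z + _]addrC subrK !mul1r.
have split_dif (a b a' b' : R) : 2^-1 * a + b - (2^-1 * a' + b') = 2^-1 * (a - a') + (b - b') by ring.
rewrite distrC /moment split_dif.
apply: (le_trans (ler_normD _ _)); rewrite normrM (gtr0_norm (_ : 0 < 2^-1))// ?invr_gt0//.
have -> : e = 2^-1 * (e / C * fine (mu2 (@disc R))) + e / C * (2 * pi).
  by rewrite [RHS](_ : _ = e / C * C); [rewrite divfK// gt_eqF|rewrite /C; ring].
by apply: lerD => //; apply: ler_wpM2l; rewrite ?invr_ge0.
Qed.

End UniformLimits.

(** * Moments of the radial limit profile *)

Section RadialLimit.
Context {R : realType}.
Variables (r : R) (r0 : 0 < r) (r1 : r < 1).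
Implicit Types (z p : plane R) (lam : R).

(** This is [v_infty] for lam = 2 r / sqrt(alpha f(z0)); the scale is kept free until the mass
    determines it. *)
Definition vlam lam z : R := ln (lam / cap_D r z).

Lemma is_C1_cap_D : is_C1 (cap_D r).
Proof. by have h2 := @is_C1_nrm2 R; rewrite /cap_D; isC1. Qed.

Lemma cont_vlam lam : 0 < lam -> cont_cdisc (vlam lam).
Proof.
move=> l0 z _; have c0 := cap_D_gt0 r z; have cc := @is_C1_cont _ _ is_C1_cap_D z.
apply: cont_at_ln; first by rewrite divr_gt0.
by cont; rewrite gt_eqF.
Qed.

Lemma moment_vlam k lam : 0 < lam -> is_C1 k ->
  moment k (vlam lam) = lam ^+ 2 * (2^-1 * intB (fun z => k z / cap_D r z ^+ 2))
                        + lam * intS (fun z => k z / cap_D r z).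
Proof.
move=> l0 hk; have hc := is_C1_cap_D; have cn z : cap_D r z != 0 by rewrite gt_eqF ?cap_D_gt0.
have E z : expR (vlam lam z) = lam / cap_D r z.
  by rewrite lnK// posrE divr_gt0// cap_D_gt0.
have E2 z : expR (2 * vlam lam z) = lam ^+ 2 / cap_D r z ^+ 2.
  by rewrite mulrDl mul1r expRD E -expr2 expr_div_n.
have cn2 z : cap_D r z ^+ 2 != 0 by rewrite expf_neq0.
have c1 : cont_cdisc (fun z => k z / cap_D r z ^+ 2) by apply: is_C1_cdisc; isC1.
have c2 : cont_circle (fun z => k z / cap_D r z) by apply: is_C1_circle; isC1.
rewrite /moment (@eq_intB _ _ (fun z => lam ^+ 2 * (k z / cap_D r z ^+ 2))); last by move=> z _; rewrite E2; ring.
rewrite (@eq_intS _ _ (fun z => lam * (k z / cap_D r z))); last by move=> z _; rewrite E; ring.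
by rewrite intBZ// intSZ//; ring.
Qed.

Lemma moment_vlam_rot k lam (th : R) : 0 < lam -> is_C1 k ->
  moment (fun z => k (rotp th z)) (vlam lam) = moment k (vlam lam).
Proof.
move=> l0 hk; have hc := is_C1_cap_D; have cn z : cap_D r z != 0 by rewrite gt_eqF ?cap_D_gt0.
have cn2 z : cap_D r z ^+ 2 != 0 by rewrite expf_neq0.
have V z : vlam lam (rotp th z) = vlam lam z.
  rewrite /vlam /cap_D rotpE /nrm2 /=; congr (ln (_ / (1 + r ^+ 2 * _))).
  by rewrite -[RHS]mul1r -(cos2Dsin2 th); ring.
have E z : expR (vlam lam z) = lam / cap_D r z.
  by rewrite lnK// posrE divr_gt0// cap_D_gt0.
have E2 z : expR (2 * vlam lam z) = lam ^+ 2 / cap_D r z ^+ 2.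
  by rewrite mulrDl mul1r expRD E -expr2 expr_div_n.
have [kx [ky h]] : is_C1 (fun z => k z * (lam ^+ 2 / cap_D r z ^+ 2)) by isC1.
have [lx [ly h']] : is_C1 (fun z => k z * (lam / cap_D r z)) by isC1.
rewrite /moment.
have -> : (fun z => k z * expR (2 * vlam lam z)) = (fun z => k z * (lam ^+ 2 / cap_D r z ^+ 2)).
  by apply/funext => z; rewrite E2.
have -> : (fun z => k z * expR (vlam lam z)) = (fun z => k z * (lam / cap_D r z)).
  by apply/funext => z; rewrite E.
rewrite -(intB_rotp th h) -(intS_rotp th h'); congr (_ * _ + _).
  by apply: eq_intB => z _; rewrite -V E2.
by apply: eq_intS => z _; rewrite -V E.
Qed.

(** The profile is radial, and a quarter turn exchanges [mat11] with [mat22] and changes the sign of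
    [mat12]. *)
Lemma moment_mat_vlam lam : 0 < lam ->
  [/\ 0 < moment (mat11 r) (vlam lam), moment (mat12 r) (vlam lam) = 0 &
      moment (mat22 r) (vlam lam) = moment (mat11 r) (vlam lam)].
Proof.
move=> l0; have [k11 k12 k22] := is_C1_mat r; have cv := cont_vlam l0.
have N z : nrm2 (- z.2, z.1) = nrm2 z by rewrite /nrm2 /=; ring.
have Rz z : rotp (pi / 2) z = (- z.2, z.1).
  by rewrite rotpE cos_pihalf sin_pihalf; congr pair; ring.
split.
- apply: moment_gt0 => //; first exact: is_C1_cdisc.
    move=> z zd; have [+ _] := mat_pos r0 1 0 r1 zd; lra.
  move=> z zd; have [_] := mat_pos r0 1 0 r1 (disc_cdisc zd).
  by rewrite xpair_eqE oner_eq0 => /(_ zd isT); lra.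
- have := moment_vlam_rot (pi / 2) l0 k12.
  rewrite (@eq_moment _ _ (fun z => -1 * mat12 r z) _ (vlam lam))//; last first.
    by move=> z _; rewrite Rz /mat12 /cap_D N /=; ring.
  by rewrite momentZ//; [lra|exact: is_C1_cdisc].
- rewrite -(moment_vlam_rot (pi / 2) l0 k22); apply: eq_moment => // z _.
  by rewrite Rz /mat22 /mat11 /cap_D N /=.
Qed.

Lemma mass_moment v : mass v = moment (fun=> 1 : R) v.
Proof.
by rewrite /mass /moment; congr (_ * intB _ + intS _); apply/funext => z; rewrite mul1r.
Qed.

(** The mass is a quadratic polynomial in the scale with positive coefficients and no constant term,
    hence injective on positive scales. *)
Lemma mass_vlam_inj lam mu : 0 < lam -> 0 < mu -> mass (vlam lam) = mass (vlam mu) -> lam = mu.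
Proof.
move=> l0 m0; have h1 := is_C1_cst (1 : R); have hc := is_C1_cap_D.
have cn z : cap_D r z != 0 by rewrite gt_eqF ?cap_D_gt0.
have cn2 z : cap_D r z ^+ 2 != 0 by rewrite expf_neq0.
rewrite !mass_moment !moment_vlam//.
have : 0 < intB (fun z => 1 / cap_D r z ^+ 2).
  by apply: intB_gt0 => [|z _]; [apply: is_C1_cdisc; isC1|rewrite divr_gt0// exprn_gt0// cap_D_gt0].
have : 0 < intS (fun z => 1 / cap_D r z).
  by apply: intS_gt0 => [|z _]; [apply: is_C1_circle; isC1|rewrite divr_gt0// cap_D_gt0].
move: (intB _) (intS _) => I J J0 I0 E.
have : (lam - mu) * ((lam + mu) * (2^-1 * I) + J) = 0.
  rewrite (_ : _ * _ = lam ^+ 2 * (2^-1 * I) + lam * J - (mu ^+ 2 * (2^-1 * I) + mu * J)); last by ring.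
  by rewrite E subrr.
move/eqP; rewrite mulf_eq0 subr_eq0 => /orP[/eqP//|].
by rewrite gt_eqF// addr_gt0// !mulr_gt0 ?invr_gt0 ?addr_gt0.
Qed.

End RadialLimit.

(** * Concentration forces |p| to 1 *)

Section BoundaryLimit.
Context {R : realType}.
Implicit Types (z p : plane R).

(** The constant 1 is used as the H^1 test function. Its weak gradient is 0 since the partial
    derivatives of a function supported inside the disc integrate to 0, by the divergence
    theorem. *)
Lemma weakH1_mean (F : nat -> plane R -> R) (c : R) : weakH1_to_cst F c ->
  (fun l => intB (fun z => F l z - c)) @ \oo --> (0 : R).
Proof.
have i0 : cont_cdisc (fun _ : plane R => 0 : R) by move=> z _; exact: cont_at_cst.
have i1 : cont_cdisc (fun _ : plane R => 1 : R) by move=> z _; exact: cont_at_cst.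
have eta_C1 (eta kx ky : plane R -> R) : test_fun eta -> C1 eta kx ky ->
    intB kx = 0 /\ intB ky = 0.
  move=> [_ [K [_ Kd K0]]] h.
  have e0 z : circle z -> eta z = 0.
    move=> zc; apply: K0 => /Kd; rewrite /disc /= => h'.
    by move: zc; rewrite /circle /= => zc; rewrite zc ltxx in h'.
  have S0 (g : plane R -> R) : intS (fun z => eta z * g z) = 0.
    rewrite (@eq_intS _ _ (fun=> 0)) ?intS_cst ?mul0r// => z zc.
    by rewrite e0 ?mul0r.
  have ce : cont_cdisc eta by move=> z _; exact: (C1_cont h).
  split.
    rewrite (@divergence_x _ eta kx) ?S0//; first by move=> z _; exact: (C1_contx h).
    by move=> [x y] _; exact: (C1_derx h).
  rewrite (@divergence_y _ eta ky) ?S0//; first by move=> z _; exact: (C1_conty h).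
  by move=> [x y] _; exact: (C1_dery h).
have H : H1_disc (fun _ : plane R => 1 : R) (fun=> 0) (fun=> 0).
  split=> [h hh|eta he|eta he].
  - have [c' ->] : exists c' : R, h = fun=> c' by case: hh => ->; eexists.
    have ch : cont_cdisc (fun _ : plane R => c' : R) by move=> z _; exact: cont_at_cst.
    split; first exact: measurable_cst.
    by apply: cont_cdisc_integrable => z _; exact: cont_at_cst.
  - have h := is_C1_Dxy (smooth_plane_C1 he.1).
    rewrite (@eq_intB _ _ (Dx eta)) => [|z _]; last by rewrite mul1r.
    rewrite (@eq_intB _ (fun z => 0 * eta z) (fun=> 0)) => [|z _]; last by rewrite mul0r.
    by have [E1 E2] := eta_C1 _ _ _ he h; rewrite intB0 ?E1 ?E2 oppr0.
  - have h := is_C1_Dxy (smooth_plane_C1 he.1).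
    rewrite (@eq_intB _ _ (Dy eta)) => [|z _]; last by rewrite mul1r.
    rewrite (@eq_intB _ (fun z => 0 * eta z) (fun=> 0)) => [|z _]; last by rewrite mul0r.
    by have [E1 E2] := eta_C1 _ _ _ he h; rewrite intB0 ?E1 ?E2 oppr0.
move=> /(_ _ _ _ H); under eq_fun => l.
  rewrite (@eq_intB _ _ (fun z => F l z - c)) => [|z _]; last by rewrite mulr1.
  rewrite (@eq_intB _ (fun z => Dx (F l) z * 0) (fun=> 0)) => [|z _]; last by rewrite mulr0.
  rewrite (@eq_intB _ (fun z => Dy (F l) z * 0) (fun=> 0)) => [|z _]; last by rewrite mulr0.
  rewrite intB0 !addr0; over.
by [].
Qed.

Lemma mob_D_le4 p z : disc p -> cdisc z -> mob_D p 1 z <= 4.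
Proof.
rewrite /disc /cdisc /mob_D /mob_a /mob_b /nrm2 /= !mul1r => h1 h2.
have E : (1 + (p.1 * z.1 + p.2 * z.2)) ^+ 2 + (p.1 * z.2 - p.2 * z.1) ^+ 2 =
   1 + 2 * (p.1 * z.1 + p.2 * z.2) + (p.1 ^+ 2 + p.2 ^+ 2) * (z.1 ^+ 2 + z.2 ^+ 2) by ring.
have E2 : 0 <= (p.1 - z.1) ^+ 2 + (p.2 - z.2) ^+ 2 by rewrite addr_ge0 ?sqr_ge0.
have E3 : (p.1 ^+ 2 + p.2 ^+ 2) * (z.1 ^+ 2 + z.2 ^+ 2) <= 1.
  by rewrite mulr_ile1 ?addr_ge0 ?sqr_ge0// ltW.
rewrite E; move: E2 E3; lra.
Qed.

(** Since |z0| = 1 and |q - z0|^2 is nonnegative, 1 - z0 . q is at least (1 - |q|^2) / 2 = T / (2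
    D), and D is at most 4. *)
Lemma boundary_gap z0 (q : plane R) (D T : R) : circle z0 -> 0 < D -> D <= 4 -> 0 <= T ->
  1 - nrm2 q = T / D -> T / 8 <= - z0.1 * (q.1 - z0.1) + - z0.2 * (q.2 - z0.2).
Proof.
case: z0 q => x y [a b]; rewrite /circle /nrm2 /= => xy D0 D4 T0 E.
have : T / 8 <= 2^-1 * (1 - (a ^+ 2 + b ^+ 2)).
  by rewrite E mulrA ler_pdivlMr//; nra.
have : 0 <= (a - x) ^+ 2 + (b - y) ^+ 2 by rewrite addr_ge0 ?sqr_ge0.
nra.
Qed.

(** Integrating [boundary_gap] for q = Phi_p(z) bounds (1 - |p|^2) J / 8 by the means of Phi - z0,
    which tend to 0. *)
Lemma concentration_norm (p : nat -> plane R) z0 : circle z0 -> (forall l, disc (p l)) ->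
  weakH1_to_cst (fun l z => (Phi (p l) z).1) z0.1 ->
  weakH1_to_cst (fun l z => (Phi (p l) z).2) z0.2 ->
  (fun l => nrm2 (p l)) @ \oo --> (1 : R).
Proof.
move=> zc pd /weakH1_mean w1 /weakH1_mean w2.
have cP l : cont_cdisc (fun z => (Phi (p l) z).1) /\ cont_cdisc (fun z => (Phi (p l) z).2).
  split; apply: (@cont_comp_Phi _ _ (p l)) => // z; [exact: cont_at_fst|exact: cont_at_snd].
pose J : R := intB (fun z : plane R => 1 - nrm2 z).
have cJ : cont_cdisc (fun z : plane R => 1 - nrm2 z).
  by move=> z _; rewrite /nrm2; cont.
have J0 : 0 < J by apply: intB_gt0 => // z; rewrite /disc /= subr_gt0.
have w3 : (fun l => - (z0.1 * intB (fun z => (Phi (p l) z).1 - z0.1) + z0.2 * intB (fun z => (Phi (p l) z).2 - z0.2)))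
    @ \oo --> (0 : R).
  have h1 : (fun l => z0.1 * intB (fun z => (Phi (p l) z).1 - z0.1)) @ \oo --> z0.1 * 0.
    by apply: cvgM; [exact: cvg_cst|exact: w1].
  have h2 : (fun l => z0.2 * intB (fun z => (Phi (p l) z).2 - z0.2)) @ \oo --> z0.2 * 0.
    by apply: cvgM; [exact: cvg_cst|exact: w2].
  have h := cvgN (cvgD h1 h2); rewrite !mulr0 addr0 oppr0 in h; exact: h.
have le l : 0 <= (1 - nrm2 (p l)) * (J / 8) <=
    - (z0.1 * intB (fun z => (Phi (p l) z).1 - z0.1) + z0.2 * intB (fun z => (Phi (p l) z).2 - z0.2)).
  have S0 : 0 < 1 - nrm2 (p l) by rewrite subr_gt0; exact: (pd l).
  apply/andP; split; first by rewrite mulr_ge0 ?divr_ge0// ltW.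
  have [c1 c2] := cP l.
  have d1 : cont_cdisc (fun z => (Phi (p l) z).1 - z0.1) by move=> z zd; have := c1 z zd => ?; cont.
  have d2 : cont_cdisc (fun z => (Phi (p l) z).2 - z0.2) by move=> z zd; have := c2 z zd => ?; cont.
  have d3 : cont_cdisc (fun z => - z0.1 * ((Phi (p l) z).1 - z0.1)) by move=> z zd; have := c1 z zd => ?; cont.
  have d4 : cont_cdisc (fun z => - z0.2 * ((Phi (p l) z).2 - z0.2)) by move=> z zd; have := c2 z zd => ?; cont.
  have -> : - (z0.1 * intB (fun z => (Phi (p l) z).1 - z0.1) + z0.2 * intB (fun z => (Phi (p l) z).2 - z0.2)) =
      intB (fun z => - z0.1 * ((Phi (p l) z).1 - z0.1) + - z0.2 * ((Phi (p l) z).2 - z0.2)).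
    by rewrite (intBD d3 d4) (intBZ _ d1) (intBZ _ d2); ring.
  have -> : (1 - nrm2 (p l)) * (J / 8) = (1 - nrm2 (p l)) / 8 * J by ring.
  rewrite -intBZ//; apply: le_intB => [z zd|z zd|z zd].
  - by apply: cont_atM; [exact: cont_at_cst|exact: cJ].
  - by apply: cont_atD; [exact: d3|exact: d4].
  have zc' := disc_cdisc zd; have D0 := mob_D_gt0' (pd l) zc'; have D4 := mob_D_le4 (pd l) zc'.
  have := nrm2_Phi (pd l) zc'; rewrite {1}/mob_S expr1n mul1r => E.
  have T0 : 0 <= (1 - nrm2 (p l)) * (1 - nrm2 z).
    by rewrite mulr_ge0 ?(ltW S0)// subr_ge0; exact: zc'.
  have -> : (1 - nrm2 (p l)) / 8 * (1 - nrm2 z) = (1 - nrm2 (p l)) * (1 - nrm2 z) / 8 by ring.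
  exact: (boundary_gap zc D0 D4 T0).
have w4 : (fun l => (1 - nrm2 (p l)) * (J / 8)) @ \oo --> (0 : R).
  by apply: (squeeze_cvgr _ (cvg_cst (0 : R)) w3); apply: nearW.
have -> : (fun l => nrm2 (p l)) = (fun l => 1 - (1 - nrm2 (p l)) * (J / 8) * (8 / J)).
  by apply/funext => l; field; rewrite gt_eqF.
rewrite -[X in _ --> X]subr0 -(mul0r (8 / J)).
by apply: cvgB; [exact: cvg_cst|apply: cvgM => //; exact: cvg_cst].
Qed.

End BoundaryLimit.

(** * Behaviour of all quantities under rotated coordinates *)

Section Rotations.
Context {R : realType}.
Implicit Types (k u v w : plane R -> R) (z p q : plane R).
Variable th : R.
Let c : R := cos th.
Let s : R := sin th.
Let cs : c ^+ 2 + s ^+ 2 = 1. Proof. exact: cos2Dsin2. Qed.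

Lemma C1_rotf k kx ky : C1 k kx ky ->
  C1 (rotf th k) (fun z => c * rotf th kx z + s * rotf th ky z)
                 (fun z => - s * rotf th kx z + c * rotf th ky z).
Proof.
move=> hk.
have cr g : (forall z, cont_at g z) -> forall z, cont_at (rotf th g) z.
  move=> cg z; apply: (@cont_at_comp2 _ _ g (fun z : plane R => c * z.1 - s * z.2)
    (fun z : plane R => c * z.2 + s * z.1)); first exact: cg.
  - by cont.
  - by cont.
have ck := cr _ (C1_cont hk); have ckx := cr _ (C1_contx hk); have cky := cr _ (C1_conty hk).
split=> [z|z|z|x y|x y].
- exact: ck.
- by have h1 := ckx z; have h2 := cky z; cont.
- by have h1 := ckx z; have h2 := cky z; cont.
- apply: has_deriv_eq.
    by apply: (has_deriv_comp2 hk (a := fun t => c * t - s * y) (b := fun t => c * y + s * t)); deriv.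
  by rewrite /rotf rotpE -/c -/s /=; ring.
- apply: has_deriv_eq.
    by apply: (has_deriv_comp2 hk (a := fun t => c * x - s * t) (b := fun t => c * t + s * x)); deriv.
  by rewrite /rotf rotpE -/c -/s /=; ring.
Qed.

Lemma is_C1_rotf k : is_C1 k -> is_C1 (rotf th k).
Proof. by move=> [kx [ky h]]; do 2 eexists; exact: C1_rotf h. Qed.

Lemma lap_rotf u : is_C1 u -> is_C1 (Dx u) -> is_C1 (Dy u) ->
  forall z, lap (rotf th u) z = lap u (rotp th z).
Proof.
move=> hu hx hy z.
have [Ex Ey] := C1_Dxy (C1_rotf (is_C1_Dxy hu)).
have [kx [ky hX]] : is_C1 (Dx u) by []; have [lx [ly hY]] : is_C1 (Dy u) by [].
have [E1 E2] := C1_Dxy hX; have [E3 E4] := C1_Dxy hY.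
have [rX1 rX2 rX3 rX4 rX5] := C1_rotf hX; have [rY1 rY2 rY3 rY4 rY5] := C1_rotf hY.
rewrite /lap Ex Ey E1 E4; case: z => x y.
have [_ ->] := @Dx_has_deriv R (fun z => c * rotf th (Dx u) z + s * rotf th (Dy u) z) (x, y) _
  (has_derivD (has_derivM (has_deriv_cst c x) (rX4 x y)) (has_derivM (has_deriv_cst s x) (rY4 x y))).
have [_ ->] := @Dy_has_deriv R (fun z => - s * rotf th (Dx u) z + c * rotf th (Dy u) z) (x, y) _
  (has_derivD (has_derivM (has_deriv_cst (- s) y) (rX5 x y)) (has_derivM (has_deriv_cst c y) (rY5 x y))).
rewrite /= -[RHS]mul1r -cs /rotf; ring.
Qed.

Lemma Kg_rotf u : is_C1 u -> is_C1 (Dx u) -> is_C1 (Dy u) ->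
  forall z, Kg (rotf th u) z = Kg u (rotp th z).
Proof. by move=> hu hx hy z; rewrite /Kg lap_rotf. Qed.

Lemma nrm2_rotp z : nrm2 (rotp th z) = nrm2 z.
Proof. by rewrite rotpE /nrm2 /= -[RHS]mul1r -cs; rewrite /c /s; ring. Qed.

Lemma cdisc_rotp z : cdisc (rotp th z) = cdisc z.
Proof. by rewrite /cdisc /= nrm2_rotp. Qed.

Lemma disc_rotp z : disc (rotp th z) = disc z.
Proof. by rewrite /disc /= nrm2_rotp. Qed.

(** [g] is a C^1 representative of [f], as [intB_rotp] requires an integrand that is C^1 on the
    plane. *)
Lemma alpha_rotf (f g u : plane R -> R) (rho : R) : is_C1 g -> (forall z, cdisc z -> f z = g z) ->
  is_C1 u -> alpha_ (rotf th f) (rotf th u) rho = alpha_ f u rho.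
Proof.
move=> hg fg hu; rewrite /alpha_; congr (_ / _).
have [kx [ky h]] : is_C1 (fun z => g z * expR (2 * u z)) by isC1.
transitivity (intB (fun z => g z * expR (2 * u z))).
  rewrite -(intB_rotp th h); apply: eq_intB => z /disc_cdisc zd.
  by rewrite /rotf fg// cdisc_rotp.
by apply: eq_intB => z /disc_cdisc zd; rewrite fg.
Qed.

(** Equivariance under simultaneous rotation of p and z: numerators and denominator are rewritten
    through the vectors themselves and the invariants p . z, p x z, |p|, |z|. *)
Lemma bal_rotp r p z :
  bal1 r (rotp th p) (rotp th z) = c * bal1 r p z - s * bal2 r p z /\
  bal2 r (rotp th p) (rotp th z) = c * bal2 r p z + s * bal1 r p z.
Proof.
have Ed : (rotp th p).1 * (rotp th z).1 + (rotp th p).2 * (rotp th z).2 = p.1 * z.1 + p.2 * z.2.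
  by rewrite !rotpE -/c -/s /= -[RHS]mul1r -cs; ring.
have Ex : (rotp th p).1 * (rotp th z).2 - (rotp th p).2 * (rotp th z).1 = p.1 * z.2 - p.2 * z.1.
  by rewrite !rotpE -/c -/s /= -[RHS]mul1r -cs; ring.
have ED : bal_D r (rotp th p) (rotp th z) = bal_D r p z.
  have F q y : bal_D r q y = (1 - (q.1 * y.1 + q.2 * y.2)) ^+ 2 + (q.1 * y.2 - q.2 * y.1) ^+ 2
      + r ^+ 2 * (nrm2 y + nrm2 q - 2 * (q.1 * y.1 + q.2 * y.2)).
    by rewrite /bal_D /nrm2; ring.
  by rewrite !F Ed Ex !nrm2_rotp.
have F1 q y : bal_N1 q y = y.1 - q.1 * (1 + nrm2 y) + (2 * (q.1 * y.1 + q.2 * y.2) * q.1 - nrm2 q * y.1).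
  by rewrite /bal_N1 /nrm2; ring.
have F2 q y : bal_N2 q y = y.2 - q.2 * (1 + nrm2 y) + (2 * (q.1 * y.1 + q.2 * y.2) * q.2 - nrm2 q * y.2).
  by rewrite /bal_N2 /nrm2; ring.
by rewrite /bal1 /bal2 ED !F1 !F2 Ed !nrm2_rotp !rotpE -/c -/s /=; split; ring.
Qed.

Lemma dmoment_rotf k w u : is_C1 k -> is_C1 w -> is_C1 u ->
  dmoment (rotf th k) (rotf th w) (rotf th u) = dmoment k w u.
Proof.
move=> hk hw hu; rewrite /dmoment.
have [kx [ky h]] : is_C1 (fun z => k z * w z * expR (2 * u z)) by isC1.
have [lx [ly h']] : is_C1 (fun z => k z * w z * expR (u z)) by isC1.
by rewrite -(intB_rotp th h) -(intS_rotp th h').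
Qed.

Lemma dmoment_lin (a b : R) k l w v : cont_cdisc k -> cont_cdisc l -> cont_cdisc w -> cont_cdisc v ->
  dmoment (fun z => a * k z + b * l z) w v = a * dmoment k w v + b * dmoment l w v.
Proof.
move=> ck cl cw cv.
have cM g : cont_cdisc g -> cont_cdisc (fun z => g z * w z).
  by move=> cg z zd; have h1 := cg z zd; have h2 := cw z zd; cont.
have [h1 h2] := cont_weight (cM _ ck) cv; have [h3 h4] := cont_weight (cM _ cl) cv.
have cZ (d : R) g : cont_cdisc g -> cont_cdisc (fun z => d * g z).
  by move=> cg z zd; have h := cg z zd; cont.
have cZ' (d : R) g : cont_circle g -> cont_circle (fun z => d * g z).
  by move=> cg x; apply: cont_atM; [exact: cont_at_cst|exact: cg].
rewrite /dmoment.
have -> : (fun z => (a * k z + b * l z) * w z * expR (2 * v z)) =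
    (fun z => a * (k z * w z * expR (2 * v z)) + b * (l z * w z * expR (2 * v z))).
  by apply/funext => z; ring.
have -> : (fun z => (a * k z + b * l z) * w z * expR (v z)) =
    (fun z => a * (k z * w z * expR (v z)) + b * (l z * w z * expR (v z))).
  by apply/funext => z; ring.
rewrite intBD ?intSD ?(intBZ a h1) ?(intBZ b h3) ?(intSZ a h2) ?(intSZ b h4); first by ring.
- exact: cZ' h2.
- exact: cZ' h4.
- exact: cZ h1.
- exact: cZ h3.
Qed.

End Rotations.

Lemma rotpK {R : realType} (th : R) : cancel (rotp (- th)) (rotp th).
Proof.
move=> [x y]; rewrite !rotpE cosN sinN /=.
congr pair; rewrite -[RHS]mul1r -(cos2Dsin2 th); ring.
Qed.

(** * Xi in rotated coordinates *)

Section RotatedXi.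
Context {R : realType}.
Variables (f j : plane R -> R) (u : R -> plane R -> R) (rho : R -> R).
Hypotheses (f_smooth : smooth_cdisc f) (flow : curvature_flow f j u rho).
Variables (r t0 th : R) (p : plane R).
Hypotheses (r0 : 0 < r) (t0_gt0 : 0 < t0) (pd : disc p).

(** In complex notation the rotated Xi is -exp(-i th) (B1 + i B2), the rotation by -th of Xi in the
    original coordinates. *)
Lemma Xi_rotf (B1 := dmoment (bal1 r p) (flow_dt u t0) (u t0)) (B2 := dmoment (bal2 r p) (flow_dt u t0) (u t0)) :
  Xi_coord (fun x => x.1.1) (rotf th f) (rotf th (u t0)) (rho t0) r (rotp (- th) p) =
    - (cos th * B1 + sin th * B2) /\
  Xi_coord (fun x => x.1.2) (rotf th f) (rotf th (u t0)) (rho t0) r (rotp (- th) p) =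
    - (cos th * B2 - sin th * B1).
Proof.
have [G hG fG] := f_extension f_smooth; have hu := flow_C1 flow t0_gt0; have hw := flow_dt_C1 flow t0_gt0.
have [hx hy] := flow_Dx_C1 flow t0_gt0; have [h1 h2] := is_C1_bal r0 pd.
have cu := is_C1_cdisc hu; have cw := is_C1_cdisc hw; have c1 := is_C1_cdisc h1; have c2 := is_C1_cdisc h2.
have qd : disc (rotp (- th) p) by rewrite disc_rotp.
have UW z : cdisc z -> Kg (rotf th (u t0)) z - alpha_ (rotf th f) (rotf th (u t0)) (rho t0) * rotf th f z
    = - rotf th (flow_dt u t0) z.
  move=> zd; rewrite Kg_rotf// (alpha_rotf th _ hG fG hu) /rotf.
  by apply: (flow_dt_cdisc f_smooth flow t0_gt0); rewrite cdisc_rotp.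
have [-> ->] := Xi_dmoment r0 qd (is_C1_rotf th hu) (is_C1_rotf th hw) UW.
have E1 z : bal1 r (rotp (- th) p) z = rotf th (fun y => cos th * bal1 r p y + sin th * bal2 r p y) z.
  have [F1 F2] := bal_rotp th r (rotp (- th) p) z; rewrite rotpK in F1 F2.
  by rewrite /rotf F1 F2 -[LHS]mul1r -(cos2Dsin2 th); ring.
have E2 z : bal2 r (rotp (- th) p) z = rotf th (fun y => - sin th * bal1 r p y + cos th * bal2 r p y) z.
  have [F1 F2] := bal_rotp th r (rotp (- th) p) z; rewrite rotpK in F1 F2.
  by rewrite /rotf F1 F2 -[LHS]mul1r -(cos2Dsin2 th); ring.
have k1 : is_C1 (fun y => cos th * bal1 r p y + sin th * bal2 r p y) by isC1.
have k2 : is_C1 (fun y => - sin th * bal1 r p y + cos th * bal2 r p y) by isC1.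
rewrite (@eq_dmoment _ _ _ _ _ _ (fun z _ => E1 z) (fun z _ => erefl)) dmoment_rotf// dmoment_lin//.
rewrite (@eq_dmoment _ _ _ _ _ _ (fun z _ => E2 z) (fun z _ => erefl)) dmoment_rotf// dmoment_lin//.
by split=> //; rewrite -/B1 -/B2; ring.
Qed.

End RotatedXi.

(** * Polar coordinates and rotated matrices *)

Section PolarCoordinates.
Context {R : realType}.

(** Continuity and phi(t0) = 0 keep phi in (-pi/2, pi/2) near t0, so phi = atan(q2 / q1), and then a
    = q1 / cos phi; both are differentiable compositions. *)
Lemma polar_deriv (a phi q1 q2 : R -> R) (t0 d1 d2 : R) :
  (\forall s \near t0, 0 < a s /\ q1 s = a s * cos (phi s) /\ q2 s = a s * sin (phi s)) ->
  phi t0 = 0 -> cont_at phi t0 -> has_deriv q1 t0 d1 -> has_deriv q2 t0 d2 ->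
  has_deriv a t0 d1 /\ has_deriv phi t0 (d2 / a t0).
Proof.
move=> hq phi0 cphi h1 h2; have [a0 [E1 E2]] := nbhs_singleton hq.
have pi2 : 0 < (pi : R) / 2 by rewrite divr_gt0// pi_gt0.
rewrite phi0 cos0 mulr1 in E1; rewrite phi0 sin0 mulr0 in E2.
have q1n : q1 t0 != 0 by rewrite E1 gt_eqF.
have hphi : \forall s \near t0, phi s \in `](- (pi / 2)), (pi / 2)[.
  have := cphi `](- (pi / 2)), (pi / 2)[%classic; rewrite phi0; apply.
  apply: open_nbhs_nbhs; split; first exact: interval_open.
  by rewrite /= in_itv /= oppr_lt0 pi2.
have dphi : has_deriv phi t0 (d2 / a t0).
  apply: (@has_deriv_near _ (fun s => atan (q2 s / q1 s))).
    near=> s.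
    have [as0 [-> ->]] : 0 < a s /\ q1 s = a s * cos (phi s) /\ q2 s = a s * sin (phi s) by near: s.
    have ps : phi s \in `](- (pi / 2)), (pi / 2)[ by near: s.
    rewrite -[RHS](tanK ps) /tan; congr atan.
    have c0 : 0 < cos (phi s) by apply: cos_gt0_pihalf; move: ps; rewrite in_itv.
    by field; rewrite !gt_eqF.
  apply: has_deriv_eq.
    apply: (has_deriv_comp (f := atan)); first exact: is_derive1_atan.
    by apply: has_derivM; [exact: h2|apply: has_derivV => //; exact: h1].
  by rewrite E2 E1; field; rewrite gt_eqF.
split=> //.
apply: (@has_deriv_near _ (fun s => q1 s / cos (phi s))).
  near=> s.
  have [as0 [-> _]] : 0 < a s /\ q1 s = a s * cos (phi s) /\ q2 s = a s * sin (phi s) by near: s.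
  have ps : phi s \in `](- (pi / 2)), (pi / 2)[ by near: s.
  have c0 : 0 < cos (phi s) by apply: cos_gt0_pihalf; move: ps; rewrite in_itv.
  by rewrite mulfK// gt_eqF.
apply: has_deriv_eq.
  apply: has_derivM; first exact: h1.
  apply: has_derivV; first by rewrite phi0 cos0 oner_eq0.
  by apply: has_deriv_cos; exact: dphi.
by rewrite /= phi0 cos0 sin0; field; rewrite gt_eqF.
Unshelve. all: by end_near. Qed.

(** The error sequences have to be fixed before the angle th is given, so cos th and sin th are
    recovered from p itself. The value (1, 0) at the origin keeps this a unit vector for every
    index. *)
Definition dir (z : plane R) : plane R :=
  if nrm2 z == 0 then (1, 0) else (z.1 / euclid z, z.2 / euclid z).

Lemma dir_circle z : (dir z).1 ^+ 2 + (dir z).2 ^+ 2 = 1.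
Proof.
rewrite /dir; case: ifPn => [_|nz]; first by rewrite /= expr1n expr0n addr0.
have E : euclid z ^+ 2 = nrm2 z by rewrite sqr_sqrtr// nrm2_ge0.
by rewrite /= !expr_div_n E -mulrDl divff.
Qed.

Lemma dir_cis (a th : R) : 0 < a -> dir (a * cos th, a * sin th) = cis th /\
  euclid (a * cos th, a * sin th) = a.
Proof.
move=> a0.
have E : nrm2 (a * cos th, a * sin th) = a ^+ 2.
  by rewrite /nrm2 /= -[RHS]mulr1 -(cos2Dsin2 th); ring.
have Ee : euclid (a * cos th, a * sin th) = a by rewrite /euclid E sqrtr_sqr gtr0_norm.
split=> //; rewrite /dir Ee E expf_eq0 /= gt_eqF// /cis.
by congr pair; rewrite mulrC mulKf// gt_eqF.
Qed.

Lemma cvg_dominated (x d : nat -> R) (l : R) :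
  (forall n, `|x n - l| <= d n) -> d @ \oo --> (0 : R) -> x @ \oo --> l.
Proof.
move=> xd /cvgrPdist_le hd; apply/cvgrPdist_le => e e0.
apply: filterS (hd e e0) => n; rewrite sub0r normrN distrC => h.
by rewrite (le_trans (xd n))// (le_trans (ler_norm _)).
Qed.

(** Conjugation by rotations fixes the scalar limit and has bounded coefficients, so the deviations
    are dominated by those of the original matrix although the rotations need not converge. *)
Lemma rotated_form_cvg (m11 m12 m22 c s : nat -> R) (C : R) :
  (forall l, c l ^+ 2 + s l ^+ 2 = 1) ->
  m11 @ \oo --> C -> m12 @ \oo --> (0 : R) -> m22 @ \oo --> C ->
  [/\ (fun l => c l ^+ 2 * m11 l + 2 * (c l * s l) * m12 l + s l ^+ 2 * m22 l) @ \oo --> C,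
      (fun l => - (c l * s l) * m11 l + (c l ^+ 2 - s l ^+ 2) * m12 l + c l * s l * m22 l) @ \oo --> (0 : R) &
      (fun l => s l ^+ 2 * m11 l - 2 * (c l * s l) * m12 l + c l ^+ 2 * m22 l) @ \oo --> C].
Proof.
move=> cs h11 h12 h22.
pose d l := `|m11 l - C| + 2 * `|m12 l| + `|m22 l - C|.
have hd : d @ \oo --> (0 : R).
  have g1 : (fun l => `|m11 l - C|) @ \oo --> `|C - C| by apply: cvg_norm; apply: cvgB => //; exact: cvg_cst.
  have g2 : (fun l => 2 * `|m12 l|) @ \oo --> 2 * `|0 : R| by apply: cvgM; [exact: cvg_cst|exact: cvg_norm].
  have g3 : (fun l => `|m22 l - C|) @ \oo --> `|C - C| by apply: cvg_norm; apply: cvgB => //; exact: cvg_cst.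
  have g := cvgD (cvgD g1 g2) g3; rewrite subrr normr0 mulr0 !addr0 in g; exact: g.
have B (a b g x y z : R) : `|a| <= 1 -> `|b| <= 2 -> `|g| <= 1 ->
    `|a * x + b * y + g * z| <= `|x| + 2 * `|y| + `|z|.
  move=> ha hb hg; apply: (le_trans (ler_normD _ _)); apply: lerD.
    apply: (le_trans (ler_normD _ _)); rewrite !normrM; apply: lerD.
      by rewrite ler_piMl.
    by rewrite ler_wpM2r.
  by rewrite normrM ler_piMl.
have hcs l : [/\ `|c l ^+ 2| <= 1, `|s l ^+ 2| <= 1, `|c l * s l| <= 1, `|2 * (c l * s l)| <= 2 &
    `|c l ^+ 2 - s l ^+ 2| <= 2].
  have := cs l; move: (c l) (s l) => a b ab.
  have h1 : 0 <= (a - b) ^+ 2 by exact: sqr_ge0.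
  have h2 : 0 <= (a + b) ^+ 2 by exact: sqr_ge0.
  have h3 : 0 <= a ^+ 2 by exact: sqr_ge0.
  have h4 : 0 <= b ^+ 2 by exact: sqr_ge0.
  rewrite !ler_norml; split; apply/andP; split; move: h1 h2 h3 h4 ab; rewrite ?sqrrB ?sqrrD; lra.
split; apply: (cvg_dominated _ hd) => l; have [k1 k2 k3 k4 k5] := hcs l.
- have -> : c l ^+ 2 * m11 l + 2 * (c l * s l) * m12 l + s l ^+ 2 * m22 l - C =
    c l ^+ 2 * (m11 l - C) + 2 * (c l * s l) * m12 l + s l ^+ 2 * (m22 l - C).
    by rewrite -[X in _ - X = _]mul1r -(cs l); ring.
  exact: B.
- have -> : - (c l * s l) * m11 l + (c l ^+ 2 - s l ^+ 2) * m12 l + c l * s l * m22 l - 0 =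
    - (c l * s l) * (m11 l - C) + (c l ^+ 2 - s l ^+ 2) * m12 l + c l * s l * (m22 l - C) by ring.
  by apply: B; rewrite ?normrN.
- have -> : s l ^+ 2 * m11 l - 2 * (c l * s l) * m12 l + c l ^+ 2 * m22 l - C =
    s l ^+ 2 * (m11 l - C) + - (2 * (c l * s l)) * m12 l + c l ^+ 2 * (m22 l - C).
    by rewrite -[X in _ - X = _]mul1r -(cs l); ring.
  by apply: B; rewrite ?normrN.
Qed.

(** With Q the rotation of cosine c and sine s, this is (Q^T M Q)(Q^T d) = Q^T (M d). *)
Lemma rotated_system (m11 m12 m22 d1 d2 c s : R) : c ^+ 2 + s ^+ 2 = 1 ->
  (c ^+ 2 * m11 + 2 * (c * s) * m12 + s ^+ 2 * m22) * (c * d1 + s * d2)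
    + (- (c * s) * m11 + (c ^+ 2 - s ^+ 2) * m12 + c * s * m22) * (c * d2 - s * d1) =
    c * (m11 * d1 + m12 * d2) + s * (m12 * d1 + m22 * d2) /\
  (- (c * s) * m11 + (c ^+ 2 - s ^+ 2) * m12 + c * s * m22) * (c * d1 + s * d2)
    + (s ^+ 2 * m11 - 2 * (c * s) * m12 + c ^+ 2 * m22) * (c * d2 - s * d1) =
    c * (m12 * d1 + m22 * d2) - s * (m11 * d1 + m12 * d2).
Proof.
move=> cs; split.
  transitivity ((c ^+ 2 + s ^+ 2) * (c * (m11 * d1 + m12 * d2) + s * (m12 * d1 + m22 * d2))).
    by ring.
  by rewrite cs mul1r.
transitivity ((c ^+ 2 + s ^+ 2) * (c * (m12 * d1 + m22 * d2) - s * (m11 * d1 + m12 * d2))).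
  by ring.
by rewrite cs mul1r.
Qed.

(** In terms of x = j / sqrt(f) > 0 the value is sqrt(1 + x^2) - x. *)
Lemma R_of_itv (f j : plane R -> R) z : 0 < f z -> 0 < j z -> 0 < R_of f j z < 1.
Proof.
move=> f0 j0; rewrite /R_of; set x := j z / Num.sqrt (f z).
have sf : 0 < Num.sqrt (f z) by rewrite sqrtr_gt0.
have x0 : 0 < x by rewrite divr_gt0.
have -> : j z ^+ 2 / f z = x ^+ 2 by rewrite /x expr_div_n sqr_sqrtr// ltW.
have y0 : 0 <= Num.sqrt (1 + x ^+ 2) by exact: sqrtr_ge0.
have : Num.sqrt (1 + x ^+ 2) ^+ 2 = 1 + x ^+ 2 by rewrite sqr_sqrtr// addr_ge0// sqr_ge0.
move: (Num.sqrt (1 + x ^+ 2)) y0 => y y0 E.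
by rewrite subr_gt0 ltrBlDr; apply/andP; split; rewrite ltNge; apply/negP => h; nra.
Qed.

End PolarCoordinates.

(** * Limit of the matrix M along a concentrating sequence *)

Section ConcentrationLimit.
Context {R : realType}.
Variables (f j : plane R -> R) (u : R -> plane R -> R) (rho : R -> R).
Hypotheses (f_smooth : smooth_cdisc f) (f_gt0 : forall z, cdisc z -> 0 < f z).
Hypotheses (j_ext : smooth_bdry_harmonic j) (j_gt0 : forall z, circle z -> 0 < j z).
Hypothesis flow : curvature_flow f j u rho.

(* The scale of the limit profile is determined by the conserved quantity [mass], hence does not
   depend on the sequence of times. *)
Definition limit_scale (r : R) : R := xget 1 [set lam : R | 0 < lam /\ mass (vlam r lam) = mass (u 1)].

(** If no scale has the prescribed mass, the default 1 is returned, so positivity also holds at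
    boundary points where no concentration occurs. *)
Lemma limit_scale_gt0 r : 0 < limit_scale r.
Proof. by rewrite /limit_scale; case: xgetP => [lam _ []//|_]; exact: ltr01. Qed.

Definition limit_moment (r : R) : R := moment (mat11 r) (vlam r (limit_scale r)).

Lemma limit_moment_gt0 r : 0 < r -> r < 1 -> 0 < limit_moment r.
Proof. by move=> r0 r1; have [] := moment_mat_vlam r0 r1 (limit_scale_gt0 r). Qed.

Variables (z0 : plane R) (p : R -> plane R) (t : nat -> R).
Hypotheses (z0c : circle z0) (comp : normalized_companion (R_of f j z0) u p).
Hypotheses (t_gt0 : forall l, 0 < t l) (conc : concentrates f j u rho p t z0).

Lemma concentration_matrix (r := R_of f j z0)
    (v := fun l => pullback (u (t l)) (Phi (p (t l)))) :
  [/\ (fun l => moment (mat11 r) (v l)) @ \oo --> limit_moment r,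
      (fun l => moment (mat12 r) (v l)) @ \oo --> (0 : R),
      (fun l => moment (mat22 r) (v l)) @ \oo --> limit_moment r &
      (fun l => euclid (p (t l))) @ \oo --> (1 : R)].
Proof.
have /andP[r0 r1] := R_of_itv (f_gt0 (circle_cdisc z0c)) (j_gt0 z0c).
have [_ w1 w2 [al [be [[al0 _ _ _ _] [_ _ hL]]]]] := conc.
have pd l : disc (p (t l)) by have [] := comp (ltW (t_gt0 l)).
have hn := concentration_norm z0c pd w1 w2.
pose lam : R := 2 * r / Num.sqrt (al * f z0).
have lam0 : 0 < lam by rewrite divr_gt0 ?mulr_gt0// sqrtr_gt0 mulr_gt0// f_gt0//; exact: circle_cdisc.
have cv l : cont_cdisc (v l).
  by apply: cont_pullback => //; exact: is_C1_cont (flow_C1 flow (t_gt0 l)).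
have unif (e : R) : 0 < e -> \forall l \near \oo, forall z, cdisc z -> `|v l z - vlam r lam z| <= e.
  move=> e0.
  have nb : nbhs (0%E : \bar R) [set y | (y <= e%:E)%E].
    rewrite /nbhs /= /ereal_nbhs /=; apply: filterS (lt_nbhsl e0) => y; rewrite lee_fin; exact: ltW.
  have h : \forall l \near \oo, (Linf (fun z => v l z - v_infty f z0 r al z)%R <= e%:E)%E := hL _ nb.
  apply: filterS h => l; apply: Linf_le => z zd.
  apply: cont_atD; first exact: cv.
  by apply: cont_atN; exact: (@cont_vlam R r lam lam0 z zd).
have lim k : is_C1 k -> (fun l => moment k (v l)) @ \oo --> moment k (vlam r lam).
  by move=> hk; apply: moment_cvg => //; [exact: is_C1_cdisc|exact: cont_vlam].
(* The mass of v is that of u by conformal invariance, and it is conserved in time: a constant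
   sequence, whose value passes to the limit profile. *)
have mE : mass (vlam r lam) = mass (u 1).
  have h1 := is_C1_cst (1 : R); have := lim _ h1.
  rewrite -mass_moment.
  have -> : (fun l => moment (fun=> 1 : R) (v l)) = (fun=> mass (u 1)).
    apply/funext => l; rewrite (moment_pullback (pd l) h1 (flow_C1 flow (t_gt0 l))) -mass_moment.
    exact: (mass_conserved f_smooth f_gt0 j_ext j_gt0 flow (t_gt0 l) ltr01).
  by move=> h; apply: (cvg_unique (@Rhausdorff R) h); exact: cvg_cst.
(* The actual scale satisfies the condition that defines [limit_scale], and injectivity of the mass
   leaves no other choice. *)
have E : limit_scale r = lam.
  rewrite /limit_scale; case: xgetP => [m _ [m0 mm]|/(_ lam)/=[]//].
  by apply: (@mass_vlam_inj R r m lam m0 lam0); rewrite mm mE.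
have [k11 k12 k22] := is_C1_mat r; have [_ M12 M22] := moment_mat_vlam r0 r1 lam0.
rewrite /limit_moment E; split; [exact: lim|rewrite -M12; exact: lim|rewrite -M22; exact: lim|].
rewrite -[X in _ --> X](@sqrtr1 R).
exact: (cvg_comp _ _ hn (@sqrt_continuous R 1)).
Qed.

End ConcentrationLimit.

(** * The exact velocity system in polar coordinates *)

Section Asymptotics.
Context {R : realType}.
Variables (f j : plane R -> R) (u : R -> plane R -> R) (rho : R -> R).
Hypotheses (f_smooth : smooth_cdisc f) (flow : curvature_flow f j u rho).
Variables (r : R) (p : R -> plane R).
Hypotheses (r0 : 0 < r) (r1 : r < 1) (comp : normalized_companion r u p).

(** No limit enters yet: the velocity system for p, rotated by -th, in the unknowns a' and a phi',
    with 1 - |p|^2 = 1 - a^2 as factor of Xi. *)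
Lemma polar_velocity (t0 th : R) (a phi : R -> R) (v := pullback (u t0) (Phi (p t0)))
    (c := (dir (p t0)).1) (s := (dir (p t0)).2)
    (m11 := moment (mat11 r) v) (m12 := moment (mat12 r) v) (m22 := moment (mat22 r) v) :
  0 < t0 ->
  (\forall x \near t0, 0 < a x < 1 /\
     rotp (- th) (p x) = (a x * cos (phi x), a x * sin (phi x))) ->
  phi t0 = 0 -> cont_at a t0 -> cont_at phi t0 ->
  exists da dphi, [/\ has_deriv a t0 da, has_deriv phi t0 dphi, euclid (p t0) = a t0,
    (c ^+ 2 * m11 + 2 * (c * s) * m12 + s ^+ 2 * m22) * da
      + (- (c * s) * m11 + (c ^+ 2 - s ^+ 2) * m12 + c * s * m22) * (a t0 * dphi) =
    - (1 - a t0 ^+ 2) * Xi_coord (fun x => x.1.1) (rotf th f) (rotf th (u t0)) (rho t0) r (rotp (- th) (p t0)) &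
    (- (c * s) * m11 + (c ^+ 2 - s ^+ 2) * m12 + c * s * m22) * da
      + (s ^+ 2 * m11 - 2 * (c * s) * m12 + c ^+ 2 * m22) * (a t0 * dphi) =
    - (1 - a t0 ^+ 2) * Xi_coord (fun x => x.1.2) (rotf th f) (rotf th (u t0)) (rho t0) r (rotp (- th) (p t0))].
Proof.
move=> t00 hp phi0 ca cphi; have [/andP[a0 a1] E0] := nbhs_singleton hp.
have pE x : rotp (- th) (p x) = (a x * cos (phi x), a x * sin (phi x)) ->
    p x = rotp th (a x * cos (phi x), a x * sin (phi x)) by move=> <-; rewrite rotpK.
have p0 : p t0 = (a t0 * cos th, a t0 * sin th).
  by rewrite (pE _ E0) phi0 cos0 sin0 mulr0 mulr1 rotpE /= !mulr0 subr0 add0r mulrC [sin th * _]mulrC.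
have [D0 e0] := dir_cis th a0; rewrite -p0 in D0 e0.
have cp1 : cont_at (fun x => (p x).1) t0.
  apply: (@cont_at_near _ _ (fun x => cos th * (a x * cos (phi x)) - sin th * (a x * sin (phi x)))).
    by apply: filterS hp => x [_ /pE ->]; rewrite rotpE.
  by cont.
have cp2 : cont_at (fun x => (p x).2) t0.
  apply: (@cont_at_near _ _ (fun x => cos th * (a x * sin (phi x)) + sin th * (a x * cos (phi x)))).
    by apply: filterS hp => x [_ /pE ->]; rewrite rotpE.
  by cont.
have [d1 [d2 [h1 h2 F1 F2]]] := companion_velocity flow r0 r1 comp t00 cp1 cp2.
have g1 : has_deriv (fun x => cos th * (p x).1 + sin th * (p x).2) t0 (cos th * d1 + sin th * d2).
  by apply: has_deriv_eq; [deriv|ring].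
have g2 : has_deriv (fun x => cos th * (p x).2 - sin th * (p x).1) t0 (cos th * d2 - sin th * d1).
  by apply: has_deriv_eq; [deriv|ring].
have hq : \forall x \near t0, 0 < a x /\ cos th * (p x).1 + sin th * (p x).2 = a x * cos (phi x) /\
    cos th * (p x).2 - sin th * (p x).1 = a x * sin (phi x).
  apply: filterS hp => x [/andP[ax _]]; rewrite rotpE cosN sinN => -[<- <-].
  by split=> //; split; ring.
have [da dphi] := polar_deriv hq phi0 cphi g1 g2.
have pd : disc (p t0) by have [] := comp (ltW t00).
have S0 : mob_S (p t0) 1 = 1 - a t0 ^+ 2.
  by rewrite /mob_S expr1n mul1r -e0 sqr_sqrtr// nrm2_ge0.
rewrite -/v -/m11 -/m12 -/m22 in F1 F2.
have aK x : a t0 * (x / a t0) = x by rewrite mulrC divfK ?gt_eqF.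
have [H1 H2] := rotated_system m11 m12 m22 d1 d2 (cos2Dsin2 th).
have [X1 X2] := Xi_rotf f_smooth flow th r0 t00 pd.
exists (cos th * d1 + sin th * d2), ((cos th * d2 - sin th * d1) / a t0); split; [exact: da|exact: dphi|exact: e0| |].
- rewrite aK /c /s D0 /= H1 F1 F2 S0 X1.
  by move: (dmoment _ _ _) (dmoment _ _ _) => B1 B2; ring.
- rewrite aK /c /s D0 /= H2 F1 F2 S0 X2.
  by move: (dmoment _ _ _) (dmoment _ _ _) => B1 B2; ring.
Qed.

End Asymptotics.

Theorem lemma5p6 (R : realType) (f j : plane R -> R)
    (u : R -> plane R -> R) (rho : R -> R)
    (f_smooth : smooth_cdisc f) (f_gt0 : forall z, cdisc z -> 0 < f z)
    (j_ext : smooth_bdry_harmonic j) (j_gt0 : forall z, circle z -> 0 < j z)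
    (no_sol : ~ exists u' : plane R -> R, solves_curvature f j u')
    (flow : curvature_flow f j u rho) :
  exists A1 A2 : plane R -> R,
    (forall z0, circle z0 -> 0 < A1 z0 /\ 0 < A2 z0) /\
    forall (z0 : plane R) (p : R -> plane R) (t : nat -> R),
      circle z0 ->
      normalized_companion (R_of f j z0) u p ->
      (forall l, 0 < t l) ->
      concentrates f j u rho p t z0 ->
      exists e1 e2 : nat -> R[i],
        little_o1 e1 /\ little_o1 e2 /\
        forall (l : nat) (th : R) (a phi : R -> R),
          let t0 := t l in
          let eps0 := (1 - a t0) / (1 + a t0) in
          (\forall s \near t0, 0 < a s < 1 /\
             rotp (- th) (p s) = (a s * cos (phi s), a s * sin (phi s))) ->
          phi t0 = 0 ->
          {for t0, continuous a} -> {for t0, continuous phi} ->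
          [/\ derivable a t0 1, derivable phi t0 1 &
              (((A1 z0)%:C + e1 l) * (derive1 a t0)%:C
                + Complex 0 1 * (((A2 z0)%:C + e2 l) * (derive1 phi t0)%:C)
              = - (eps0%:C * Xi (rotf th f) (rotf th (u t0)) (rho t0)
                              (R_of f j z0) (rotp (- th) (p t0))))%C].
Proof.
have Rr z0 : circle z0 -> 0 < R_of f j z0 < 1.
  by move=> zc; apply: R_of_itv; [exact/f_gt0/circle_cdisc|exact: j_gt0].
(* The system carries -(1 - a^2) on the right; dividing by (1 + a)^2, which tends to 4, turns this
   into -eps0. *)
pose A z0 := limit_moment u (R_of f j z0) / 4.
exists A, A; split=> [z0 /Rr /andP[r0 r1]|z0 p t zc comp t0 conc].
  by split; rewrite divr_gt0// limit_moment_gt0.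
have /andP[r0 r1] := Rr _ zc.
have [h11 h12 h22 hE] := concentration_matrix f_smooth f_gt0 j_ext j_gt0 flow zc comp t0 conc.
set r := R_of f j z0 in r0 r1 h11 h12 h22 comp *.
pose v l := pullback (u (t l)) (Phi (p (t l))).
pose c l := (dir (p (t l))).1; pose s l := (dir (p (t l))).2.
pose E l := euclid (p (t l)).
have cs l : c l ^+ 2 + s l ^+ 2 = 1 by exact: dir_circle.
have := rotated_form_cvg cs h11 h12 h22.
set n11 := fun l => _; set n12 := fun l => _; set n22 := fun l => _ => -[k11 k12 k22].
have E0 l : 0 <= E l by exact: sqrtr_ge0.
have hV : (fun l => (1 + E l) ^- 2) @ \oo --> (4^-1 : R).
  have -> : (4 : R) = (1 + 1) ^+ 2 by ring.
  apply: cvgV; first by rewrite expf_neq0// -mulr2n pnatr_eq0.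
  apply: cvgM; apply: cvgD => //; exact: cvg_cst.
have hEV : (fun l => E l * (1 + E l) ^- 2) @ \oo --> (4^-1 : R).
  by rewrite -[X in _ --> X]mul1r; apply: cvgM.
(* The two real rows combine to (n11 + i n12) a' + i (n22 - i n12) a phi'. The off-diagonal entry
   supplies the imaginary parts of the errors, and the factor a of phi' is absorbed as [E l]. *)
exists (fun l => Complex (n11 l * (1 + E l) ^- 2 - A z0) (n12 l * (1 + E l) ^- 2)).
exists (fun l => Complex (n22 l * (E l * (1 + E l) ^- 2) - A z0) (- (n12 l * (E l * (1 + E l) ^- 2)))).
split; [split|split; [split|]].
- rewrite /= -[X in _ --> X](subrr (A z0)); apply: cvgB; [exact: cvgM|exact: cvg_cst].
- by rewrite /= -[X in _ --> X](mul0r 4^-1); apply: cvgM.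
- rewrite /= -[X in _ --> X](subrr (A z0)); apply: cvgB; [exact: cvgM|exact: cvg_cst].
- by rewrite /= -[X in _ --> X]oppr0 -[X in _ --> - X](mul0r 4^-1); apply: cvgN; apply: cvgM.
move=> l th a phi /= hp phi0 ca cphi.
have [da [dphi [ha hphi aE F1 F2]]] := polar_velocity f_smooth flow r0 r1 comp (t0 l) hp phi0 ca cphi.
have [/andP[a0 a1] _] := nbhs_singleton hp.
have [ad aD] := ha; have [pd pD] := hphi; split; [exact: ad|exact: pd|].
rewrite !derive1E aD pD; rewrite -/(v l) -/(c l) -/(s l) -/(n11 l) -/(n12 l) -/(n22 l) in F1 F2.
have EE : E l = a (t l) by [].
have a2 : 1 + a (t l) != 0 by rewrite gt_eqF// ltr_pwDl// ltW.
apply/eqP; rewrite eq_complex /= EE; apply/andP; split; apply/eqP.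
  transitivity ((n11 l * da + n12 l * (a (t l) * dphi)) / (1 + a (t l)) ^+ 2); first by ring.
  by rewrite F1; move: (Xi_coord _ _ _ _ _ _) => X; field.
transitivity ((n12 l * da + n22 l * (a (t l) * dphi)) / (1 + a (t l)) ^+ 2); first by ring.
by rewrite F2; move: (Xi_coord _ _ _ _ _ _) => X; field.
Qed.
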